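(* Let $v,u,\lambda$ be positive integers such that $v,u\geq 5$, $v\leq u$, and $\lambda v\equiv \lambda u\equiv 0\pmod{2}$. Let $M=m_1,m_2,\ldots,m_t$ be a non-decreasing sequence of positive even integers with $2\leq m_1$. Then an $(M)$-cycle decomposition of $\lambda K_{v,u}$ exists if all of the following hold: - $m_t\leq 3m_{t-1}$; - $t\leq \frac{\lambda}{2}vu-m_t+2$ if $\lambda$ is even; - $2\nu_2(M)\leq (\lambda-1)vu$; - $m_{t-1}+m_t\leq 2v+2$ if $v<u$; - $m_{t-1}+m_t\leq 2v$ if $v=u$; - $m_1+m_2+\cdots+m_t=\lambda vu$.
   Context: $\lambda K_{v,u}$ denotes the multigraph with vertex set $V\cup U$ ($V,U$ disjoint, $|V|=v$, $|U|=u$) in which every $x\in V$ and $y\in U$ are joined by exactly $\lambda$ parallel edges and there are no other edges. For $m\geq 2$, an $m$-cycle is a subgraph consisting of $m$ distinct vertices $x_0,\ldots,x_{m-1}$ and one edge joining $x_i$ and $x_{i+1}$ for each $i$ (indices mod $m$); in particular a $2$-cycle consists of two parallel edges between two vertices. An $(M)$-cycle decomposition of a multigraph $G$, for $M=m_1,\ldots,m_t$, is a partition of the edge set of $G$ into $t$ cycles of lengths $m_1,\ldots,m_t$ respectively. $\nu_2(M)$ denotes the number of indices $i$ with $m_i=2$. *)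

(* Defs.v *)
From mathcomp Require Import all_boot.
Set Implicit Arguments. Unset Strict Implicit. Unset Printing Implicit Defensive.

(* The multigraph lam K_{v,u}: vertex set V + U with V = 'I_v, U = 'I_u;
   the lam parallel edges between x in V and y in U are (x, y, k), k : 'I_lam. *)
Definition vtx (v u : nat) := ('I_v + 'I_u)%type.
Definition edge (v u lam : nat) := ('I_v * 'I_u * 'I_lam)%type.

Definition joins v u lam (e : edge v u lam) (a b : vtx v u) : bool :=
  ((a == inl e.1.1) && (b == inr e.1.2)) || ((b == inl e.1.1) && (a == inr e.1.2)).

Definition is_cycle v u lam (m : nat) (c : 'I_m -> edge v u lam) : Prop :=
  2 <= m /\ injective c /\
  exists x : 'I_m -> vtx v u, injective x /\ forall i : 'I_m, joins (c i) (x i) (x (ordS i)).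

Definition cycle_decomposition (v u lam : nat) (M : seq nat) : Prop :=
  exists C : forall i : 'I_(size M), 'I_(nth 0 M i) -> edge v u lam,
    (forall i, is_cycle (C i)) /\
    forall e : edge v u lam,
      exists! p : {i : 'I_(size M) & 'I_(nth 0 M i)}, C (tag p) (tagged p) = e.

Definition nu2 (M : seq nat) : nat := count (pred1 2) M.

(* 1-indexed entry m_i of M, with the convention m_0 = 0 *)
Definition mi (M : seq nat) (i : nat) : nat := if i is j.+1 then nth 0 M j else 0.

(* Main.v *)
(* Cycles of a decomposition are rearranged by switching: for two vertices a, b of the same
   part, exchanging a and b on a suitable set of edges keeps every cycle of the decomposition
   and changes exactly two edges of the leave (the set of edges not used so far).

   Put the edges of a few cycles back into the leave and view it as a union of closed trails
   (tours); let Psi be the number of trails plus the number of repeated vertex positions.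
   Switching a repeated vertex with an unused one shows that a leave with l edges, having a
   repeated vertex and Psi <= T <= l - T, T even, can be turned into two cycles of lengths T
   and l - T, provided l is not too large for an unused vertex to exist: reduce to a chain of
   beads, cut it into two strands with the same ends and of lengths T and l - T, and switch
   these ends; whenever this fails, Psi drops.

   This gives moves such as (c, x, 2, ..., 2) -> (c, x + 2k).  For even lam one starts from
   the decomposition into 2-cycles.  For lam = 1 one starts from a decomposition into
   4-cycles and 6-cycles glued from explicit blocks and merges cycles (h, p, r) ->
   (h, p + r).  For odd lam >= 3 one label carries a decomposition of the simple graph, the
   other labels are paired into 2-cycles, and the moves enlarge the cycles. *)

Require Import Defs.
From mathcomp Require Import all_boot.
From mathcomp Require Import zify.
Set Implicit Arguments. Unset Strict Implicit. Unset Printing Implicit Defensive.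

(** * Walks and vertex transpositions *)

(** A switch starts from one chosen edge of the leave, but the second edge that it changes is
    imposed by the packing. So each move is an alternative, and both outcomes must be progress: the
    wanted configuration, or a state of smaller [Psi].

    The bound [Psi <= T] counts beads. When one repetition is left, the trails form exactly [Psi]
    closed pieces without repetition, and each piece must give at least one edge to each of the two
    strands.

    The factor 3 comes from the simple graph: closed trails have at least 4 edges there, so
    [4 * Psi <= l], and [l <= 4 * T] says that the longer of the two cycles is at most three times
    the shorter. With 2-cycles around, this count is too weak; [Psi] is then bounded by the number
    of absorbed 2-cycles.

    For even [lam] the bound on the number of cycles is equivalent to
    [2 (m_t - 2) <= sum (m_i - 2)], a form that can be preserved while the moves are undone one by
    one. *)

Section Walks.
Variables v u lam : nat.
Notation vtx := (vtx v u).
Notation edge := (edge v u lam).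
Implicit Types (e : edge) (x y z a b w : vtx) (E F : seq edge) (I J : seq vtx).

Definition side x : bool := if x is inl _ then true else false.
Definition inc e x : bool := (x == inl e.1.1) || (x == inr e.1.2).

Lemma joinsC e x y : joins e x y = joins e y x.
Proof. by rewrite /joins orbC. Qed.

Lemma joins_inc e x y z : joins e x y -> inc e z = (z == x) || (z == y).
Proof. by rewrite /inc; case/orP => /andP[/eqP-> /eqP->] //; rewrite orbC. Qed.

Lemma joins_side e x y : joins e x y -> side y = ~~ side x.
Proof. by case/orP => /andP[/eqP-> /eqP->]. Qed.

(* E lists the edges and I the interior vertices. *)
Inductive walk : vtx -> vtx -> seq edge -> seq vtx -> Prop :=
| walk1 x y e : joins e x y -> walk x y [:: e] [::]
| walkS x y z e E I : joins e x y -> walk y z E I -> walk x z (e :: E) (y :: I).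

Lemma walk_cat x y z E F I J : walk x y E I -> walk y z F J ->
  walk x z (E ++ F) (I ++ y :: J).
Proof.
elim=> [x1 y1 e h|x1 y1 z1 e E1 I1 h _ IH] hF /=; first exact: walkS h hF.
exact: walkS h (IH hF).
Qed.

Lemma walk_rev x y E I : walk x y E I -> walk y x (rev E) (rev I).
Proof.
elim=> [x1 y1 e h|x1 y1 z1 e E1 I1 h _ IH]; first by apply: walk1; rewrite joinsC.
rewrite !rev_cons -!cats1; apply: walk_cat IH _.
by apply: walk1; rewrite joinsC.
Qed.

Lemma size_walk x y E I : walk x y E I -> size E = (size I).+1.
Proof. by elim=> //= *; congr _.+1. Qed.

Lemma walk_split x z E I J y : walk x z E (I ++ y :: J) ->
  exists E1 E2, [/\ E = E1 ++ E2, walk x y E1 I & walk y z E2 J].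
Proof.
elim: I x E => [|a I IH] x E hw.
  inversion hw; subst.
  by exists [:: e], E0; split=> //; apply: walk1.
inversion hw; subst.
have [E1 [E2 [-> h1 h2]]] := IH _ _ H5.
by exists (e :: E1), E2; split=> //; apply: walkS h1.
Qed.

Lemma walk_side x y E I : walk x y E I -> side y = side x (+) odd (size E).
Proof.
elim=> [x1 y1 e h|x1 y1 z1 e E1 I1 h _ IH] /=.
  by rewrite (joins_side h) addbT.
by rewrite IH (joins_side h); case: (side x1); case: (odd _).
Qed.

Lemma walk_inc x y E I e z : walk x y E I -> e \in E -> inc e z ->
  z \in x :: y :: I.
Proof.
elim=> [x1 y1 e1 h|x1 y1 z1 e1 E1 I1 h _ IH]; rewrite !inE.
  by move/eqP->; rewrite (joins_inc _ h).
case/orP=> [/eqP->|he hz].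
  by rewrite (joins_inc _ h) => /orP[]->; rewrite ?orbT.
by move: (IH he hz); rewrite !inE => /or3P[]->; rewrite ?orbT.
Qed.

Definition swp a b x : vtx := if x == a then b else if x == b then a else x.

(** For [a] and [b] in the same part, [swp] keeps the part of each end of [e], so both matches take
    their first branch; the fallback values make the function total. The label is kept. *)
Definition tau a b e : edge :=
  let f : edge := ((if swp a b (inl e.1.1) is inl i then i else e.1.1,
     if swp a b (inr e.1.2) is inr j then j else e.1.2), e.2) in f.

Lemma swpK a b : involutive (swp a b).
Proof.
move=> x; rewrite /swp; case: (eqVneq x a) => [->|xa].
  by rewrite eqxx; case: (eqVneq b a) => [->|].
case: (eqVneq x b) => [->|xb]; first by rewrite eqxx.
by rewrite (negbTE xa) (negbTE xb).
Qed.

Lemma swp_side a b x : side a = side b -> side (swp a b x) = side x.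
Proof.
rewrite /swp => h; case: (eqVneq x a) => [->|_] //.
by case: (eqVneq x b) => [->|_].
Qed.

Lemma tauE a b e : side a = side b ->
  inl (tau a b e).1.1 = swp a b (inl e.1.1) /\ inr (tau a b e).1.2 = swp a b (inr e.1.2).
Proof.
move=> h; split=> /=.
  by have := swp_side (inl e.1.1) h; case: (swp a b (inl _)).
by have := swp_side (inr e.1.2) h; case: (swp a b (inr _)).
Qed.

Lemma swp_inj_eq a b x y : (swp a b x == swp a b y) = (x == y).
Proof. exact: (inj_eq (inv_inj (swpK a b))). Qed.

Lemma tau_joins a b e x y : side a = side b ->
  joins (tau a b e) (swp a b x) (swp a b y) = joins e x y.
Proof.
by move=> h; have [h1 h2] := tauE e h; rewrite /joins h1 h2 !swp_inj_eq.
Qed.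

Lemma edge_ext e f : inl e.1.1 = inl f.1.1 :> vtx -> inr e.1.2 = inr f.1.2 :> vtx ->
  e.2 = f.2 -> e = f.
Proof.
by case: e => [[i j] k]; case: f => [[i' j'] k'] /= [->] [->] ->.
Qed.

Lemma tauK a b : side a = side b -> involutive (tau a b).
Proof.
move=> h e; have [h1 h2] := tauE e h; have [h3 h4] := tauE (tau a b e) h.
by apply: edge_ext; rewrite ?h3 ?h4 ?h1 ?h2 ?swpK.
Qed.

Lemma tau_inj a b : side a = side b -> injective (tau a b).
Proof. by move=> h; apply: inv_inj; apply: tauK. Qed.

Lemma swpC a b x : swp a b x = swp b a x.
Proof. by rewrite /swp; case: eqVneq => [->|//]; case: eqVneq. Qed.

Lemma tauC a b e : side a = side b -> tau a b e = tau b a e.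
Proof.
move=> h; have [h1 h2] := tauE e h; have [h3 h4] := tauE e (esym h).
by apply: edge_ext; rewrite ?h1 ?h2 ?h3 ?h4 ?(swpC b).
Qed.

Lemma tau_inc a b e x : side a = side b -> inc (tau a b e) (swp a b x) = inc e x.
Proof. by move=> h; have [h1 h2] := tauE e h; rewrite /inc h1 h2 !swp_inj_eq. Qed.

Lemma tau_id a b e : side a = side b -> ~~ inc e a -> ~~ inc e b -> tau a b e = e.
Proof.
move=> h; rewrite /inc !negb_or => /andP[a1 a2] /andP[b1 b2].
have [h1 h2] := tauE e h; apply: edge_ext => //.
  by rewrite h1 /swp !(eq_sym (inl _)) (negbTE a1) (negbTE b1).
by rewrite h2 /swp !(eq_sym (inr _)) (negbTE a2) (negbTE b2).
Qed.

Lemma inc_side e x y : inc e x -> inc e y -> side x = side y -> x = y.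
Proof. by move=> /orP[]/eqP-> /orP[]/eqP->. Qed.

Lemma swpL a b : swp a b a = b. Proof. by rewrite /swp eqxx. Qed.
Lemma swpR a b : swp a b b = a. Proof. by rewrite swpC swpL. Qed.
Lemma swpD a b x : x != a -> x != b -> swp a b x = x.
Proof. by rewrite /swp => /negbTE-> /negbTE->. Qed.

(** The ends of an edge lie in different parts, so an edge at [a] misses [b]. Freeness from fixed
    points is what the alternating paths of [trail] require. *)
Lemma tau_neq a b e : side a = side b -> a != b -> inc e a -> tau a b e != e.
Proof.
move=> h ab ha; apply: contra ab => /eqP he; apply/eqP.
apply: (@inc_side e) => //.
by have := tau_inc e a h; rewrite he swpL ha => ->.
Qed.

Lemma map_swp_id a b I : a \notin I -> b \notin I -> map (swp a b) I = I.
Proof.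
move=> ha hb; rewrite -[RHS]map_id; apply/eq_in_map => x xI.
by apply: swpD; [apply: contraNneq ha | apply: contraNneq hb] => <-.
Qed.

Lemma walk_map a b x y E I : side a = side b -> walk x y E I ->
  walk (swp a b x) (swp a b y) (map (tau a b) E) (map (swp a b) I).
Proof.
move=> h; elim=> [x1 y1 e j|x1 y1 z1 e E1 I1 j _ IH] /=.
  by apply: walk1; rewrite tau_joins.
by apply: walkS IH; rewrite tau_joins.
Qed.

End Walks.

(** Permutation goals are decided as identities between multiplicities. The [change] step unifies
    counts whose type arguments are convertible but differ syntactically, so that [lia] sees a
    single atom. *)
Ltac count_lia :=
  rewrite -?cats1 /=; repeat progress (rewrite ?count_cat ?count_rev /=);
  repeat match goal with |- context [@count ?T ?a ?l] =>
    match goal with |- context [@count ?T' a l] =>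
      tryif constr_eq T T' then fail else change (@count T' a l) with (@count T a l) end end;
  repeat match goal with |- context [nat_of_bool ?b] => generalize (nat_of_bool b) end;
  repeat match goal with |- context [@count ?T ?a ?l] => generalize (@count T a l) end;
  clear; intros; lia.

Ltac size_lia :=
  repeat progress (rewrite ?size_cat ?size_rev /=);
  repeat match goal with |- context [@size ?T ?l] =>
    match goal with |- context [@size ?T' l] =>
      tryif constr_eq T T' then fail else change (@size T' l) with (@size T l) end end;
  repeat match goal with |- context [@size ?T ?l] => generalize (@size T l) end;
  clear; intros; lia.

Ltac perm_lia := by let q := fresh "q" in apply/permP => q; count_lia.

Ltac perm_from h :=
  let q := fresh "q" in apply/permP => q; move/permP/(_ q): h; count_lia.

(** * Pairings and alternating paths *)

Definition unpairs (T : Type) (P : seq (T * T)) : seq T :=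
  flatten [seq [:: p.1; p.2] | p <- P].

Lemma unpairs_perm (T : eqType) (P Q : seq (T * T)) :
  perm_eq P Q -> perm_eq (unpairs P) (unpairs Q).
Proof. by move=> h; apply: perm_flatten; apply: perm_map. Qed.

Lemma mem_unpairs (T : eqType) (P : seq (T * T)) p :
  p \in P -> (p.1 \in unpairs P) && (p.2 \in unpairs P).
Proof.
move=> h; apply/andP; split; apply/flattenP; exists [:: p.1; p.2];
  by rewrite ?inE ?eqxx ?orbT //; apply: map_f.
Qed.

(* Alternate between the involution t and the pairing P, starting at the unpaired e1:
   the alternating path ends at another unpaired element e2. *)
Lemma trail (T : eqType) (t : T -> T) n (P : seq (T * T)) (L : seq T) e1 :
  involutive t -> size P = n -> uniq (unpairs P ++ L) ->
  {in unpairs P ++ L, forall x, (t x \in unpairs P ++ L) && (t x != x)} ->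
  e1 \in L ->
  exists e2 (S : pred T), [/\ e2 \in L, e2 != e1,
    {in unpairs P ++ L, forall x, S (t x) = S x},
    {in L, forall x, S x = (x == e1) || (x == e2)} &
    {in P, forall p, S p.1 = S p.2}].
Proof.
move=> tK; elim: n P L e1 => [|n IH] P L e1 hn hu ht h1.
  case: P hn hu ht => // _ /= hu ht; have /andP[m2 m3] := ht _ h1.
  exists (t e1), [pred x | (x == e1) || (x == t e1)]; split=> //.
  by move=> x _ /=; rewrite (inj_eq (inv_inj tK)) (can2_eq tK tK) orbC.
have A1 : e1 \in unpairs P ++ L by rewrite mem_cat h1 orbT.
have /andP[m2 m3] := ht _ A1; move: (hu); rewrite cat_uniq => /and3P[uP /hasPn dj uL].
case: (boolP (t e1 \in L)) => [tL|ntL].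
  exists (t e1), [pred x | (x == e1) || (x == t e1)]; split=> //.
    by move=> x _ /=; rewrite (inj_eq (inv_inj tK)) (can2_eq tK tK) orbC.
  move=> p /mem_unpairs/andP[p1 p2] /=.
  have aux x : x \in unpairs P -> (x == e1) || (x == t e1) = false.
    by move=> hx; apply/negP => /orP[]/eqP hh; subst x; have := dj _;
      [move/(_ _ h1)|move/(_ _ tL)]; rewrite /= hx.
  by rewrite !aux.
have tP : t e1 \in unpairs P by move: m2; rewrite mem_cat (negbTE ntL) orbF.
have [p pP hp] : exists2 p, p \in P & (t e1 == p.1) || (t e1 == p.2).
  case/flattenP: tP => s /mapP[p pP ->]; rewrite !inE => h; by exists p.
(* [f] is the partner of [t e1]. Dropping this pair and letting [f] replace [e1] among the unpaired
   elements gives a smaller instance, on the set without [e1] and [t e1], which is still stable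
   under [t]. *)
pose f := if t e1 == p.1 then p.2 else p.1.
have hpp : perm_eq (unpairs P) [:: t e1, f & unpairs (rem p P)].
  apply: perm_trans (unpairs_perm (perm_to_rem pP)) _.
  rewrite /f /unpairs /=; case: eqVneq hp => [->//|_ /=/eqP->].
  by apply/permP => a; count_lia.
have hA : perm_eq (unpairs P ++ L) [:: e1, t e1 & unpairs (rem p P) ++ (f :: rem e1 L)].
  apply/permP => a; move/permP/(_ a): hpp; move/permP/(_ a): (perm_to_rem h1).
  by rewrite !count_cat /= !count_cat /= => -> ->; count_lia.
set A' := unpairs (rem p P) ++ (f :: rem e1 L) in hA.
have := hu; rewrite (perm_uniq hA) /= !inE !negb_or => /and3P[/andP[_ n1] n2 uA'].
have sA x : x \in A' -> x \in unpairs P ++ L by move=> h; rewrite (perm_mem hA) !inE h !orbT.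
have ne x : x \in A' -> (x != e1) && (x != t e1).
  by move=> h; apply/andP; split; apply: contraTneq h => ->.
have tA' : {in A', forall x, (t x \in A') && (t x != x)}.
  move=> x xA; have /andP[h ->] := ht _ (sA _ xA); rewrite andbT.
  move: h; rewrite (perm_mem hA) !inE; have /andP[x1 x2] := ne _ xA.
  rewrite (can2_eq tK tK) (negbTE x2) (inj_eq (inv_inj tK)) (negbTE x1) /=; by [].
have fL : f \notin L.
  have fu : f \in unpairs P by rewrite (perm_mem hpp) !inE eqxx orbT.
  by apply: contraL fu => fL; apply: dj.
have sr : size (rem p P) = n by rewrite size_rem // hn.
have fr : f \in f :: rem e1 L by rewrite inE eqxx.
have [e2 [S [e2L e2f Sc SL SP]]] := IH (rem p P) (f :: rem e1 L) f sr uA' tA' fr.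
have e2r : e2 \in rem e1 L by move: e2L; rewrite inE (negbTE e2f).
exists e2, [pred x | [|| x == e1, x == t e1 | S x]]; split.
- exact: mem_rem e2r.
- by apply: contraTneq e2r => ->; rewrite mem_rem_uniq // inE eqxx.
- move=> x; rewrite (perm_mem hA) !inE /= (inj_eq (inv_inj tK)) (can2_eq tK tK).
  case/or3P => [/eqP->|/eqP->|xA]; rewrite ?eqxx ?orbT //.
  by rewrite Sc // orbCA.
- move=> x xL /=; case: (eqVneq x e1) => [->//|xe].
  have xt : (x == t e1) = false by apply: contraNF ntL => /eqP<-.
  rewrite xt /= SL; last by rewrite inE mem_rem_uniq // inE xe xL orbT.
  by case: eqVneq => // xf; rewrite -xf xL in fL.
- move=> q qP; case: (eqVneq q p) => [->|qp] /=.
    have Sf : S f by rewrite SL ?inE ?eqxx.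
    have hh : (p.1 == t e1) && (p.2 == f) || (p.2 == t e1) && (p.1 == f).
      by move: hp; rewrite /f !(eq_sym _ (t e1)); case: eqVneq => [->|_ /= ->]; rewrite eqxx ?orbT.
    by case/orP: hh => /andP[/eqP-> /eqP->]; rewrite eqxx !Sf !orbT.
  have qr : q \in rem p P.
    have : perm_eq P (p :: rem p P) by apply: perm_to_rem.
    by move/perm_mem/(_ q); rewrite qP inE (negbTE qp).
  have /andP[q1 q2] := mem_unpairs qr.
  rewrite SP //.
  have /andP[/negbTE-> /negbTE->] : (q.1 != e1) && (q.1 != t e1) by apply: ne; rewrite mem_cat q1.
  by have /andP[/negbTE-> /negbTE->] : (q.2 != e1) && (q.2 != t e1) by apply: ne;
    rewrite mem_cat q2.
Qed.

(** * Cycle switching *)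

Section Switch.
Variables v u lam : nat.
Notation vtx := (vtx v u).
Notation edge := (edge v u lam).
Implicit Types (e : edge) (x y z a b w : vtx) (E F : seq edge) (I J : seq vtx).

Definition cyc E : Prop := exists x I, [/\ walk x x E I, uniq (x :: I) & uniq E].

Lemma walk_inv x y E I : walk x y E I ->
  (exists e, [/\ E = [:: e], I = [::] & joins e x y]) \/
  exists e z E' I', [/\ E = e :: E', I = z :: I', joins e x z & walk z y E' I'].
Proof.
case=> [x1 y1 e h|x1 y1 z1 e E1 I1 h h1]; first by left; exists e.
by right; exists e, y1, E1, I1.
Qed.

Lemma walk_ends x y E I : walk x y E I -> I != [::] -> exists e1 M e2 z z',
  [/\ E = e1 :: rcons M e2, joins e1 x z, joins e2 z' y, (z \in I) && (z' \in I) &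
   forall e w, e \in M -> inc e w -> w \in I].
Proof.
case/walk_inv => [[e [_ -> _]] //|[e [z [E1 [I1 [-> -> j1 w1]]]]] _].
case/walk_inv: (walk_rev w1) => [[f [hE hI j2]]|[f [z' [E2 [I2 [hE hI j2 w2]]]]]].
  exists e, [::], f, z, z; rewrite -[E1]revK hE -[I1]revK hI; split=> //; first by rewrite joinsC.
  by rewrite inE eqxx.
exists e, (rev E2), f, z, z'; rewrite -[E1]revK hE -[I1]revK hI !rev_cons; split=> //.
- by rewrite joinsC.
- by rewrite mem_head inE mem_rcons mem_head orbT.
move=> e' w; rewrite mem_rev => he' hi; have := walk_inc w2 he' hi.
by rewrite !inE mem_rcons inE mem_rev => /or3P[]->; rewrite ?orbT.
Qed.

Lemma walk_rot x E I J y : walk x x E (I ++ y :: J) ->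
  exists E1 E2, [/\ E = E1 ++ E2, walk y y (E2 ++ E1) (J ++ x :: I), walk x y E1 I & walk y x E2 J].
Proof.
move=> h; have [E1 [E2 [-> h1 h2]]] := walk_split h.
by exists E1, E2; split=> //; apply: walk_cat h2 h1.
Qed.

(** [S] selects the edges on which [a] and [b] are exchanged. When [S] is stable under [tau], this
    is an injection of the whole edge set, so it maps a packing to a packing. *)
Definition phi a b (S : pred edge) e : edge := if S e then tau a b e else e.

Lemma phi_inj a b (S : pred edge) : side a = side b -> (forall e, S (tau a b e) = S e) ->
  injective (phi a b S).
Proof.
move=> h hS e f; rewrite /phi.
case Se: (S e); case Sf: (S f) => // he.
- exact: tau_inj h _ _ he.
- by rewrite -hS he Sf in Se.
- by rewrite he hS Sf in Se.
Qed.

Lemma map_phi_all a b (S : pred edge) E : {in E, forall e, inc e a || inc e b -> S e} ->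
  side a = side b -> map (phi a b S) E = map (tau a b) E.
Proof.
move=> h hs; apply/eq_in_map => e eE; rewrite /phi; case Se: (S e) => //.
have := contraFN (h e eE) Se; rewrite negb_or => /andP[ha hb].
by rewrite tau_id.
Qed.

Lemma map_phi_none a b (S : pred edge) E : {in E, forall e, inc e a || inc e b -> ~~ S e} ->
  side a = side b -> map (phi a b S) E = E.
Proof.
move=> h hs; rewrite -[RHS]map_id; apply/eq_in_map => e eE; rewrite /phi.
case Se: (S e) => //.
have := contraTN (h e eE) Se; rewrite negb_or => /andP[ha hb].
by rewrite tau_id.
Qed.

Lemma filter_ends a b e1 M e2 I (z z' : vtx) :
  (inc e1 a || inc e1 b) -> (inc e2 a || inc e2 b) ->
  (forall e w, e \in M -> inc e w -> w \in I) -> a \notin I -> b \notin I ->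
  [seq e <- e1 :: rcons M e2 | inc e a || inc e b] = [:: e1; e2].
Proof.
move=> h1 h2 hM ha hb; rewrite /= h1 filter_rcons h2.
suff -> : [seq e <- M | inc e a || inc e b] = [::] by [].
apply/eqP; rewrite -[_ == _]negbK -has_filter; apply/hasPn => e eM.
by rewrite negb_or; apply/andP; split; [move: ha|move: hb]; apply: contra; apply: hM.
Qed.

Lemma walk_ne x y E I : walk x y E I -> side x = side y -> I != [::].
Proof. by case=> // x1 y1 e /joins_side ->; case: side. Qed.

(** The pairs are the end edges of the arcs that [a] and [b] cut out of the cycle. With one of the
    two vertices on the cycle, switching its two edges replaces that vertex by the other. With both
    on it, there are two arcs from [a] to [b], and switching both end edges of an arc inserts it in
    the opposite direction. *)
Lemma flip a b E : side a = side b -> a != b -> cyc E ->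
  exists P, perm_eq (unpairs P) [seq e <- E | inc e a || inc e b] /\
  forall S : pred edge, (forall e, S (tau a b e) = S e) -> {in P, forall p, S p.1 = S p.2} ->
  exists E', cyc E' /\ perm_eq E' (map (phi a b S) E).
Proof.
move=> hs ab [x [I [hw hu uE]]].
have hsc E' (S : pred edge) : (forall e, S (tau a b e) = S e) ->
  perm_eq E' (map (phi a b S) E) -> uniq E'.
  by move=> hS hp; rewrite (perm_uniq hp) map_inj_uniq //; apply: phi_inj.
have rebase y : y \in x :: I ->
  exists E' I', [/\ walk y y E' I', uniq (y :: I'), perm_eq E E' & perm_eq (x :: I) (y :: I')].
  rewrite inE => /orP[/eqP->|/splitPr hI]; first by exists E, I; rewrite !perm_refl.
  case: hI hw hu => p1 p2 hw hu; have [E1 [E2 [-> h1 _ _]]] := walk_rot hw.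
  have hp : perm_eq (x :: p1 ++ y :: p2) (y :: p2 ++ x :: p1).
    by rewrite -cat_cons perm_catC.
  by exists (E2 ++ E1), (p2 ++ x :: p1); rewrite -(perm_uniq hp) perm_catC.
(* The case of exactly one of the two vertices on the cycle, stated for [c] and [d] so that it
   serves both orders of [a] and [b]. *)
have one c d : side c = side d -> c != d ->
  (fun z => (z == c) || (z == d)) =1 (fun z => (z == a) || (z == b)) ->
  c \in x :: I -> d \notin x :: I ->
    exists P, perm_eq (unpairs P) [seq e <- E | inc e a || inc e b] /\
  forall S : pred edge, (forall e, S (tau a b e) = S e) -> {in P, forall p, S p.1 = S p.2} ->
  exists E', cyc E' /\ perm_eq E' (map (phi a b S) E).
  move=> scd cd hcd cI dI; have [E' [I' [hw' hu' pE pI]]] := rebase _ cI.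
  have hab e : inc e a || inc e b = inc e c || inc e d.
    have := hcd a; have := hcd b; rewrite !eqxx !orbT /= => /orP[]/eqP h1 /orP[]/eqP h2; subst;
      rewrite ?eqxx in ab cd; rewrite ?orbb //; exact: orbC.
  have [e1 [M [e2 [z [z' [hE j1 j2 _ hM]]]]]] := walk_ends hw' (walk_ne hw' erefl).
  have cI' : c \notin I' by case/andP: hu'.
  have dI' : d \notin I' by move: dI; rewrite (perm_mem pI) inE negb_or => /andP[].
  have hf : [seq e <- E' | inc e c || inc e d] = [:: e1; e2].
    rewrite hE; apply: filter_ends hM _ _ => //; first by rewrite (joins_inc _ j1) eqxx.
    by rewrite (joins_inc _ j2) eqxx orbT.
  exists [:: (e1, e2)]; split.
    rewrite (eq_filter hab) /unpairs /= -hf; apply: perm_filter; by rewrite perm_sym.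
  move=> S hS /(_ (e1, e2)); rewrite inE eqxx => /(_ isT) /= S12.
  case S1: (S e1).
    have hmp : map (phi a b S) E' = map (tau a b) E'.
      apply: map_phi_all => // e eE; rewrite hab => hi.
      have : e \in [seq e <- E' | inc e c || inc e d] by rewrite mem_filter hi.
      by rewrite hf !inE => /orP[]/eqP->; rewrite -?S12.
    have pp : perm_eq (map (tau a b) E') (map (phi a b S) E) by rewrite -hmp; apply: perm_map;
      rewrite perm_sym.
    exists (map (tau a b) E'); split=> //.
    exists (swp a b c), (map (swp a b) I'); split; first exact: walk_map.
      by rewrite -[_ :: _]/(map (swp a b) (c :: I')) map_inj_uniq //; apply: inv_inj; apply: swpK.
    exact: hsc _ S hS pp.
  exists E; split; first by exists x, I.
  have hmp : map (phi a b S) E' = E'.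
    apply: map_phi_none => // e eE; rewrite hab => hi.
    have : e \in [seq e <- E' | inc e c || inc e d] by rewrite mem_filter hi.
    by rewrite hf !inE => /orP[]/eqP->; rewrite -?S12 S1.
  apply: (perm_trans pE); rewrite -[X in perm_eq X _]hmp perm_sym; exact: (perm_map _ pE).
case aI: (a \in x :: I); case bI: (b \in x :: I); last 1 first.
- exists [::]; have hno e : e \in E -> ~~ (inc e a || inc e b).
    move=> eE; apply/negP => /orP[]/(walk_inc hw eE).
      by rewrite inE aI eq_sym orbF => /eqP h; move: aI; rewrite !inE h eqxx.
    by rewrite inE bI orbF => /eqP h; move: bI; rewrite !inE h eqxx.
  split.
    rewrite /unpairs /=; suff -> : [seq e <- E | inc e a || inc e b] = [::] by [].
    by apply/eqP; rewrite -[_ == _]negbK -has_filter; apply/hasPn.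
  move=> S hS _; exists E; split; first by exists x, I.
  by rewrite map_phi_none // => e eE; rewrite (negbTE (hno e eE)).
- have [E' [I' [hw' hu' pE pI]]] := rebase _ aI.
  have bI' : b \in I' by move: bI; rewrite (perm_mem pI) inE eq_sym (negbTE ab).
  case/splitPr: bI' hw' hu' pI => I1 I2 hw' hu' pI.
  have [E1 [E2 [hE _ w1 w2]]] := walk_rot hw'.
  move: (hu'); rewrite cons_uniq mem_cat inE !negb_or => /andP[/and3P[aI1 _ aI2]].
  rewrite cat_uniq => /and3P[_ /hasPn dj /andP[bI2 _]].
  have bI1 : b \notin I1 by apply: dj; rewrite inE eqxx.
  have [e1 [M [e2 [z [z' [hE1 j1 j2 _ hM]]]]]] := walk_ends w1 (walk_ne w1 hs).
  have [f1 [N [f2 [y [y' [hE2 k1 k2 _ hN]]]]]] := walk_ends w2 (walk_ne w2 (esym hs)).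
  have F1 : [seq e <- E1 | inc e a || inc e b] = [:: e1; e2].
    rewrite hE1; apply: filter_ends hM _ _ => //; first by rewrite (joins_inc _ j1) eqxx.
    by rewrite !(joins_inc _ j2) eqxx !orbT.
  have F2 : [seq e <- E2 | inc e a || inc e b] = [:: f1; f2].
    rewrite hE2; apply: filter_ends hN _ _ => //; first by rewrite !(joins_inc _ k1) eqxx orbT.
    by rewrite (joins_inc _ k2) eqxx !orbT.
  exists [:: (e1, e2); (f1, f2)]; split.
    rewrite /unpairs /= -[_ :: _]/([:: e1; e2] ++ [:: f1; f2]) -F1 -F2 -filter_cat -hE.
    by apply: perm_filter; rewrite perm_sym.
  move=> S hS hP.
  have S1 : S e1 = S e2 by apply: (hP (e1, e2)); rewrite !inE eqxx.
  have S2 : S f1 = S f2 by apply: (hP (f1, f2)); rewrite !inE eqxx orbT.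
  (* An arc between the two vertices: exchanging them turns it into a walk in the other direction,
     so its reverse has the original ends. *)
  have key c d E0 I0 g1 g2 : (c, d) = (a, b) \/ (c, d) = (b, a) -> walk c d E0 I0 ->
      a \notin I0 -> b \notin I0 ->
      [seq e <- E0 | inc e a || inc e b] = [:: g1; g2] -> S g1 = S g2 ->
      exists E0' I0', [/\ walk c d E0' I0', perm_eq I0' I0 & perm_eq E0' (map (phi a b S) E0)].
    move=> hcd w0 na nb hf hSg; case Sg: (S g1).
      exists (rev (map (tau a b) E0)), (rev (map (swp a b) I0)); split.
      - have := walk_rev (walk_map hs w0).
        by case: hcd => -[-> ->]; rewrite swpL swpR.
      - by rewrite map_swp_id // perm_rev.
      - rewrite (@map_phi_all _ _ S) ?perm_rev // => e eE hi.
        have : e \in [seq e <- E0 | inc e a || inc e b] by rewrite mem_filter hi.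
        by rewrite hf !inE => /orP[]/eqP->; rewrite -?hSg.
    exists E0, I0; split=> //.
    rewrite map_phi_none // => e eE hi.
    have : e \in [seq e <- E0 | inc e a || inc e b] by rewrite mem_filter hi.
    by rewrite hf !inE => /orP[]/eqP->; rewrite -?hSg Sg.
  have [E1' [I1' [w1' pI1 pE1]]] := key _ _ _ _ _ _ (or_introl erefl) w1 aI1 bI1 F1 S1.
  have [E2' [I2' [w2' pI2 pE2]]] := key _ _ _ _ _ _ (or_intror erefl) w2 aI2 bI2 F2 S2.
  have pp : perm_eq (E1' ++ E2') (map (phi a b S) E).
    apply: (@perm_trans _ (map (phi a b S) E')); last by apply: perm_map; rewrite perm_sym.
    by rewrite hE map_cat; apply: perm_cat.
  exists (E1' ++ E2'); split=> //; exists a, (I1' ++ b :: I2'); split.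
  + exact: walk_cat w1' w2'.
  + rewrite -(perm_uniq (s1 := a :: I1 ++ b :: I2)) // perm_cons.
    by apply: perm_cat; rewrite ?perm_cons perm_sym.
  + exact: hsc _ S hS pp.
- by apply: (one a b); rewrite ?aI ?bI.
- apply: (one b a); rewrite ?aI ?bI //; first by rewrite eq_sym.
  by move=> z; rewrite orbC.
Qed.

(* E is the leave of a packing with cycles of lengths N. *)
Definition reach (N : seq nat) E : Prop := exists Cs : seq (seq edge),
  [/\ forall C, C \in Cs -> cyc C, perm_eq (map size Cs) N &
      perm_eq (flatten Cs ++ E) (enum {: edge})].

Lemma reach_perm N N' E E' : perm_eq N N' -> perm_eq E E' -> reach N E -> reach N' E'.
Proof.
move=> hN hE [Cs [h1 h2 h3]]; exists Cs; split=> //; first exact: perm_trans h2 hN.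
by apply: perm_trans h3; rewrite perm_cat2l perm_sym.
Qed.

Lemma reach_uniq N E : reach N E -> uniq E.
Proof.
move=> [Cs [_ _ h]]; have := enum_uniq {: edge}; rewrite -(perm_uniq h) cat_uniq.
by case/and3P.
Qed.

Lemma absorb m N E : reach (m :: N) E -> exists C, [/\ cyc C, size C = m & reach N (C ++ E)].
Proof.
move=> [Cs [h1 h2 h3]]; have : m \in map size Cs by rewrite (perm_mem h2) inE eqxx.
case/mapP => C CC hm; exists C; split=> //; first exact: h1.
have pC := perm_to_rem CC; exists (rem C Cs); split.
- by move=> D /mem_rem; apply: h1.
- by have := perm_map size pC; rewrite (permPl h2) /= -hm perm_cons perm_sym.
- apply: perm_trans h3; rewrite (permPr (perm_cat (perm_flatten pC) (perm_refl E))) /=.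
  by rewrite perm_catCA catA perm_refl.
Qed.

Lemma emit C N E : cyc C -> reach N (C ++ E) -> reach (size C :: N) E.
Proof.
move=> hC [Cs [h1 h2 h3]]; exists (C :: Cs); split=> /=.
- by move=> D; rewrite inE => /orP[/eqP->|/h1].
- by rewrite perm_cons.
- by apply: perm_trans h3; rewrite -catA perm_catCA.
Qed.

Lemma pairs_all a b (Cs : seq (seq edge)) : side a = side b -> a != b ->
  (forall C, C \in Cs -> cyc C) ->
  exists P, perm_eq (unpairs P) [seq e <- flatten Cs | inc e a || inc e b] /\
  forall S : pred edge, (forall e, S (tau a b e) = S e) -> {in P, forall p, S p.1 = S p.2} ->
  exists Cs', [/\ forall C, C \in Cs' -> cyc C, map size Cs' = map size Cs &
     perm_eq (flatten Cs') (map (phi a b S) (flatten Cs))].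
Proof.
move=> hs ab; elim: Cs => [|C Cs IH] hC.
  by exists [::]; split=> // S _ _; exists [::].
have [P1 [p1 h1]] := flip hs ab (hC C (mem_head _ _)).
have [|P2 [p2 h2]] := IH; first by move=> D hD; apply: hC; rewrite inE hD orbT.
exists (P1 ++ P2); split.
  by rewrite /unpairs map_cat flatten_cat filter_cat; apply: perm_cat.
move=> S hS hP.
have [|C' [c1 c2]] := h1 S hS; first by move=> p hp; apply: hP; rewrite mem_cat hp.
have [|Cs' [d1 d2 d3]] := h2 S hS; first by move=> p hp; apply: hP; rewrite mem_cat hp orbT.
exists (C' :: Cs'); split=> /=.
- by move=> D; rewrite inE => /orP[/eqP->|/d1].
- by rewrite d2 (perm_size c2) size_map.
- by rewrite map_cat; apply: perm_cat.
Qed.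

(** Among the edges at [a] or [b], those in cycles of the packing are paired by [flip] and those of
    the leave are unpaired. The alternating path of [tau] and this pairing that starts at [e1] ends
    at another leave edge [e2]; applying [tau] along the path keeps every cycle. *)
Lemma switch a b N E e1 : reach N E -> side a = side b -> a != b -> e1 \in E ->
  inc e1 a || inc e1 b -> exists e2 E', [/\ perm_eq E [:: e1, e2 & E'],
    inc e2 a || inc e2 b & reach N [:: tau a b e1, tau a b e2 & E']].
Proof.
move=> hR hs ab e1E i1; case: (hR) => Cs [h1 h2 h3].
have [P [pP hP]] := pairs_all hs ab h1.
pose ii := fun e => inc e a || inc e b; pose L := filter ii E.
have pA : perm_eq (unpairs P ++ L) (filter ii (enum {: edge})).
  rewrite (permPl (perm_cat pP (perm_refl L))) /L -filter_cat.
  exact: perm_filter.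
have inA e : (e \in unpairs P ++ L) = ii e by rewrite (perm_mem pA) mem_filter mem_enum andbT.
have it e : ii (tau a b e) = ii e.
  by rewrite /ii -[inc e a](tau_inc e a hs) -[inc e b](tau_inc e b hs) swpL swpR orbC.
have uA : uniq (unpairs P ++ L) by rewrite (perm_uniq pA) filter_uniq // enum_uniq.
have tA : {in unpairs P ++ L, forall e, (tau a b e \in unpairs P ++ L) && (tau a b e != e)}.
  move=> e; rewrite !inA it => he; rewrite he /=.
  case/orP: he => hi; first exact: tau_neq.
  by rewrite tauC //; apply: tau_neq; rewrite // eq_sym.
have e1L : e1 \in L by rewrite mem_filter /ii i1.
have [e2 [S [e2L e21 Sc SL SP]]] := trail (tauK hs) erefl uA tA e1L.
(* [trail] controls [S] only on edges at [a] or [b]; elsewhere the selection is set to false. *)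
pose S0 e := ii e && S e.
have S0c e : S0 (tau a b e) = S0 e.
  by rewrite /S0 it; case he: (ii e) => //=; apply: Sc; rewrite inA.
have [|Cs' [d1 d2 d3]] := hP S0 S0c.
  move=> p pp; have /andP[q1 q2] := mem_unpairs pp.
  have ie q : q \in unpairs P -> ii q by move=> hq; rewrite -inA mem_cat hq.
  by rewrite /S0 !ie //= SP.
have S1 : S e1 by rewrite SL // eqxx.
have S2 : S e2 by rewrite SL // eqxx orbT.
move: e2L; rewrite mem_filter => /andP[i2 e2E].
have pE : perm_eq E [:: e1, e2 & rem e2 (rem e1 E)].
  rewrite (permPl (perm_to_rem e1E)) perm_cons; apply: perm_to_rem.
  by rewrite mem_rem_uniq ?(reach_uniq hR) // inE e21.
exists e2, (rem e2 (rem e1 E)); split=> //; exists Cs'; split=> //; first by rewrite d2.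
have hmap : perm_eq (map (phi a b S0) E) [:: tau a b e1, tau a b e2 & rem e2 (rem e1 E)].
  rewrite (permPl (perm_map _ pE)) /= /phi /S0 /ii i1.
  move: i2; rewrite /ii => ->; rewrite S1 S2 !perm_cons.
  suff -> : [seq phi a b S0 i | i <- rem e2 (rem e1 E)] = rem e2 (rem e1 E) by [].
  rewrite -[RHS]map_id; apply/eq_in_map => e he; rewrite /phi.
  have := reach_uniq hR; rewrite (perm_uniq pE) /= inE negb_or => /and3P[/andP[_ n1] n2 _].
  have eE : e \in E by rewrite (perm_mem pE) !inE he !orbT.
  rewrite /S0; case he' : (ii e) => //=; rewrite SL ?mem_filter ?he' ?eE //.
  have /negbTE-> : e != e1 by apply: contraTneq he => ->.
  by have /negbTE-> : e != e2 by apply: contraTneq he => ->.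
rewrite (permPl (perm_cat d3 (perm_refl _))).
apply: (@perm_trans _ (map (phi a b S0) (flatten Cs ++ E))).
  by rewrite map_cat perm_cat2l perm_sym.
rewrite (permPl (perm_map _ h3)).
apply: uniq_perm; rewrite ?enum_uniq //.
  by rewrite map_inj_uniq ?enum_uniq //; apply: phi_inj.
move=> e; rewrite mem_enum; apply/mapP.
exists (phi a b S0 e); first by rewrite mem_enum.
by rewrite /phi; case he: (S0 e); rewrite ?S0c he // tauK.
Qed.

(** What the reduction of tours uses about leaves. It is abstracted because the reduction is applied
    both to [reach N] and to [reach_labels N L], which also remembers the labels of the leave. *)
Record switching (Q : seq edge -> Prop) : Prop := Switching {
  sw_perm : forall E E', perm_eq E E' -> Q E -> Q E';
  sw_uniq : forall E, Q E -> uniq E;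
  sw_switch : forall a b E e1, Q E -> side a = side b -> a != b -> e1 \in E ->
    inc e1 a || inc e1 b -> exists e2 E', [/\ perm_eq E [:: e1, e2 & E'],
    inc e2 a || inc e2 b & Q [:: tau a b e1, tau a b e2 & E']] }.

Lemma switching_reach N : switching (reach N).
Proof.
split=> [E E' pE|E|a b E e1 hR hs ab]; [exact: reach_perm|exact: reach_uniq|exact: switch].
Qed.

Definition reach_labels N (L : seq 'I_lam) E := reach N E /\ perm_eq (map snd E) L.

Lemma switching_labels N (L : seq 'I_lam) : switching (reach_labels N L).
Proof.
split=> [E E' pE [h1 h2]|E [h _]|a b E e1 [hR hL] hs ab h1 i1].
- split; first exact: reach_perm h1.
  by apply: perm_trans h2; apply: perm_map; rewrite perm_sym.
- exact: reach_uniq h.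
have [e2 [E' [pE i2 hR']]] := switch hR hs ab h1 i1.
exists e2, E'; split=> //; split=> //.
by apply: perm_trans hL; rewrite perm_sym (permPl (perm_map snd pE)).
Qed.

End Switch.

(** * Tours *)

Section Tours.
Variables v u lam : nat.
Notation vtx := (vtx v u).
Notation edge := (edge v u lam).
Implicit Types (e : edge) (x y z a b w : vtx) (E F G Z : seq edge) (I J S Vs : seq vtx).

(* Vs is the multiset of vertices visited, one for each edge. *)
Definition tour E Vs : Prop := exists x E' I,
  [/\ walk x x E' I, perm_eq E' E & perm_eq (x :: I) Vs].

Lemma tour_walk x E I : walk x x E I -> tour E (x :: I).
Proof. by move=> h; exists x, E, I; rewrite !perm_refl. Qed.

Lemma tour_perm E E' Vs Vs' : perm_eq E E' -> perm_eq Vs Vs' -> tour E Vs -> tour E' Vs'.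
Proof.
move=> hE hV [x [F [I [h1 h2 h3]]]]; exists x, F, I.
by rewrite (perm_trans h2 hE) (perm_trans h3 hV).
Qed.

Lemma tour_at E Vs y : tour E Vs -> y \in Vs -> exists E' I,
  [/\ walk y y E' I, perm_eq E' E & perm_eq (y :: I) Vs].
Proof.
move=> [x [F [I [h1 h2 h3]]]]; rewrite -(perm_mem h3) inE.
case/orP => [/eqP->|/splitPr hI]; first by exists F, I.
case: hI h1 h3 => p1 p2 h1 h3; have [E1 [E2 [hF hw _ _]]] := walk_rot h1.
exists (E2 ++ E1), (p2 ++ x :: p1); split=> //.
  by apply: perm_trans h2; rewrite hF perm_catC.
by apply: perm_trans h3; rewrite -!cat_cons perm_catC.
Qed.

Lemma tour_size E Vs : tour E Vs -> size Vs = size E.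
Proof.
by move=> [x [F [I [/size_walk h1 /perm_size <- /perm_size <-]]]].
Qed.

Lemma tour_inc E Vs e y : tour E Vs -> e \in E -> inc e y -> y \in Vs.
Proof.
move=> [x [F [I [h1 h2 h3]]]]; rewrite -(perm_mem h2) -(perm_mem h3) => he hy.
by have := walk_inc h1 he hy; rewrite !inE orbA orbb.
Qed.

Lemma tour_cat E F Vs Ws y : tour E Vs -> tour F Ws -> y \in Vs -> y \in Ws ->
  tour (E ++ F) (Vs ++ Ws).
Proof.
move=> hE hF yV yW; have [E' [I [h1 h2 h3]]] := tour_at hE yV.
have [F' [J [k1 k2 k3]]] := tour_at hF yW.
exists y, (E' ++ F'), (I ++ y :: J); split; first exact: walk_cat h1 k1.
  exact: perm_cat.
by rewrite -cat_cons; apply: perm_cat.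
Qed.

Lemma walk_first x y e E I : walk x y (e :: E) I ->
  (E = [::] /\ joins e x y /\ I = [::]) \/
  exists z I', [/\ joins e x z, walk z y E I' & I = z :: I'].
Proof.
by case/walk_inv => [[f [[<- ->] -> h]]|[f [z [E' [I' [[<- <-] -> h1 h2]]]]]];
  [left|right; exists z, I'].
Qed.

(** Rotate the trail until it starts with [e]; if it then departs from the other end of [e], reverse
    the rest. *)
Lemma tour_edge E Vs e y : tour E Vs -> e \in E -> inc e y -> exists E' I,
  [/\ walk y y (e :: E') I, perm_eq (e :: E') E & perm_eq (y :: I) Vs].
Proof.
move=> [x [F [I [h1 h2 h3]]]]; rewrite -(perm_mem h2) => eF hy.
have {h1} [p [F' [I' [h1 hF hI]]]] : exists p F' I', [/\ walk p p (e :: F') I',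
    perm_eq (e :: F') F & perm_eq (p :: I') (x :: I)].
  case/splitPr: eF h1 {h2 h3} => E1 E2.
  elim: E1 E2 x I => [|f E1 IH] E2 x I h; first by exists x, E2, I.
  case/walk_first: h => [[] | [z [I1 [j w ->]]]]; first by case: E1 {IH}.
  have hw : walk z z (E1 ++ e :: (E2 ++ [:: f])) (I1 ++ [:: x]).
    rewrite -[e :: _]/((e :: E2) ++ [:: f]) catA; apply: walk_cat w _.
    exact: walk1.
  have [p [F' [I' [h1 hF hI]]]] := IH _ _ _ hw; exists p, F', I'; split=> //.
    by apply: (perm_trans hF); perm_lia.
  by apply: (perm_trans hI); perm_lia.
have [pE pI] : perm_eq (e :: F') E /\ perm_eq (p :: I') Vs.
  by split; [apply: perm_trans hF h2 | apply: perm_trans hI h3].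
case/walk_first: (h1) => [[_ [j _]]|[q [I2 [j w hI2]]]].
  by have := joins_side j; case: side.
move: hy; rewrite (joins_inc _ j) => /orP[]/eqP->; first by exists F', I'.
exists (rev F'), (p :: rev I2); split.
- by apply: walkS (walk_rev w); rewrite joinsC.
- by apply: perm_trans pE; rewrite perm_cons perm_rev.
- by apply: perm_trans pI; rewrite hI2; perm_lia.
Qed.

(** The second end of the first edge lies in the opposite part, so [tau] moves only the starting
    point. *)
Lemma walk_swap_first a b e E I y : side a = side b -> walk a y (e :: E) I ->
  walk b y (tau a b e :: E) I.
Proof.
move=> hs /walk_first hw.
have js z : joins e a z -> joins (tau a b e) b z.
  move=> j; have := tau_joins e a z hs; rewrite j swpL.
  have sz := joins_side j.
  rewrite swpD //; apply/eqP => hz; move: sz; rewrite hz ?hs; by case: side.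
by case: hw => [[-> [j ->]]|[z [I' [j w ->]]]]; [apply: walk1|apply: walkS w]; apply: js.
Qed.

Lemma walk_size1 x E I : walk x x E I -> exists e E', E = e :: E' /\ E' != [::].
Proof.
move=> h; case/walk_inv: (h) => [[e [-> _ j]]|[e [z [E' [I' [-> _ _ w]]]]]].
  by have := joins_side j; case: side.
by exists e, E'; split=> //; case: E' w => // /size_walk.
Qed.

Variable Q : seq edge -> Prop.
Hypothesis hQ : switching Q.

(* One step of cycle switching that tries to move the closed walk Z from b to a:
   either all of Z moves, or only its first edge does, together with one edge of G. *)
Lemma pull a b Z Iz G : Q (Z ++ G) -> walk b b Z Iz -> b \notin Iz -> a \notin Iz ->
  side a = side b -> a != b ->
  (exists Z', [/\ walk a a Z' Iz, size Z' = size Z & Q (Z' ++ G)]) \/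
  exists e2 G' Z1, [/\ perm_eq G (e2 :: G'), inc e2 a || inc e2 b, walk a b Z1 Iz,
     size Z1 = size Z & Q (Z1 ++ tau a b e2 :: G')].
Proof.
move=> hR hw bI aI hs ab.
have [e1 [M [eL [z [z' [hZ j1 j2 _ hM]]]]]] := walk_ends hw (walk_ne hw erefl).
have e1in : e1 \in Z ++ G by rewrite hZ inE eqxx.
have i1 : inc e1 a || inc e1 b by rewrite !(joins_inc _ j1) eqxx orbT.
have [e2 [E' [pE i2 hR']]] := sw_switch hQ hR hs ab e1in i1.
have uE := sw_uniq hQ hR.
have pE2 : perm_eq (rcons M eL ++ G) (e2 :: E').
  by move: pE; rewrite hZ /= perm_cons.
have e2in : e2 \in rcons M eL ++ G by rewrite (perm_mem pE2) mem_head.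
rewrite mem_cat mem_rcons inE -orbA in e2in; case/or3P: e2in => [/eqP he|eM|eG].
- left; exists (map (tau a b) Z); split; first by have := walk_map hs hw; rewrite swpR map_swp_id.
    by rewrite size_map.
  apply: (sw_perm hQ) hR'.
  have hMt : map (tau a b) M = M.
    rewrite -[RHS]map_id; apply/eq_in_map => e eM; apply: tau_id => //; apply/negP => hi.
      by move: aI; rewrite (hM _ _ eM hi).
    by move: bI; rewrite (hM _ _ eM hi).
  rewrite hZ /= map_rcons hMt perm_cons he -cats1 -catA /=.
  by rewrite he in pE2; perm_from pE2.
- case/orP: i2 => hi; first by move: aI; rewrite (hM _ _ eM hi).
  by move: bI; rewrite (hM _ _ eM hi).
right; exists e2, (rem e2 G), (tau a b e1 :: rcons M eL); split=> //.
- exact: perm_to_rem.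
- by rewrite tauC //; apply: walk_swap_first; rewrite -?hZ.
- by rewrite hZ.
apply: (sw_perm hQ) hR' => /=; rewrite perm_cons.
have pG := perm_to_rem eG; move/permP: pG => pG.
by apply/permP => q; move/permP/(_ q): pE2; move: (pG q); count_lia.
Qed.

Lemma detach w x E1 I1 E2 Vs F : Q (E1 ++ E2 ++ F) -> walk w w E1 I1 ->
  w \notin I1 -> tour E2 Vs -> w \in Vs -> side x = side w -> x \notin I1 -> x \notin Vs ->
  {in F, forall e, ~~ inc e x && ~~ inc e w} ->
  (exists E, tour E (x :: I1 ++ Vs) /\ Q (E ++ F)) \/
  exists E1', [/\ walk x x E1' I1, size E1' = size E1 & Q (E1' ++ E2 ++ F)].
Proof.
move=> hR w1 wI t2 wV hs xI xV hF.
have xw : x != w by apply: contraNneq xV => ->.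
have [[E1' h]|[e2 [G' [Z1 [pG i2 wZ sZ hR']]]]] := pull hR w1 wI xI hs xw.
  by right; exists E1'.
left; have : e2 \in E2 ++ F by rewrite (perm_mem pG) mem_head.
rewrite mem_cat => /orP[e2E|/hF/andP[/negbTE h1 /negbTE h2]]; last by rewrite h1 h2 in i2.
have i2w : inc e2 w.
  case/orP: i2 => // hi; by rewrite (tour_inc t2 e2E hi) in xV.
have [E' [J [hw pE pJ]]] := tour_edge t2 e2E i2w.
have hw2 : walk x w (tau x w e2 :: E') J by rewrite tauC //; apply: walk_swap_first.
exists (rev Z1 ++ tau x w e2 :: E'); split.
  apply: tour_perm (tour_walk (walk_cat (walk_rev wZ) hw2)) => //.
  apply: (@perm_trans _ (x :: I1 ++ (w :: J))); first perm_lia.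
  by rewrite perm_cons perm_cat2l.
apply: (sw_perm hQ) hR'; apply/permP => q.
by move/permP/(_ q): pE; move/permP/(_ q): pG; count_lia.
Qed.

End Tours.

(** * States *)

Section Exc.
Variable T : eqType.
Implicit Types (S : seq T) (x w : T).

Definition exc S := size S - size (undup S).

Lemma undup_le S : size (undup S) <= size S. Proof. exact: size_undup. Qed.

Lemma exc_perm S S' : perm_eq S S' -> exc S = exc S'.
Proof.
move=> h; rewrite /exc (perm_size h).
by rewrite (perm_size (perm_undup (perm_mem h))).
Qed.

Lemma exc_in S w : w \in S -> exc (w :: S) = (exc S).+1.
Proof. by move=> h; rewrite /exc /= h; have := undup_le S; lia. Qed.

Lemma exc_out S w : w \notin S -> exc (w :: S) = exc S.
Proof. by move=> h; rewrite /exc /= (negbTE h) /=; lia. Qed.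

Lemma exc_uniq S : (exc S == 0) = uniq S.
Proof.
have := ltn_size_undup S; have := undup_le S; rewrite /exc.
by case: (uniq S) => /=; lia.
Qed.

Lemma exc_cat S S' : {in S, forall x, x \notin S'} -> exc (S ++ S') = exc S + exc S'.
Proof.
elim: S => [|x S IH] h; first by [].
rewrite cat_cons; have hS : {in S, forall x, x \notin S'} by move=> y yS; apply: h;
  rewrite inE yS orbT.
have xS' : x \notin S' by apply: h; rewrite mem_head.
case xS: (x \in S).
  by rewrite !exc_in ?mem_cat ?xS // IH.
by rewrite !exc_out ?mem_cat ?xS // IH.
Qed.

Lemma repeat_of_exc S : 0 < exc S -> exists w, 1 < count_mem w S.
Proof.
rewrite lt0n exc_uniq => h; case: (altP (@allP _ (fun w => count_mem w S <= 1) S)) => [ha|].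
  case/negP: h; apply: count_mem_uniq => x; case: (boolP (x \in S)) => [xS|/count_memPn->//].
  have := ha _ xS; rewrite -has_pred1 has_count in xS; by lia.
by case/allPn => w _; rewrite -ltnNge => hw; exists w.
Qed.

Lemma exc_of_repeat S w : 1 < count_mem w S -> 0 < exc S.
Proof.
rewrite lt0n exc_uniq => h; apply/negP => uS; move: h.
by rewrite count_uniq_mem //; case: (w \in S).
Qed.

Lemma perm_pull S w : w \in S -> exists S', perm_eq S (w :: S').
Proof. by move=> h; exists (rem w S); apply: perm_to_rem. Qed.

Lemma exc_two S w1 w2 : w1 != w2 -> 1 < count_mem w1 S -> 1 < count_mem w2 S -> 1 < exc S.
Proof.
move=> ne h1 h2.
have [S1 p1] : exists S1, perm_eq S (w1 :: S1).
  by apply: perm_pull; rewrite -has_pred1 has_count; lia.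
move: h1 h2; rewrite (exc_perm p1) !(permP p1) /= eqxx (negbTE ne) => h1 h2.
rewrite exc_in; last by rewrite -has_pred1 has_count; lia.
by rewrite ltnS; apply: (@exc_of_repeat _ w2); lia.
Qed.

Lemma first_occ S w : w \in S -> exists S1 S2, S = S1 ++ w :: S2 /\ w \notin S1.
Proof.
elim: S => // x S IH; rewrite inE; case: eqVneq => [->|xw /= /IH[S1 [S2 [-> h]]]].
  by move=> _; exists [::], S.
by exists (x :: S1), S2; rewrite inE negb_or xw h.
Qed.

End Exc.

Section States.
Variables v u lam : nat.
Notation vtx := (vtx v u).
Notation edge := (edge v u lam).
Implicit Types (e : edge) (x y z a b w : vtx) (E F G Z : seq edge) (I J S Vs : seq vtx).
Implicit Types (TT : seq (seq edge * seq vtx)) (N : seq nat).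

(* Bound on the number l of edges of the leave: an unused vertex then exists on the side of
   a repeated one, except when the only repetition is on the side of V. *)
Definition bnd l := (l <= 2 * v) || ((v < u) && (l <= 2 * v + 2)).

Definition ok TT := forall t, t \in TT -> tour t.1 t.2.
Definition eds TT := flatten (map fst TT).
Definition vs TT := flatten (map snd TT).
Definition disj TT := forall y, count (fun t : seq edge * seq vtx => y \in t.2) TT <= 1.
Definition Psi TT := size TT + exc (vs TT).

(** The parts alternate along a walk. The boolean terms correct the count for odd length and vanish
    on closed walks. *)
Lemma walk_half x y E I : walk x y E I ->
  2 * count (@side v u) (x :: I) + (odd (size E) && ~~ side x) = size E + (odd (size E) && side x).
Proof.
elim=> [x1 y1 e h|x1 y1 z1 e E1 I1 h _]; first by rewrite /=; case: side.
rewrite /= (joins_side h); case: (side x1); case: (odd _) => /=; lia.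
Qed.

Lemma tour_half E Vs : tour E Vs -> 2 * count (@side v u) Vs = size Vs.
Proof.
move=> [x [F [I [w p1 p2]]]]; rewrite -(permP p2) -(perm_size p2) /= -(size_walk w).
have := walk_half w; have := walk_side w.
by case: (odd _); rewrite ?addbT /= ?addn0 //; case: side.
Qed.

Lemma ok_half TT : ok TT -> 2 * count (@side v u) (vs TT) = size (vs TT).
Proof.
elim: TT => // t TT IH h; rewrite /vs /= count_cat size_cat -[flatten _]/(vs TT) mulnDr IH.
  by rewrite (tour_half (h _ (mem_head _ _))).
by move=> s hs; apply: h; rewrite inE hs orbT.
Qed.

Lemma mem_vs TT y : (y \in vs TT) = has (fun t : seq edge * seq vtx => y \in t.2) TT.
Proof. by elim: TT => // t TT IH; rewrite /vs /= mem_cat -IH. Qed.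

Lemma eds_perm TT TT' : perm_eq TT TT' -> perm_eq (eds TT) (eds TT').
Proof. by move=> h; apply: perm_flatten; apply: perm_map. Qed.

Lemma vs_perm TT TT' : perm_eq TT TT' -> perm_eq (vs TT) (vs TT').
Proof. by move=> h; apply: perm_flatten; apply: perm_map. Qed.

Lemma ok_perm TT TT' : perm_eq TT TT' -> ok TT -> ok TT'.
Proof. by move=> h hk t; rewrite -(perm_mem h); apply: hk. Qed.

Lemma ok_cons t TT : ok (t :: TT) <-> tour t.1 t.2 /\ ok TT.
Proof.
split=> [h|[h1 h2] s]; last by rewrite inE => /orP[/eqP->|/h2].
by split; [apply: h; rewrite mem_head|move=> s hs; apply: h; rewrite inE hs orbT].
Qed.

Lemma merge1 TT y : ok TT -> 1 < count (fun t : seq edge * seq vtx => y \in t.2) TT ->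
  exists TT', [/\ ok TT', perm_eq (eds TT') (eds TT),
    perm_eq (vs TT') (vs TT) & size TT = (size TT').+1].
Proof.
move=> hk hc; set p := fun t : seq edge * seq vtx => y \in t.2 in hc.
have /hasP[t tT yt] : has p TT by rewrite has_count; lia.
have p1 := perm_to_rem tT; set R := rem t TT in p1.
have /hasP[s sR ys] : has p R.
  by rewrite has_count; move: hc; rewrite (permP p1) /= yt.
have p2 := perm_to_rem sR; set Q := rem s R in p2.
have p3 : perm_eq TT (t :: s :: Q) by rewrite (permPl p1) perm_cons.
have hk3 := ok_perm p3 hk; move: hk3 => /ok_cons[ht /ok_cons[hs hQ]].
exists ((t.1 ++ s.1, t.2 ++ s.2) :: Q); split.
- by apply/ok_cons; split=> //; apply: tour_cat ht hs yt ys.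
- by rewrite (permPr (eds_perm p3)) /eds /= -catA.
- by rewrite (permPr (vs_perm p3)) /vs /= -catA.
- by rewrite (perm_size p3).
Qed.

(** Merging two tours at a common vertex lowers the number of tours and keeps all visited positions,
    so [Psi] does not grow. *)
Lemma normalize TT : ok TT -> exists TT', [/\ ok TT', disj TT', perm_eq (eds TT') (eds TT),
  perm_eq (vs TT') (vs TT) & size TT' <= size TT].
Proof.
move: {2}(size TT) (leqnn (size TT)) => n; elim: n TT => [|n IH] TT hn hk.
  by exists TT; split=> // y; case: TT hn {hk}.
case: (boolP [forall y : vtx,
  count (fun t : seq edge * seq vtx => y \in t.2) TT <= 1]) => [/forallP h|].
  by exists TT; split.
case/forallPn => y; rewrite -ltnNge => hc.
have [T1 [k1 e1 v1 s1]] := merge1 hk hc.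
have [|T2 [k2 d2 e2 v2 s2]] := IH T1 _ k1; first by lia.
exists T2; split=> //; first exact: perm_trans e2 e1; first exact: perm_trans v2 v1.
by lia.
Qed.

Lemma free_vertex (s : bool) S : size (undup [seq x <- S | side x == s]) < (if s then v else u) ->
  exists x, side x = s /\ x \notin S.
Proof.
move=> h; case: (boolP [exists x : vtx,
  (side x == s) && (x \notin S)]) => [/existsP[x /andP[/eqP h1 h2]]|].
  by exists x.
move/existsPn => hn; exfalso.
have hin x : side x = s -> x \in undup [seq x <- S | side x == s].
  move=> hx; rewrite mem_undup mem_filter hx eqxx /=.
  by have := hn x; rewrite hx eqxx /= negbK.
case: s h hn hin => h hn hin.
  have := @uniq_leq_size _ [seq (inl i : vtx) | i <- enum 'I_v] (undup [seq x <- S | side x ==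
    true]).
  rewrite map_inj_uniq ?enum_uniq; last by move=> i j [].
  rewrite size_map size_enum_ord => hh.
  have : v <= size (undup [seq x <- S | side x == true]) by apply: hh => // x /mapP[i _ ->];
    apply: hin.
  by rewrite leqNgt h.
have := @uniq_leq_size _ [seq (inr i : vtx) | i <- enum 'I_u] (undup [seq x <- S | side x ==
  false]).
rewrite map_inj_uniq ?enum_uniq; last by move=> i j [].
rewrite size_map size_enum_ord => hh.
have : u <= size (undup [seq x <- S | side x == false]) by apply: hh => // x /mapP[i _ ->];
  apply: hin.
by rewrite leqNgt h.
Qed.

Lemma count_side_filter (s : bool) S w : side w = s ->
  count_mem w [seq x <- S | side x == s] = count_mem w S.
Proof.
move=> hw; rewrite count_filter; apply: eq_count => x /=.
by case: eqVneq => [->|]; rewrite ?hw ?eqxx.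
Qed.

Lemma size_side (s : bool) S : 2 * count (@side v u) S = size S ->
  2 * size [seq x <- S | side x == s] = size S.
Proof.
move=> h; rewrite size_filter.
have := count_predC (@side v u) S.
have -> : count (fun x : vtx =>
  side x == s) S = if s then count (@side v u) S else count (predC (@side v u)) S.
  by case: s; apply: eq_count => x /=; case: side.
move: h; case: s => [//|] h hc; move: h; rewrite -hc.
by move: (count _ S) (count _ S) => p q h; lia.
Qed.

Hypothesis hvu : v <= u.

(** Half of the positions lie in [U]: at most [v], or at most [v + 1] when [v < u], hence at most
    [u] in all cases. One repetition then leaves a vertex of [U] free. *)
Lemma free_U S w : bnd (size S) -> 2 * count (@side v u) S = size S -> ~~ side w ->
  1 < count_mem w S -> exists x, side x = side w /\ x \notin S.
Proof.
move=> hb hs hw hc; rewrite (negbTE hw); apply: free_vertex.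
have h2 := size_side false hs.
have := @exc_of_repeat _ [seq x <- S | side x == false] w.
rewrite count_side_filter ?(negbTE hw) // => /(_ hc); rewrite /exc.
move: hb h2; rewrite /bnd; set A := [seq x <- S | _].
by move: (size (undup A)) (size A) (size S) => p q r; clear -hvu; lia.
Qed.

(** The part [V] may receive [v + 1] positions, so two repetitions are required here. *)
Lemma free_V S : bnd (size S) -> 2 * count (@side v u) S = size S ->
  1 < exc [seq x <- S | side x == true] -> exists x, side x /\ x \notin S.
Proof.
move=> hb hs hc; have [|x [h1 h2]] := @free_vertex true S; last by exists x.
have h2 := size_side true hs.
move: hb hc h2; rewrite /bnd /exc; set A := [seq x <- S | _].
by move: (size (undup A)) (size A) (size S) => p q r; clear; lia.
Qed.

Lemma exc_sides S : exc S = exc [seq x <- S | side x == true] + exc [seq x <- S | side x == false].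
Proof.
rewrite -exc_cat; last first.
  by move=> x; rewrite !mem_filter => /andP[/eqP-> _].
apply: exc_perm; rewrite perm_sym.
have -> : [seq x <- S | side x == false] = [seq x <- S | predC (fun x : vtx => side x == true) x].
  by apply: eq_filter => x /=; case: side.
by rewrite perm_filterC.
Qed.

Lemma free_pick S : bnd (size S) -> 2 * count (@side v u) S = size S -> 1 < exc S ->
  exists w x, [/\ 1 < count_mem w S, side x = side w & x \notin S].
Proof.
move=> hb hs hc; case: (posnP (exc [seq x <- S | side x == false])) => h.
  move: hc; rewrite exc_sides h addn0 => hc.
  have [x [x1 x2]] := free_V hb hs hc.
  have [|w hw] := @repeat_of_exc _ [seq x <- S | side x == true]; first by lia.
  have sw : side w.
    have : w \in [seq x <- S | side x == true] by rewrite -has_pred1 has_count; lia.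
    by rewrite mem_filter => /andP[/eqP].
  by exists w, x; rewrite count_side_filter in hw; rewrite ?x1 ?sw.
have [w hw] := repeat_of_exc h.
have sw : ~~ side w.
  have : w \in [seq x <- S | side x == false] by rewrite -has_pred1 has_count; lia.
  by rewrite mem_filter => /andP[/eqP->].
rewrite count_side_filter in hw; last exact/negbTE.
by have [x [x1 x2]] := free_U hb hs sw hw; exists w, x.
Qed.

(** A repeated vertex in [U] suffices by [free_U]; if both lie in [V], they supply the two
    repetitions that [free_V] asks for. *)
Lemma free_two S w1 w2 : bnd (size S) -> 2 * count (@side v u) S = size S -> w1 != w2 ->
  1 < count_mem w1 S -> 1 < count_mem w2 S ->
  exists w x, [/\ (w == w1) || (w == w2), side x = side w & x \notin S].
Proof.
move=> hb hs ne h1 h2.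
case s1: (side w1); last first.
  by have [|x [x1 x2]] := free_U hb hs _ h1; rewrite ?s1 //; exists w1, x; rewrite eqxx.
case s2: (side w2); last first.
  by have [|x [x1 x2]] := free_U hb hs _ h2; rewrite ?s2 //; exists w2, x; rewrite eqxx orbT.
have [|x [x1 x2]] := free_V hb hs; last by exists w1, x; rewrite eqxx s1.
by apply: (exc_two ne); rewrite count_side_filter.
Qed.

End States.

(** * Reduction to a single repeated vertex *)

Section Reduce.
Variables v u lam : nat.
Notation vtx := (vtx v u).
Notation edge := (edge v u lam).
Implicit Types (e : edge) (x y z a b w : vtx) (E F G Z : seq edge) (I J S Vs : seq vtx).
Implicit Types (TT : seq (seq edge * seq vtx)) (N : seq nat).

Lemma vs_cons t TT : vs (t :: TT) = t.2 ++ vs TT. Proof. by []. Qed.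
Lemma eds_cons (t : seq edge * seq vtx) TT : eds (t :: TT) = t.1 ++ eds TT. Proof. by []. Qed.

Lemma eds_inc TT e y : ok TT -> e \in eds TT -> inc e y -> y \in vs TT.
Proof.
elim: TT => // t TT IH /ok_cons[ht hk]; rewrite eds_cons vs_cons !mem_cat.
by case/orP=> [he hi|he hi]; [rewrite (tour_inc ht he hi)|rewrite (IH hk he hi) orbT].
Qed.

Lemma disj_perm TT TT' : perm_eq TT TT' -> disj TT -> disj TT'.
Proof. by move=> h d y; rewrite -(permP h). Qed.

Lemma disj_cons t TT y : disj (t :: TT) -> y \in t.2 -> y \notin vs TT.
Proof.
by move=> d yt; have := d y; rewrite /= yt mem_vs has_count -leqNgt add1n ltnS.
Qed.

Variable Q : seq edge -> Prop.
Hypothesis hQ : switching Q.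

(** By disjointness both visits of [w] belong to one tour, which is cut at [w] into a loop and the
    rest; [detach] replaces one visit by [x]. If the loop splits off, the additional tour is paid
    for by the lost repetition, so [Psi] does not grow. *)
Lemma split_state TT w x : Q (eds TT) -> ok TT -> disj TT ->
  1 < count_mem w (vs TT) -> side x = side w -> x \notin vs TT ->
  exists TT', [/\ ok TT', Q (eds TT'), size (vs TT') = size (vs TT),
    (exc (vs TT')).+1 = exc (vs TT) & Psi TT' <= Psi TT].
Proof.
move=> hR hk hd hc hs hx.
have : w \in vs TT by rewrite -has_pred1 has_count; lia.
rewrite mem_vs => /hasP[t tT /= wt].
have pT := perm_to_rem tT; set R := rem t TT in pT.
have /ok_cons[ht hkR] := ok_perm pT hk.
have hdR := disj_perm pT hd.
have wR : w \notin vs R := disj_cons hdR wt.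
have pv := vs_perm pT; rewrite vs_cons in pv.
have pe := eds_perm pT; rewrite eds_cons in pe.
have [E [I [hw pE pI]]] := tour_at ht wt.
have wI : w \in I.
  rewrite -has_pred1 has_count; move: hc; rewrite (permP pv) count_cat (count_memPn wR) addn0.
  by rewrite -(permP pI) /= eqxx.
have [I1 [I2 [hI nI1]]] := first_occ wI; rewrite hI in hw pI.
have [E1 [E2 [hE w1 w2]]] := walk_split hw; rewrite hE in pE.
have xn : x \notin w :: I1 ++ w :: I2 by rewrite (perm_mem pI); apply: contra hx;
  rewrite (perm_mem pv) mem_cat => ->.
have xI1 : x \notin I1 by apply: contra xn; rewrite inE mem_cat => ->; rewrite orbT.
have xI2 : x \notin w :: I2 by apply: contra xn => h; rewrite inE mem_cat h !orbT.
have xR : x \notin vs R by apply: contra hx; rewrite (perm_mem pv) mem_cat => ->; rewrite orbT.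
have hR1 : Q (E1 ++ E2 ++ eds R).
  apply: (sw_perm hQ) hR; rewrite (permPl pe) perm_sym catA perm_cat2r; exact: pE.
have hF : {in eds R, forall e, ~~ inc e x && ~~ inc e w}.
  move=> e eR; apply/andP; split; apply/negP => hi.
    by rewrite (eds_inc hkR eR hi) in xR.
  by rewrite (eds_inc hkR eR hi) in wR.
set S' := (I1 ++ w :: I2) ++ vs R.
have pS : perm_eq (vs TT) (w :: S').
  by rewrite (permPl pv) /S' -cat_cons perm_cat2r perm_sym.
have wS : w \in S' by rewrite /S' !mem_cat inE eqxx orbT.
have xS : x \notin S' by rewrite /S' !mem_cat (negbTE xI1) (negbTE xI2) (negbTE xR).
have exS : exc (vs TT) = (exc (x :: S')).+1 by rewrite (exc_perm pS) exc_in // exc_out.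
have wV : w \in w :: I2 by rewrite mem_head.
case: (detach hQ hR1 w1 nI1 (tour_walk w2) wV hs xI1 xI2 hF) => [[E' [tE hR2]]|[E1' [wE1 sE1 hR2]]].
  exists ((E', x :: I1 ++ w :: I2) :: R); split.
  - by apply/ok_cons.
  - exact: hR2.
  - by rewrite vs_cons /= (perm_size pS) /S' /= !size_cat.
  - by rewrite exS; congr _.+1.
  - by rewrite /Psi exS (perm_size pT) /=; rewrite leq_add2l; exact: leqnSn.
exists ((E1', x :: I1) :: (E2, w :: I2) :: R); split.
- by apply/ok_cons; split; [exact: tour_walk|apply/ok_cons; split=> //; exact: tour_walk].
- by rewrite !eds_cons.
- rewrite !vs_cons /= (perm_size pS) /S' /= !size_cat /=.
  by rewrite size_cat -addnA addSn.
- by rewrite exS !vs_cons /= /S' -catA.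
- by rewrite /Psi exS (perm_size pT) !vs_cons /= /S' -catA /= addnS.
Qed.

Hypothesis hvu : v <= u.

Lemma reduce1 TT : bnd v u (size (vs TT)) -> Q (eds TT) -> ok TT -> 0 < exc (vs TT) ->
  exists TT', [/\ ok TT' /\ disj TT', Q (eds TT'), size (vs TT') = size (vs TT),
    exc (vs TT') = 1 & Psi TT' <= Psi TT].
Proof.
move: {2}(exc (vs TT)) (erefl (exc (vs TT))) => n; elim: n TT => [|n IH] TT hn hb hR hk he.
  by rewrite hn in he.
have [T1 [k1 d1 e1 v1 s1]] := normalize hk.
have hR1 : Q (eds T1) by apply: (sw_perm hQ) hR; rewrite perm_sym.
have x1 : exc (vs T1) = exc (vs TT) by apply: exc_perm.
have sz1 : size (vs T1) = size (vs TT) by apply: perm_size.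
have P1 : Psi T1 <= Psi TT by rewrite /Psi x1 leq_add2r.
case: (ltnP 1 (exc (vs T1))) => h1; last first.
  by exists T1; split=> //; apply/eqP; rewrite eqn_leq h1 x1.
have hb1 : bnd v u (size (vs T1)) by rewrite sz1.
have [w [x [hc hs hx]]] := free_pick hvu hb1 (ok_half k1) h1.
have [T2 [k2 R2 sz2 x2 P2]] := split_state hR1 k1 d1 hc hs hx.
have h2 : exc (vs T2) = n by apply: succn_inj; rewrite x2 x1.
have hb2 : bnd v u (size (vs T2)) by rewrite sz2 sz1.
have h3 : 0 < exc (vs T2) by rewrite -ltnS x2.
have [T3 [[k3 d3] R3 sz3 x3 P3]] := IH T2 h2 hb2 R2 k2 h3.
exists T3; split=> //; first by rewrite sz3 sz2.
exact: leq_trans P3 (leq_trans P2 P1).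
Qed.

End Reduce.

(** * Closing two strands *)

Lemma uniq_cat2 (T : eqType) (s t : seq T) : uniq s -> uniq t ->
  {in s, forall y, y \notin t} -> uniq (s ++ t).
Proof.
move=> us ut h; rewrite cat_uniq us ut andbT /=; apply/hasPn => y yt.
by apply/negP => ys; move: (h y ys); rewrite yt.
Qed.

Section Moves.
Variables v u lam : nat.
Notation vtx := (vtx v u).
Notation edge := (edge v u lam).
Notation wins N := (reach N (@nil edge)).
Implicit Types (e : edge) (x y z a b w : vtx) (A B E F G Z : seq edge) (I J S Vs IA IB : seq vtx).
Implicit Types (TT : seq (seq edge * seq vtx)) (N : seq nat).

Lemma emit2 N E F : reach N (E ++ F) -> cyc E -> cyc F -> wins (size E :: size F :: N).
Proof.
move=> h hE hF; apply: (@emit _ _ _ E) => //; rewrite cats0; apply: emit => //.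
by apply: reach_perm h => //; rewrite perm_catC.
Qed.

Lemma cyc_walk x E I : walk x x E I -> uniq (x :: I) -> uniq E -> cyc E.
Proof. by exists x, I. Qed.

Lemma walk_cut x z E I i : walk x z E I -> 0 < i < size E -> exists y E1 E2 I1 I2,
  [/\ I = I1 ++ y :: I2, E = E1 ++ E2, walk x y E1 I1, walk y z E2 I2 & size E1 = i].
Proof.
move=> h; have sE := size_walk h; rewrite sE => hi.
have hI : I = take i.-1 I ++ nth z I i.-1 :: drop i I.
  rewrite -{1}(cat_take_drop i.-1 I); congr (_ ++ _).
  by rewrite (drop_nth z) ?prednK //; lia.
rewrite hI in h; have [E1 [E2 [hE h1 h2]]] := walk_split h.
exists (nth z I i.-1), E1, E2, (take i.-1 I), (drop i I); split=> //.
by rewrite (size_walk h1) size_take; case: ltnP; lia.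
Qed.

Lemma tour_side E Vs (s : bool) : tour E Vs -> exists2 y, y \in Vs & side y = s.
Proof.
move=> [x [F [I [h _ p]]]].
case/walk_inv: h => [[e [_ _ j]]|[e [z [E' [I' [_ hI j _]]]]]].
  by have := joins_side j; case: side.
have := joins_side j; case: (eqVneq (side x) s) => [<- _|hs hz].
  by exists x => //; rewrite -(perm_mem p) mem_head.
exists z; first by rewrite -(perm_mem p) hI !inE eqxx orbT.
by rewrite hz; case: (side x) s hs => -[].
Qed.

(** Opposite to [detach]: the bead [Z] is pulled from its own vertex [b] to a vertex [a] of [E2]. If
    only its first edge moves, the second changed edge lies on [E2] and both closed trails fuse into
    one with the same visited vertices. *)
Lemma attach N a b Z Iz E2 Vs F : reach N (Z ++ E2 ++ F) -> walk b b Z Iz -> uniq (b :: Iz) ->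
  tour E2 Vs -> a \in Vs -> {in b :: Iz, forall y, y \notin Vs} -> side a = side b ->
  {in F, forall e, ~~ inc e a && ~~ inc e b} ->
  (exists Z', [/\ walk a a Z' Iz, size Z' = size Z & reach N (Z' ++ E2 ++ F)]) \/
  exists E, tour E ((b :: Iz) ++ Vs) /\ reach N (E ++ F).
Proof.
move=> hR wZ uZ t2 aV hd hs hF.
have bI : b \notin Iz by case/andP: uZ.
have bV : b \notin Vs by apply: hd; rewrite mem_head.
have aI : a \notin Iz.
  by apply/negP => h; have := hd a; rewrite inE h orbT aV => /(_ isT).
have ab : a != b by apply: contraNneq bV => <-.
case: (pull (@switching_reach _ _ _ _) hR wZ bI aI hs ab) => [h|[e2 [G' [Z1 [pG i2 w1 s1 hR']]]]];
  first by left.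
right; have : e2 \in E2 ++ F by rewrite (perm_mem pG) mem_head.
rewrite mem_cat => /orP[e2E|/hF/andP[/negbTE h1 /negbTE h2]]; last by rewrite h1 h2 in i2.
have i2a : inc e2 a.
  by case/orP: i2 => // hi; rewrite (tour_inc t2 e2E hi) in bV.
have [E' [J [hw pE pJ]]] := tour_edge t2 e2E i2a.
have hw2 := walk_swap_first hs hw.
exists (Z1 ++ tau a b e2 :: E'); split.
  apply: tour_perm (tour_walk (walk_cat w1 hw2)) => //.
  apply: (@perm_trans _ ((b :: Iz) ++ a :: J)); first perm_lia.
  by rewrite perm_cat2l.
apply: reach_perm hR' => //; apply/permP => q.
by move/permP/(_ q): pE; move/permP/(_ q): pG; count_lia.
Qed.

(** Switch [a] and [g] from the first edge of [A]. If the other changed edge is an end of [B], both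
    strands close up. If it is the last edge of [A], the ends of [A] are exchanged while its
    interior keeps its order, so [A] now runs backwards relative to [B]. *)
Lemma close N a g A B IA IB : reach N (A ++ B) -> walk a g A IA -> walk a g B IB ->
  uniq (a :: g :: IA) -> uniq (a :: g :: IB) -> side a = side g ->
  wins (size A :: size B :: N) \/
  exists A', [/\ walk g a A' IA, size A' = size A & reach N (A' ++ B)].
Proof.
move=> hR wA wB uA uB hs.
have ag : a != g by move: uA; rewrite /= inE negb_or => /andP[/andP[]].
have [aA gA] : a \notin IA /\ g \notin IA.
  by move: uA; rewrite /= inE negb_or => /and3P[/andP[_ ->] -> _].
have [aB gB] : a \notin IB /\ g \notin IB.
  by move: uB; rewrite /= inE negb_or => /and3P[/andP[_ ->] -> _].
have uA' : uniq (g :: IA) by case/andP: uA.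
have uB' : uniq (g :: IB) by case/andP: uB.
have uB'' : uniq (a :: IB) by move: uB => /= /and3P[_ _ ->]; rewrite aB.
have [a1 [M [a2 [z1 [z2 [hA j1 j2 _ hM]]]]]] := walk_ends wA (walk_ne wA hs).
have [b1 [K [b2 [y1 [y2 [hB k1 k2 _ hK]]]]]] := walk_ends wB (walk_ne wB hs).
have a1in : a1 \in A ++ B by rewrite hA inE eqxx.
have i1 : inc a1 a || inc a1 g by rewrite (joins_inc _ j1) eqxx.
have [e2 [E' [pE i2 hR']]] := switch hR hs ag a1in i1.
have uE := reach_uniq hR'.
have pE2 : perm_eq (rcons M a2 ++ B) (e2 :: E') by move: pE; rewrite hA /= perm_cons.
have nM e : e \in M -> ~~ (inc e a || inc e g).
  by move=> eM; apply/negP => /orP[]/(hM _ _ eM) h; [move: aA|move: gA]; rewrite h.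
have nK e : e \in K -> ~~ (inc e a || inc e g).
  by move=> eK; apply/negP => /orP[]/(hK _ _ eK) h; [move: aB|move: gB]; rewrite h.
have wA1 : walk g g (tau a g a1 :: rcons M a2) IA by apply: walk_swap_first; rewrite -?hA.
have e2in : e2 \in rcons M a2 ++ B by rewrite (perm_mem pE2) mem_head.
rewrite mem_cat mem_rcons inE -orbA in e2in; case/or3P: e2in => [/eqP he|eM|].
- right; exists (map (tau a g) A); split.
  + by have := walk_map hs wA; rewrite swpL swpR map_swp_id.
  + by rewrite size_map.
  apply: reach_perm hR' => //.
  have hMt : map (tau a g) M = M.
    rewrite -[RHS]map_id; apply/eq_in_map => e eM.
    by have := nM e eM; rewrite negb_or => /andP[*]; apply: tau_id.
  by rewrite hA /= map_rcons hMt perm_cons he -cats1; rewrite he in pE2; perm_from pE2.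
- by rewrite (negbTE (nM _ eM)) in i2.
have e2B eB : eB \in B -> [\/ eB = b1, eB = b2 | eB \in K].
  by rewrite hB inE mem_rcons inE => /or3P[/eqP->|/eqP->|]; constructor.
case/e2B => [he|he|eK]; last by rewrite (negbTE (nK _ eK)) in i2.
- left; pose A1 := tau a g a1 :: rcons M a2; pose B1 := tau a g b1 :: rcons K b2.
  have hR2 : reach N (A1 ++ B1).
    apply: reach_perm hR' => //; rewrite /A1 /B1 he perm_cons.
    by rewrite he hB in pE2; perm_from pE2.
  have := reach_uniq hR2; rewrite cat_uniq => /and3P[uA1 _ uB1].
  have -> : size A = size A1 by rewrite hA.
  have -> : size B = size B1 by rewrite hB.
  apply: emit2 hR2 _ _; first exact: cyc_walk wA1 uA' uA1.
  by apply: cyc_walk _ uB' uB1; apply: walk_swap_first; rewrite -?hB.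
left; pose A1 := tau a g a1 :: rcons M a2; pose B1 := rev (tau a g b2 :: rev (b1 :: K)).
have hR2 : reach N (A1 ++ B1).
  apply: reach_perm hR' => //; rewrite /A1 /B1 he perm_cons.
  by rewrite he hB in pE2; perm_from pE2.
have := reach_uniq hR2; rewrite cat_uniq => /and3P[uA1 _ uB1].
have -> : size A = size A1 by rewrite hA.
have -> : size B = size B1 by rewrite hB size_rev /= size_rev /= size_rcons.
apply: emit2 hR2 _ _; first exact: cyc_walk wA1 uA' uA1.
apply: cyc_walk _ uB'' uB1; rewrite -[IB]revK; apply: walk_rev.
rewrite tauC //; apply: walk_swap_first => //.
by have := walk_rev wB; rewrite hB -rcons_cons rev_rcons.
Qed.

(** Even if [detach] separates the two loops at [g], their other common vertex [y] holds them
    together; a visit of [g] is lost without a gain in tours. *)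
Lemma cross_split N g y x E1 I1 E2 I2 : reach N (E1 ++ E2) -> walk g g E1 I1 ->
  walk g g E2 I2 -> g \notin I1 -> y \in I1 -> y \in I2 -> side x = side g ->
  x \notin I1 -> x \notin g :: I2 ->
  exists E, tour E (x :: I1 ++ g :: I2) /\ reach N E.
Proof.
move=> hR w1 w2 gI y1 y2 hs x1 x2.
have hR1 : reach N (E1 ++ E2 ++ [::]) by rewrite cats0.
have hF : {in [::], forall e, ~~ inc e x && ~~ inc e g} by [].
case: (detach (@switching_reach _ _ _ _) hR1 w1 gI (tour_walk w2) (mem_head _ _) hs x1 x2 hF) =>
  [[E [tE]]|[E1' [w1' s1 hR2]]].
  by rewrite cats0 => h; exists E.
rewrite cats0 in hR2; exists (E1' ++ E2); split=> //.
apply: (tour_cat (Vs := x :: I1) (Ws := g :: I2) (y := y)) => //; try exact: tour_walk.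
  by rewrite inE y1 orbT.
by rewrite inE y2 orbT.
Qed.

End Moves.

(** * Cutting a chain of beads into two cycles *)

Section Win.
Variables v u lam : nat.
Notation vtx := (vtx v u).
Notation edge := (edge v u lam).
Notation wins N := (reach N (@nil edge)).
Implicit Types (e : edge) (x y z w al ga de : vtx) (a b : seq vtx) (A B E F G X Y Z : seq edge) (I
  J S Vs IA IB : seq vtx).
Implicit Types (TT : seq (seq edge * seq vtx)) (N : seq nat).

(** The outcome of a failed attempt: a state from which the construction can restart. *)
Definition better N l s := exists TT,
  [/\ ok TT, reach N (eds TT), size (vs TT) = l, 0 < exc (vs TT) & Psi TT < s].

Lemma even_closed x E I : walk x x E I -> ~~ odd (size E).
Proof. by move=> h; have := walk_side h; case: (odd _) => //; case: side. Qed.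

(** The strands pass through [w], from a point of [X] to a point of [Y]. If closing them fails, the
    reversed strand recombines with the other one into two loops at [w] again, of new lengths; the
    cut is chosen to make these lengths useful. *)
Lemma chain2 N T l w X Y Ix Iy : reach N (X ++ Y) -> walk w w X Ix -> walk w w Y Iy ->
  uniq (w :: Ix ++ Iy) -> size X + size Y = l -> size X <= size Y ->
  4 <= T -> ~~ odd T -> T <= l - T -> wins (T :: l - T :: N).
Proof.
move: {2}(size X) (leqnn (size X)) => n;
  elim: n w X Y Ix Iy => [|n IH] w X Y Ix Iy hn hR hX hY hu hl hxy h4 hT hTl.
  by have := size_walk hX; lia.
have oX := even_closed hX; have oY := even_closed hY.
have sX := size_walk hX; have sY := size_walk hY.
(* After a reversal, the loop [X] has length [size X - i + j]. With [i] half of the even number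
   [size X] this is [i + j = T], and the two loops are the wanted cycles. This choice needs [i < T];
   otherwise [i = T - 1] and [j = 1] shorten the loop by [T - 2], and the induction hypothesis
   applies. *)
pose i := if T <= (size X)./2 then T.-1 else (size X)./2; pose j := T - i.
have [i1 [i2 [j1 j2]]] : 0 < i /\ i < size X /\ 0 < j /\ j < size Y.
  have hi : i = if T <= (size X)./2 then T.-1 else (size X)./2 by [].
  have hj : j = T - i by [].
  move: (i) (j) hi hj => i' j'; move: oX oY sX sY hxy hl h4 hTl.
  move: (size X) (size Y) (size Ix) (size Iy) => p q r s; clear.
  by case: ifP; lia.
have [al [X1 [X2 [I1 [I2 [hI hXX wX1 wX2 s1]]]]]] := walk_cut hX (introT andP (conj i1 i2)).
have [ga [Y1 [Y2 [J1 [J2 [hJ hYY wY1 wY2 s2]]]]]] := walk_cut hY (introT andP (conj j1 j2)).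
have wA := walk_cat (walk_rev wX1) wY1.
have wB := walk_cat wX2 (walk_rev wY2).
have hij : i + j = T by rewrite /j subnKC // /i; case: ifP; lia.
have hs : side al = side ga.
  by have := walk_side wA; rewrite size_cat size_rev s1 s2 hij (negbTE hT) addbF.
have uA : uniq (al :: ga :: rev I1 ++ w :: J1) /\ uniq (al :: ga :: I2 ++ w :: rev J2).
  have hp : perm_eq (w :: Ix ++ Iy) ((al :: ga :: rev I1 ++ w :: J1) ++ I2 ++ J2).
    by rewrite hI hJ; perm_lia.
  have hq : perm_eq (w :: Ix ++ Iy) ((al :: ga :: I2 ++ w :: rev J2) ++ I1 ++ J1).
    by rewrite hI hJ; perm_lia.
  by split; [move: hu; rewrite (perm_uniq hp) cat_uniq => /andP[]|
     move: hu; rewrite (perm_uniq hq) cat_uniq => /andP[]].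
have hR1 : reach N ((rev X1 ++ Y1) ++ X2 ++ rev Y2).
  by apply: reach_perm hR => //; rewrite hXX hYY; perm_lia.
have sA : size (rev X1 ++ Y1) = T by rewrite size_cat size_rev s1 s2.
have sB : size (X2 ++ rev Y2) = l - T.
  rewrite size_cat size_rev -hl hXX hYY !size_cat s1 s2.
  by move: (size X2) (size Y2) => p q; move: hij; clear; lia.
case: (close hR1 wA wB (proj1 uA) (proj2 uA) hs) => [|[A' [wA' sA' hR2]]].
  by rewrite sA sB.
have [A1 [A2 [hA wA1 wA2]]] := walk_split wA'.
have hR3 : reach N ((A2 ++ X2) ++ rev Y2 ++ A1).
  by apply: reach_perm hR2 => //; rewrite hA; perm_lia.
have wX' := walk_cat wA2 wX2; have wY' := walk_cat (walk_rev wY2) wA1.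
have sA1 : size A1 = i by rewrite (size_walk wA1) size_rev -s1 (size_walk wX1).
have sA2 : size A2 = j by rewrite (size_walk wA2) -s2 (size_walk wY1).
have hx1 : size X = i + size X2 by rewrite hXX size_cat s1.
have hy1 : size Y = j + size Y2 by rewrite hYY size_cat s2.
have sX' : size (A2 ++ X2) = j + (size X - i) by rewrite size_cat sA2 hx1; congr (_ + _); clear;
  lia.
have sY' : size (rev Y2 ++ A1) = size Y - j + i by rewrite size_cat size_rev sA1 hy1;
  congr (_ + _); clear; lia.
have uX' : uniq (w :: (J1 ++ al :: I2) ++ rev J2 ++ ga :: rev I1).
  have hp : perm_eq (w :: Ix ++ Iy) (w :: (J1 ++ al :: I2) ++ rev J2 ++ ga :: rev I1).
    by rewrite hI hJ; perm_lia.
  by rewrite -(perm_uniq hp).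
case hc: (T <= (size X)./2).
  have hi : i = T.-1 by rewrite /i hc.
  have hj : j = 1 by rewrite /j hi; clear -h4; lia.
  apply: (IH _ _ _ _ _ _ hR3 wX' wY' uX') => //; rewrite sX' ?sY' hi hj;
   move: (size X) (size Y) hn hl hxy hc h4 oX oY; clear; lia.
have hi : i = (size X)./2 by rewrite /i hc.
have hT1 : size (A2 ++ X2) = T by rewrite sX' -hij hi; move: (size X) oX; clear; lia.
have hT2 : size (rev Y2 ++ A1) = l - T.
  by rewrite sY' -hij -hl hi; move: (size X) (size Y) oX j2; clear; lia.
rewrite -{1}hT1 -hT2; have := reach_uniq hR3; rewrite cat_uniq => /and3P[uE1 _ uE2].
apply: emit2 hR3 _ _.
  apply: cyc_walk wX' _ uE1; move: uX'; rewrite -cat_cons cat_uniq; by case/andP.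
apply: cyc_walk wY' _ uE2.
have hp : perm_eq (w :: (J1 ++ al :: I2) ++ rev J2 ++ ga :: rev I1)
  ((w :: rev J2 ++ ga :: rev I1) ++ J1 ++ al :: I2) by perm_lia.
by move: uX'; rewrite (perm_uniq hp) cat_uniq => /andP[].
Qed.

(** A bead of [z] edges is cut into arcs for two strands that still lack [a] and [b] edges, when [r]
    more beads with [S] edges in total must each give an edge to both strands. *)
Lemma arc_choice (a b z r S : nat) : a + b = z + S -> 2 * r <= S -> r < a -> r < b -> 2 <= z ->
  exists2 c, 0 < c < z & (c <= a - r) && (z - c <= b - r).
Proof.
move=> h1 h2 h3 h4 h5; exists (minn z.-1 (a - r)); first by lia.
by have := geq_minl z.-1 (a - r); have := geq_minr z.-1 (a - r); rewrite minnC /minn; case: ltnP;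
  lia.
Qed.

Lemma vs_ge2 TT : ok TT -> 2 * size TT <= size (vs TT).
Proof.
elim: TT => // t TT IH /ok_cons[[x [E [J [h _ p]]]] hk]; rewrite vs_cons size_cat -(perm_size p).
have [e [E' [hE nE]]] := walk_size1 h; have := size_walk h; have := IH hk.
case: E' hE nE => // e' E' -> _ /=; move: (size _) (size _) (size _) (size _) => a1 a2 a3 a4.
by clear; lia.
Qed.

Hypothesis hvu : v <= u.

(* The closing switch has reversed one strand, so the strands now cross at w and ga;
   splitting the tour at either of them keeps it connected and lowers Psi. *)
Lemma crossing N (w ga de al : vtx) A B (a0 a1 b0 b1 i1 i2 : seq vtx) l s : reach N (A ++ B) ->
  walk de al A (a0 ++ w :: a1 ++ ga :: i1) -> walk al de B (b0 ++ w :: b1 ++ ga :: i2) ->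
  uniq (al :: de :: a0 ++ w :: a1 ++ ga :: i1) -> uniq (al :: de :: b0 ++ w :: b1 ++ ga :: i2) ->
  bnd v u l -> size A + size B = l ->
  exc (al :: de :: (a0 ++ w :: a1 ++ ga :: i1) ++ b0 ++ w :: b1 ++ ga :: i2) < s ->
  better N l s.
Proof.
set IA := _ ++ w :: a1 ++ _; set IB := _ ++ w :: b1 ++ _.
move=> hR wA wB uA uB hb hl hexc.
have wC := walk_cat wA wB.
pose P := al :: de :: IA ++ IB.
have pC : perm_eq (de :: IA ++ al :: IB) P by rewrite /P /IA /IB; perm_lia.
have sP : size P = l by rewrite -hl (size_walk wA) (size_walk wB) /P /IA /IB; size_lia.
have hP : 2 * count (@side v u) P = size P.
  by apply: (@tour_half _ _ _ (A ++ B)); apply: tour_perm (tour_walk wC).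
have cw : 1 < count_mem w P.
  by rewrite /P /IA /IB; repeat progress (rewrite ?count_cat ?eqxx /=); count_lia.
have cg : 1 < count_mem ga P.
  by rewrite /P /IA /IB; repeat progress (rewrite ?count_cat ?eqxx /=); count_lia.
have wg : w != ga.
  have : uniq (w :: a1 ++ ga :: i1) by move: uA => /= /and3P[_ _]; rewrite /IA cat_uniq => /and3P[].
  by case/andP => h _; apply: contraNneq h => ->; rewrite mem_cat mem_head orbT.
have fin g E1 I1 E2 I2 y x : perm_eq P (g :: I1 ++ g :: I2) -> walk g g E1 I1 -> walk g g E2 I2 ->
    perm_eq (E1 ++ E2) (A ++ B) -> g \notin I1 -> y \in I1 -> y \in I2 -> side x = side g ->
    x \notin P -> better N l s.
  move=> pP w1 w2 pE gI y1 y2 hs hx; rewrite (perm_mem pP) in hx.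
  have x1 : x \notin I1 by apply: contra hx => h; rewrite inE mem_cat h orbT.
  have x2 : x \notin g :: I2 by apply: contra hx => h; rewrite inE mem_cat h !orbT.
  have hR2 : reach N (E1 ++ E2) by apply: reach_perm hR; rewrite // perm_sym.
  have [E [tE hRE]] := cross_split hR2 w1 w2 gI y1 y2 hs x1 x2.
  have hx' : exc (x :: I1 ++ g :: I2) = exc (I1 ++ g :: I2).
    by rewrite exc_out // mem_cat (negbTE x1).
  have hg : exc P = (exc (I1 ++ g :: I2)).+1.
    by rewrite (exc_perm pP) exc_in // mem_cat mem_head orbT.
  exists [:: (E, x :: I1 ++ g :: I2)]; rewrite /eds /vs /Psi /= !cats0; split=> //.
  - by move=> t; rewrite inE => /eqP->.
  - by rewrite -sP (perm_size pP).
  - rewrite hx' lt0n exc_uniq cat_uniq; apply/negP => /and3P[_ /hasPn/(_ y) h _].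
    by move: h; rewrite inE y2 orbT /= y1 => /(_ isT).
  - by rewrite /vs /= cats0 hx' add1n -hg.
have [e1 [e2 [f1 [f2 [hE w1 w2]]]]] : exists E1 E2 F1 F2,
    [/\ A = E1 ++ E2 /\ B = F1 ++ F2, walk de w E1 a0, walk w al E2 (a1 ++ ga :: i1),
      walk al w F1 b0
     & walk w de F2 (b1 ++ ga :: i2)].
  have [E1 [E2 [h1 h2 h3]]] := walk_split wA; have [F1 [F2 [k1 k2 k3]]] := walk_split wB.
  by exists E1, E2, F1, F2.
move=> w3 w4; have [g1 [g2 [hg w5 w6]]] := walk_split w2;
  have [h1 [h2 [hh w7 w8]]] := walk_split w4.
case: hE => hA hB.
have [w' [x [/orP[/eqP hw|/eqP hw] hs hx]]] := free_two hvu (eq_ind_r (bnd v u) hb sP) hP wg cw cg.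
- have wE1 := walk_cat w4 w1; have wE2 := walk_cat w2 w3.
  rewrite hw in hs; apply: (fin w _ _ _ _ ga x) wE1 wE2 _ _ _ _ hs hx.
  + by rewrite /P /IA /IB; perm_lia.
  + by rewrite hA hB; perm_lia.
  + have wn1 : w \notin b1 ++ ga :: i2 /\ w \notin de :: a0.
      split; first by move: uB => /= /and3P[_ _]; rewrite /IB cat_uniq => /and3P[_ _ /andP[]].
      have pA : perm_eq (al :: de :: IA) (w :: (de :: a0) ++ al :: a1 ++ ga :: i1) by rewrite /IA;
        perm_lia.
      by move: uA; rewrite (perm_uniq pA) cons_uniq mem_cat negb_or => /andP[/andP[]].
    by rewrite mem_cat negb_or; case: wn1 => -> ->.
  + by rewrite !mem_cat mem_head !orbT.
  + by rewrite !mem_cat mem_head !orbT.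
rewrite hw in hs.
have wE1 := walk_cat w8 (walk_cat w1 w5); have wE2 := walk_cat w6 (walk_cat w3 w7).
apply: (fin ga _ _ _ _ w x) wE1 wE2 _ _ _ _ hs hx.
+ by rewrite /P /IA /IB; perm_lia.
+ by rewrite hA hB hg hh; perm_lia.
+ have wn1 : ga \notin i2 /\ ga \notin de :: a0 ++ w :: a1.
    split.
      have pB : perm_eq (al :: de :: IB) (ga :: i2 ++ al :: de :: b0 ++ w :: b1) by rewrite /IB;
        perm_lia.
      by move: uB; rewrite (perm_uniq pB) cons_uniq mem_cat negb_or => /andP[/andP[]].
    have pA : perm_eq (al :: de :: IA) (ga :: (de :: a0 ++ w :: a1) ++ al :: i1) by rewrite /IA;
      perm_lia.
    by move: uA; rewrite (perm_uniq pA) cons_uniq mem_cat negb_or => /andP[/andP[]].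
  by rewrite mem_cat negb_or; case: wn1 => -> ->.
+ by rewrite mem_cat inE mem_cat mem_head !orbT.
+ by rewrite mem_cat inE mem_cat mem_head !orbT.
Qed.

Lemma exc_fresh (U : eqType) (S S' : seq U) : uniq S' -> {in S', forall y : U, y \notin S} ->
  exc (S' ++ S) = exc S.
Proof. by rewrite -exc_uniq => /eqP h1 h2; rewrite exc_cat // h1. Qed.

(* Two strands al - w - ga (interiors a0, a1 and b0, b1) meeting in w, and the beads rest
   still to be attached at ga; T and l - T are the target lengths. *)
Record link N T l s rest (w al ga : vtx) (a0 a1 b0 b1 : seq vtx) : Prop := Link {
  lk_edges : exists A0 A1 B0 B1, [/\ walk al w A0 a0 /\ walk w ga A1 a1, walk al w B0 b0,
    walk w ga B1 b1 & reach N (A0 ++ A1 ++ B0 ++ B1 ++ eds rest)];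
  lk_ok : ok rest;
  lk_uniq : uniq (vs rest);
  lk_uA : uniq (al :: ga :: w :: a0 ++ a1);
  lk_uB : uniq (al :: ga :: w :: b0 ++ b1);
  lk_disj : {in vs rest, forall y, y \notin al :: ga :: w :: w :: a0 ++ a1 ++ b0 ++ b1};
  lk_A : (size a0 + size a1).+2 + size rest <= T;
  lk_B : (size b0 + size b1).+2 + size rest <= l - T;
  lk_size : (size a0 + size a1).+2 + (size b0 + size b1).+2 + size (vs rest) = l;
  lk_exc : exc (al :: ga :: w :: w :: a0 ++ a1 ++ b0 ++ b1) + size rest < s }.

(** The next bead is pulled to the common end [ga] and cut at a point [de], which becomes the new
    end; its two arcs prolong the strands. If the bead fuses with the strands instead, no repetition
    is added and [lk_exc] bounds [Psi] of the new state. *)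
Lemma link_step N T l s t rest w al ga a0 a1 b0 b1 : T <= l ->
  link N T l s (t :: rest) w al ga a0 a1 b0 b1 ->
  better N l s \/ exists de i1 i2,
    link N T l s rest w al de a0 (a1 ++ ga :: i1) b0 (b1 ++ ga :: i2).
Proof.
move=> hTl [[A0 [A1 [B0 [B1 [[wA0 wA1] wB0 wB1 hR]]]]] hk hV uA uB hd hA hB hl hs].
have [ht hkr] := (iffLR (ok_cons _ _) hk).
have [b bt sb] := tour_side (side ga) ht.
have [Z [Iz [wZ pZ pIz]]] := tour_at ht bt.
rewrite vs_cons in hV hd hl.
set P := al :: ga :: _ in hd hs.
have pV : perm_eq (t.2 ++ vs rest) ((b :: Iz) ++ vs rest) by rewrite perm_cat2r perm_sym.
rewrite (perm_uniq pV) in hV; rewrite (perm_size pV) in hl.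
have /and3P[uZ hZr uV] := (etrans (esym (cat_uniq _ _)) hV).
have tP : tour (A0 ++ A1 ++ B0 ++ B1) P.
  apply: tour_perm (tour_walk (walk_cat (walk_cat wA0 wA1) (walk_rev (walk_cat wB0 wB1))));
  by rewrite /P; perm_lia.
have hZP : {in b :: Iz, forall y, y \notin P}.
  by move=> y hy; apply: hd; rewrite (perm_mem pV) mem_cat hy.
have hrP : {in vs rest, forall y, y \notin P}.
  by move=> y hy; apply: hd; rewrite (perm_mem pV) mem_cat hy orbT.
have gP : ga \in P by rewrite /P !inE eqxx orbT.
have hF : {in eds rest, forall e, ~~ inc e ga && ~~ inc e b}.
  move=> e he; apply/andP; split; apply/negP => hi; have hv := eds_inc hkr he hi.
    by have := hrP _ hv; rewrite gP.
  by move/hasPn: hZr => /(_ _ hv); rewrite mem_head.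
have hR1 : reach N (Z ++ (A0 ++ A1 ++ B0 ++ B1) ++ eds rest).
  apply: reach_perm hR => //; rewrite eds_cons; perm_from pZ.
have excP : exc ((b :: Iz) ++ P) = exc P by apply: exc_fresh.
have sP : size P = (size a0 + size a1).+2 + (size b0 + size b1).+2 by rewrite /P; size_lia.
have repP : 0 < exc P.
  rewrite lt0n exc_uniq; apply/negP; rewrite /P => /= /and4P[_ _ + _].
  by rewrite inE eqxx.
case: (attach hR1 wZ uZ tP gP hZP (esym sb) hF) => [[Z' [wZ' sZ' hR2]]|[E [tE hRE]]]; last first.
  left; exists ((E, (b :: Iz) ++ P) :: rest); split=> //.
  - by apply/ok_cons.
  - rewrite vs_cons !size_cat -hl size_cat sP /=.
    by move: (size (vs rest)) (size Iz) => p q; clear; lia.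
  - rewrite vs_cons exc_cat ?excP; first by rewrite ltn_addr.
    move=> y; rewrite mem_cat => /orP[hy|hy].
      by apply/negP => h; move/hasPn: hZr => /(_ _ h); rewrite /= hy.
    by apply/negP => /hrP; rewrite hy.
  rewrite /Psi vs_cons exc_cat ?excP; last first.
    move=> y; rewrite mem_cat => /orP[hy|hy].
      by apply/negP => h; move/hasPn: hZr => /(_ _ h); rewrite /= hy.
    by apply/negP => /hrP; rewrite hy.
  have -> : exc (vs rest) = 0 by apply/eqP; rewrite exc_uniq.
  by rewrite addn0 addnC.
right.
have sz := size_walk wZ'; have oZ := even_closed wZ'.
have [c hc hcc] : exists2 c, 0 < c < size Z' & (c <= T - (size a0 + size a1).+2 - size rest) &&
    (size Z' - c <= l - T - (size b0 + size b1).+2 - size rest).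
  apply: (@arc_choice _ _ _ _ (size (vs rest))).
  - move: hA hB hl; rewrite size_cat /= sz; move: (size (vs rest)) (size Iz) (size rest) => p q r.
    by move: hTl; clear; lia.
  - exact: vs_ge2.
  - by move: hA => /=; clear; lia.
  - by move: hB => /=; clear; lia.
  - by move: oZ; rewrite sz; move: (size Iz); clear; case.
have [de [Z1 [Z2 [i1 [i2 [hI hZ w1 w2 s1]]]]]] := walk_cut wZ' hc.
exists de, i1, (rev i2).
have pI : perm_eq Iz (de :: i1 ++ i2) by rewrite hI; perm_lia.
have sI : size Iz = (size i1 + size i2).+1 by rewrite (perm_size pI) /= size_cat.
have si1 := size_walk w1; have si2 := size_walk w2.
have dI y : y \in de :: i1 ++ i2 -> y \in b :: Iz by rewrite -(perm_mem pI) inE orbC => ->.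
have uI : uniq (de :: i1 ++ i2) by rewrite -(perm_uniq pI); case/andP: uZ.
have ext (K L M : seq vtx) : uniq L -> uniq K -> {subset K <= de :: i1 ++ i2} -> {subset L <= P} ->
    perm_eq M (K ++ L) -> uniq M.
  move=> uL uK sK sL pM; rewrite (perm_uniq pM); apply: uniq_cat2 => // y hy.
  by apply/negP => /sL; apply/negP; apply: hZP; apply: dI; apply: sK.
split=> //.
- exists A0, (A1 ++ Z1), B0, (B1 ++ rev Z2); split=> //.
  + by split=> //; apply: walk_cat wA1 w1.
  + by apply: walk_cat wB1 (walk_rev w2).
  by apply: reach_perm hR2 => //; rewrite hZ; perm_lia.
- apply: (ext (de :: i1) (al :: ga :: w :: a0 ++ a1)) => //.
  + by move: uI; rewrite -cat_cons cat_uniq => /andP[].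
  + by move=> y; rewrite !inE mem_cat => /orP[->|->] //; rewrite orbT.
  + by move=> y; rewrite /P !(inE, mem_cat); do !case: (_ == _) => //; do !case: (_ \in _).
  + by perm_lia.
- apply: (ext (de :: rev i2) (al :: ga :: w :: b0 ++ b1)) => //.
  + have : uniq ((de :: i2) ++ i1) by rewrite -(perm_uniq (_ : perm_eq (de :: i1 ++ i2) _)) //;
      perm_lia.
    by rewrite cat_uniq /= rev_uniq mem_rev => /andP[].
  + by move=> y; rewrite !inE mem_cat mem_rev => /orP[->|->] //; rewrite !orbT.
  + by move=> y; rewrite /P !(inE, mem_cat); do !case: (_ == _) => //; do !case: (_ \in _).
  + by perm_lia.
- move=> y hy; have := hrP _ hy => h1.
  have h2 : y \notin b :: Iz by apply/negP => h; move/hasPn: hZr => /(_ _ hy); rewrite /= h.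
  have pq : perm_eq ((b :: al :: de :: w :: w :: a0 ++ (a1 ++ ga :: i1) ++ b0 ++ b1 ++ ga :: rev
    i2))
    ((b :: Iz) ++ ga :: P) by rewrite hI /P; perm_lia.
  apply: (@contra _ (y \in (b :: Iz) ++ ga :: P)); first by rewrite -(perm_mem pq) inE => ->;
    rewrite orbT.
  by rewrite mem_cat (negbTE h2) in_cons (negbTE h1) orbF; apply: contraNneq h1 => ->.
- by move: hcc hA; rewrite -s1 si1 => /andP[h _]; move: h; size_lia.
- have -> : size (b0) + size (b1 ++ ga :: rev i2) = size b0 + size b1 + (size Z' - c).
    have -> : size Z' - c = (size i2).+1 by rewrite hZ size_cat s1 addKn.
    by size_lia.
  by move: hcc hB => /andP[_]; size_lia.
- by rewrite -hl [in RHS]size_cat /= sI; size_lia.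
have pq : perm_eq (al :: de :: w :: w :: a0 ++ (a1 ++ ga :: i1) ++ b0 ++ b1 ++ ga :: rev i2)
    ((de :: i1 ++ i2) ++ ga :: P) by rewrite /P; perm_lia.
rewrite (exc_perm pq) exc_fresh //.
  by rewrite exc_in //; move: hs => /=; rewrite addSn addnS.
move=> y hy; rewrite inE; have hyP := hZP _ (dI _ hy).
by rewrite negb_or hyP andbT; apply: contraNneq hyP => ->.
Qed.

(** With no bead left, the bounds [lk_A], [lk_B] and the total force the strand lengths [T] and
    [l - T]. The strands meet in [w] and in [ga], so a failed [close] leads to [crossing]. *)
Lemma link_end N T l s w al ga de a0 a1 b0 b1 i1 i2 : bnd v u l -> ~~ odd T -> T <= l ->
  link N T l s [::] w al de a0 (a1 ++ ga :: i1) b0 (b1 ++ ga :: i2) ->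
  wins (T :: l - T :: N) \/ better N l s.
Proof.
move=> hb oT hTl [[A0 [A1 [B0 [B1 [[wA0 wA1] wB0 wB1 hR]]]]] _ _ uA uB _ hA hB hl hs].
have wA := walk_cat wA0 wA1; have wB := walk_cat wB0 wB1.
have sA : size (A0 ++ A1) = T.
  by rewrite (size_walk wA); move: hA hB hl hTl => /=; rewrite /vs /=; size_lia.
have sB : size (B0 ++ B1) = l - T.
  by rewrite (size_walk wB); move: hA hB hl hTl => /=; rewrite /vs /=; size_lia.
have hs' : side al = side de by have := walk_side wA; rewrite sA (negbTE oT) addbF.
have uA' : uniq (al :: de :: a0 ++ w :: a1 ++ ga :: i1).
  by rewrite (perm_uniq (_ : perm_eq _ (al :: de :: w :: a0 ++ a1 ++ ga :: i1))) //; perm_lia.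
have uB' : uniq (al :: de :: b0 ++ w :: b1 ++ ga :: i2).
  by rewrite (perm_uniq (_ : perm_eq _ (al :: de :: w :: b0 ++ b1 ++ ga :: i2))) //; perm_lia.
have hR1 : reach N ((A0 ++ A1) ++ B0 ++ B1).
  by apply: reach_perm hR => //; rewrite /eds /=; perm_lia.
case: (close hR1 wA wB uA' uB' hs'); first by rewrite sA sB; left.
move=> [A' [wA' sA' hR2]]; right; apply: (crossing hR2 wA' wB uA' uB' hb).
  by rewrite sA' sA sB; apply: subnKC.
rewrite /= addn0 in hs; apply: leq_ltn_trans hs.
by rewrite (@exc_perm _ _ (al :: de :: w :: w :: a0 ++ (a1 ++ ga :: i1) ++ b0 ++ b1 ++ ga :: i2))
  //; perm_lia.
Qed.

Lemma link_win N T l s rest w al ga a0 a1 b0 b1 : bnd v u l -> ~~ odd T -> T <= l ->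
  rest != [::] -> link N T l s rest w al ga a0 a1 b0 b1 ->
  wins (T :: l - T :: N) \/ better N l s.
Proof.
move=> hb oT hTl; elim: rest ga a1 b1 => // t rest IH ga a1 b1 _ hL.
case: (link_step hTl hL) => [|[de [i1 [i2 hL']]]]; first by right.
case: rest IH hL' {hL} => [_ hL'|t' rest IH hL']; first exact: link_end hL'.
exact: IH hL'.
Qed.

(** Since the tours are disjoint, the only repeated vertex [w] is visited twice by one tour; it is
    cut there into the loops [X] and [Y], and all other tours are cycles. *)
Lemma figure_eight TT : ok TT -> disj TT -> exc (vs TT) = 1 -> exists w X Ix Y Iy Zs,
  [/\ walk w w X Ix /\ walk w w Y Iy, perm_eq (eds TT) (X ++ Y ++ eds Zs),
     perm_eq (vs TT) (w :: Ix ++ w :: Iy ++ vs Zs), uniq (w :: Ix ++ Iy ++ vs Zs)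
     & ok Zs /\ size TT = (size Zs).+1].
Proof.
move=> hk hd he; have [w hw] : exists w, 1 < count_mem w (vs TT) by apply: repeat_of_exc;
  rewrite he.
have : w \in vs TT by rewrite -has_pred1 has_count; apply: ltn_trans hw.
rewrite mem_vs => /hasP[t tT wt].
have pT := perm_to_rem tT; set Zs := rem t TT in pT.
have [hkt hkZ] := (iffLR (ok_cons _ _) (ok_perm pT hk)).
have dZ := disj_cons (disj_perm pT hd) wt.
have [E [J [wE pE pJ]]] := tour_at hkt wt.
have pV : perm_eq (vs TT) (w :: J ++ vs Zs).
  by apply: (perm_trans (vs_perm pT)); rewrite vs_cons; perm_from pJ.
have wJ : w \in J.
  move: hw; rewrite (permP pV) /= eqxx count_cat (count_memPn dZ) addn0 ltnS.
  by rewrite -has_count has_pred1.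
have [Ix [Iy [hJ wI]]] := first_occ wJ; rewrite hJ in wE.
have [X [Y [hE wX wY]]] := walk_split wE.
have pV2 : perm_eq (vs TT) (w :: Ix ++ w :: Iy ++ vs Zs).
  by apply: (perm_trans pV); rewrite hJ; perm_lia.
exists w, X, Ix, Y, Iy, Zs; split=> //; last by split=> //; rewrite (perm_size pT).
- apply: (perm_trans (eds_perm pT)); rewrite eds_cons catA perm_cat2r -hE.
  by rewrite perm_sym.
- move: he; rewrite (exc_perm (perm_trans pV2 (_ : perm_eq _ (w :: w :: Ix ++ Iy ++ vs Zs))));
    last by perm_lia.
  by rewrite exc_in ?mem_head // => -[/eqP]; rewrite exc_uniq.
Qed.

(** The beads are [X], [Y] and the remaining tours, [Psi TT] in number. The bound
    [Psi TT <= T <= l - T] leaves room for an edge of each bead on both strands. *)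
Lemma win_or_better N T l TT : bnd v u l -> ~~ odd T -> 4 <= T -> T <= l - T ->
  ok TT -> disj TT -> exc (vs TT) = 1 -> reach N (eds TT) -> size (vs TT) = l -> Psi TT <= T ->
  wins (T :: l - T :: N) \/ better N l (Psi TT).
Proof.
move=> hb oT h4 hTl hk hd he hR hl hP.
have [w [X [Ix [Y [Iy [Zs [[wX wY] pE pV uV [kZ sT]]]]]]]] := figure_eight hk hd he.
have eP : Psi TT = (size Zs).+2 by rewrite /Psi he sT addn1.
have sX := size_walk wX; have sY := size_walk wY.
have hl' : size X + size Y + size (vs Zs) = l.
  by rewrite -hl (perm_size pV) sX sY; size_lia.
have hR1 : reach N (X ++ Y ++ eds Zs) by apply: reach_perm hR.
(* Without further beads the strands meet only in [w], while [crossing] needs two meeting points;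
   [chain2] covers this case. *)
case: Zs eP kZ pE pV uV sT hl' hR1 => [|t rest] eP kZ pE pV uV sT hl' hR1.
  left; rewrite /vs /eds /= ?addn0 ?cats0 in hl' hR1 uV.
  case: (leqP (size X) (size Y)) => hxy; first exact: chain2 hR1 wX wY uV hl' hxy h4 oT hTl.
  apply: (chain2 (w := w) (X := Y) (Y := X) _ wY wX _ _ (ltnW hxy)) => //.
  - by apply: reach_perm hR1; rewrite // perm_catC.
  - by rewrite (perm_uniq (_ : perm_eq _ (w :: Ix ++ Iy))) // perm_cons perm_catC.
  - by rewrite addnC.
set Zs := t :: rest in eP kZ pE pV uV sT hl' hR1 *.
have oX := even_closed wX; have oY := even_closed wY.
have hZ := vs_ge2 kZ.
have [i hi /andP[hi1 hi2]] : exists2 c,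
  0 < c < size X & (c <= T - (size Zs).+1) && (size X - c <= l - T - (size Zs).+1).
  apply: (@arc_choice _ _ _ _ (size Y + size (vs Zs))).
  - by move: hl' hTl; size_lia.
  - by move: oY hZ; rewrite sY; case: (size Iy) => //; size_lia.
  - by rewrite eP in hP.
  - by rewrite eP in hP; apply: leq_trans hTl.
  - by move: oX; rewrite sX; case: (size Ix).
have [j hj /andP[hj1 hj2]] : exists2 c,
  0 < c < size Y & (c <= T - i - (size Zs)) && (size Y - c <= l - T - (size X - i) - (size Zs)).
  apply: (@arc_choice _ _ _ _ (size (vs Zs))) => //.
  - move: hl' hTl hi1 hi2 hi eP hP; size_lia.
  - move: hi1 hi; rewrite eP in hP; move: hP; size_lia.
  - move: hi2 hi; rewrite eP in hP; move: hP hTl; size_lia.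
  - by move: oY; rewrite sY; case: (size Iy).
have [al [X1 [X2 [I1 [I2 [hI hXX wX1 wX2 s1]]]]]] := walk_cut wX hi.
have [ga [Y1 [Y2 [J1 [J2 [hJ hYY wY1 wY2 s2]]]]]] := walk_cut wY hj.
have sX1 := size_walk wX1; have sX2 := size_walk wX2; have sY1 := size_walk wY1;
  have sY2 := size_walk wY2.
have pP : perm_eq (w :: Ix ++ Iy ++ vs Zs)
  ((al :: ga :: w :: rev I1 ++ J1) ++ (I2 ++ rev J2) ++ vs Zs) by rewrite hI hJ; perm_lia.
have pP2 : perm_eq (w :: Ix ++ Iy ++ vs Zs)
  ((al :: ga :: w :: I2 ++ rev J2) ++ (rev I1 ++ J1) ++ vs Zs) by rewrite hI hJ; perm_lia.
have pP3 : perm_eq (w :: Ix ++ Iy ++ vs Zs)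
  ((al :: ga :: w :: rev I1 ++ J1 ++ I2 ++ rev J2) ++ vs Zs) by rewrite hI hJ; perm_lia.
apply: (@link_win N T l _ Zs w al ga (rev I1) J1 I2 (rev J2)) => //;
  first by apply: leq_trans hTl (leq_subr _ _).
split=> //.
- exists (rev X1), Y1, X2, (rev Y2); split=> //; [split=> //| |]; try exact: walk_rev.
  by apply: reach_perm hR1 => //; rewrite hXX hYY; perm_lia.
- by move: uV; rewrite (perm_uniq pP3) cat_uniq => /and3P[].
- by move: uV; rewrite (perm_uniq pP) cat_uniq => /and3P[].
- by move: uV; rewrite (perm_uniq pP2) cat_uniq => /and3P[].
- move=> y hy; have : y \notin al :: ga :: w :: rev I1 ++ J1 ++ I2 ++ rev J2.
    move: uV; rewrite (perm_uniq pP3) cat_uniq => /and3P[_ /hasPn/(_ _ hy) + _].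
    by [].
  by apply: contra; rewrite !in_cons; do !case: (_ == _).
- by rewrite size_rev; move: hj1 hi1 hi hj; rewrite -s1 -s2 sX1 sY1; rewrite eP in hP; move: hP;
    size_lia.
- rewrite size_rev; move: hj2 hi2 hi hj; rewrite -s1 -s2 hXX hYY !size_cat !addKn sX2 sY2;
    rewrite eP in hP; move: hP hTl; size_lia.
- by rewrite -hl' hXX hYY !size_cat sX1 sX2 sY1 sY2 !size_rev; size_lia.
rewrite eP ltnS -[size Zs]add0n -[X in _ <= X]add1n addnA leq_add2r.
rewrite (@exc_perm _ _ (w :: (al :: ga :: w :: rev I1 ++ J1 ++ I2 ++ rev J2))); last by perm_lia.
rewrite exc_in ?inE ?eqxx ?orbT //.
have : uniq (al :: ga :: w :: rev I1 ++ J1 ++ I2 ++ rev J2).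
  by move: uV; rewrite (perm_uniq pP3) cat_uniq => /and3P[].
by rewrite -exc_uniq => /eqP->.
Qed.

Lemma win N T l TT : bnd v u l -> ~~ odd T -> 4 <= T -> T <= l - T ->
  ok TT -> reach N (eds TT) -> size (vs TT) = l -> 0 < exc (vs TT) -> Psi TT <= T ->
  wins (T :: l - T :: N).
Proof.
move=> hb oT h4 hTl; move: {2}(Psi TT) (leqnn (Psi TT)) => n.
elim: n TT => [|n IH] TT hn hk hR hl he hP; first by move: hn; rewrite /Psi; lia.
have hb' : bnd v u (size (vs TT)) by rewrite hl.
have [T1 [[k1 d1] r1 s1 e1 p1]] := reduce1 (@switching_reach _ _ _ _) hvu hb' hR hk he.
have := win_or_better hb oT h4 hTl k1 d1 e1 r1 (etrans s1 hl) (leq_trans p1 hP).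
case=> // -[T2 [k2 r2 s2 e2 p2]]; apply: IH k2 r2 s2 e2 _.
  by rewrite -ltnS; apply: leq_trans p2 (leq_trans p1 hn).
by apply: leq_trans (ltnW p2) (leq_trans p1 hP).
Qed.

End Win.

(** * Moves on lists of cycle lengths *)

Section Parts.
Variables v u lam : nat.
Hypothesis hvu : v <= u.
Notation vtx := (vtx v u).
Notation edge := (edge v u lam).
Notation wins N := (reach N (@nil edge)).
Implicit Types (e : edge) (x y z w a b : vtx) (A B E F G X Y Z : seq edge) (I J S Vs IA IB : seq
  vtx).
Implicit Types (TT PP QQ DD : seq (seq edge * seq vtx)) (N : seq nat).

Lemma vs_cat TT TT' : vs (TT ++ TT') = vs TT ++ vs TT'.
Proof. by rewrite /vs map_cat flatten_cat. Qed.

Lemma emit_tour N E Vs F : reach N (E ++ F) -> tour E Vs -> uniq Vs -> reach (size Vs :: N) F.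
Proof.
move=> hR t uV; have [x [E' [I [h p1 p2]]]] := t.
have uE : uniq E by have := reach_uniq hR; rewrite cat_uniq => /andP[].
rewrite (tour_size t) -(perm_size p1); apply: emit.
  by apply: cyc_walk h _ _; rewrite ?(perm_uniq p1) ?(perm_uniq p2).
by apply: reach_perm hR => //; rewrite perm_cat2r perm_sym.
Qed.

Lemma absorb_tour N m F : reach (m :: N) F -> exists E Vs,
  [/\ tour E Vs, uniq Vs, size Vs = m & reach N (E ++ F)].
Proof.
move=> h; have [C [[x [I [w uI uC]]] sC hR]] := absorb h.
exists C, (x :: I); split=> //; first exact: tour_walk.
by rewrite -sC (size_walk w).
Qed.

Lemma even_tour E Vs : tour E Vs -> ~~ odd (size Vs).
Proof. by move=> /tour_half <-; rewrite oddM. Qed.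

(** Pull [t1] to a vertex of [t2]. If it moves, there is one tour fewer and one repetition, so [Psi]
    equals the former number of cycles. If not, the two cycles fuse without repetition. *)
Lemma join_step N t1 t2 rest : reach N (eds (t1 :: t2 :: rest)) -> ok (t1 :: t2 :: rest) ->
  uniq (vs (t1 :: t2 :: rest)) ->
  (exists TT, [/\ ok TT, reach N (eds TT), size (vs TT) = size (vs (t1 :: t2 :: rest)),
     0 < exc (vs TT) & Psi TT <= size (t1 :: t2 :: rest)]) \/
  exists E, tour E (t1.2 ++ t2.2) /\ reach N (E ++ eds rest).
Proof.
move=> hR /ok_cons[k1 /ok_cons[k2 kr]]; rewrite !vs_cons => uV.
have [a a1 _] := tour_side true k2; have [b b1 hs] := tour_side (side a) k1.
have [Z [Iz [wZ pZ pIz]]] := tour_at k1 b1.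
have /and3P[u1 n1 /(etrans (esym (cat_uniq _ _)))/and3P[u2 n2 ur]] := (etrans (esym (cat_uniq _ _))
  uV).
have hR1 : reach N (Z ++ t2.1 ++ eds rest).
  by apply: reach_perm hR => //; rewrite !eds_cons; perm_from pZ.
have uZ : uniq (b :: Iz) by rewrite (perm_uniq pIz).
have hd : {in b :: Iz, forall y, y \notin t2.2}.
  by move=> y; rewrite (perm_mem pIz) => y1; apply: contraL y1 => y2; apply: (hasPn n1);
    rewrite mem_cat y2.
have hF : {in eds rest, forall e, ~~ inc e a && ~~ inc e b}.
  move=> e he; apply/andP; split; apply/negP => hi; have hv := eds_inc kr he hi.
    by move/hasPn: n2 => /(_ _ hv); rewrite /= a1.
  by move/hasPn: n1 => /(_ b); rewrite mem_cat hv orbT /= b1 => /(_ isT).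
case: (attach hR1 wZ uZ k2 a1 hd (esym hs) hF) => [[Z' [wZ' sZ' hR2]]|[E [tE hRE]]]; last first.
  right; exists E; split=> //; apply: tour_perm tE => //.
  by rewrite perm_cat2r.
left; exists ((Z' ++ t2.1, (a :: Iz) ++ t2.2) :: rest).
have sI : size t1.2 = (size Iz).+1 by rewrite -(perm_size pIz).
have eV : exc (vs ((Z' ++ t2.1, (a :: Iz) ++ t2.2) :: rest)) = 1.
  rewrite vs_cons -catA cat_cons exc_in; last by rewrite !mem_cat a1 orbT.
  congr _.+1; apply/eqP; rewrite exc_uniq.
  move: uV; rewrite -(perm_uniq (_ : perm_eq (b :: Iz ++ t2.2 ++ vs rest) _)) => [/andP[]//|].
  by perm_from pIz.
split=> //.
- by apply/ok_cons; split=> //=; apply: tour_cat (tour_walk wZ') k2 _ a1; rewrite mem_head.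
- by rewrite eds_cons -catA.
- by rewrite !vs_cons !size_cat sI /=; clear; lia.
- by rewrite eV.
by rewrite /Psi eV addn1.
Qed.

(** Vertex-disjoint cycles offer no repetition to [win]. Cycles are joined within each part: either
    a repetition appears and [win] finishes, or each part becomes one cycle. *)
Lemma two_parts N T l PP QQ : bnd v u l -> ~~ odd T -> 4 <= T -> T <= l - T ->
  ok (PP ++ QQ) -> uniq (vs (PP ++ QQ)) -> reach N (eds (PP ++ QQ)) ->
  size (vs PP) = T -> size (vs QQ) = l - T -> size (PP ++ QQ) <= T ->
  wins (T :: l - T :: N).
Proof.
move=> hb oT h4 hTl; move: {2}(size (PP ++ QQ)) (leqnn (size (PP ++ QQ))) => n.
elim: n PP QQ => [|n IH] PP QQ hn hk hu hR hP hQ hs.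
  by move: hP; case: PP hn {hk hu hR hs} => // _; rewrite /vs /= => h; move: h4; rewrite -h.
have hl : size (vs (PP ++ QQ)) = l by rewrite vs_cat size_cat hP hQ; clear -hTl h4; lia.
have use TT : ok TT -> reach N (eds TT) -> size (vs TT) = l -> 0 < exc (vs TT) ->
  Psi TT <= size (PP ++ QQ) ->
    wins (T :: l - T :: N).
  by move=> k r s e p; apply: (win hvu hb oT h4 hTl k r s e); apply: leq_trans hs.
case: PP hn hk hu hR hP hs hl use => [|t1 [|t2 P']].
- by move=> _ _ _ _ hP; move: h4; rewrite -hP.
- case: QQ hQ => [|q1 [|q2 Q']].
  + by move=> hQ; move: hTl; rewrite -hQ leqn0 => /eqP hT; rewrite hT in h4.
  + move=> hQ _ /ok_cons[/= k1 /ok_cons[k2 _]] hu hR hP _ _ _.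
    rewrite /vs /= cats0 in hP hu hQ; rewrite /eds /= in hR.
    rewrite cats0 cat_uniq in hu; case/and3P: hu => u1 _ u2.
    rewrite -hQ -hP; rewrite cats0; apply: (emit_tour _ k1 u1);
      apply: (emit_tour (Vs := q1.2) (E := q1.1)) => //.
    by apply: reach_perm hR => //; perm_lia.
  move=> hQ hn hk hu hR hP hs hl use.
  have pp : perm_eq ([:: t1] ++ [:: q1, q2 & Q']) [:: q1, q2 & rcons Q' t1].
    by rewrite -cats1; perm_lia.
  have hk2 := ok_perm pp hk; rewrite (perm_uniq (vs_perm pp)) in hu.
  have hR2 := reach_perm (perm_refl N) (eds_perm pp) hR.
  case: (join_step hR2 hk2 hu) => [[TT [k r s e p]]|[E [tE hRE]]].
    apply: use k r _ e _; first by rewrite s -hl (perm_size (vs_perm pp)).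
    by apply: leq_trans p _; rewrite /= size_rcons.
  have pp2 : perm_eq ((E, q1.2 ++ q2.2) :: rcons Q' t1) ([:: t1] ++ (E, q1.2 ++ q2.2) :: Q').
    by rewrite -cats1; perm_lia.
  have hk3 : ok ((E, q1.2 ++ q2.2) :: rcons Q' t1).
    apply/ok_cons; split=> // t ht; apply: hk2; by rewrite !inE ht !orbT.
  apply: (IH [:: t1] ((E, q1.2 ++ q2.2) :: Q')) => //.
  + exact: ok_perm pp2 hk3.
  + by rewrite -(perm_uniq (vs_perm pp2)) vs_cons -catA; rewrite !vs_cons in hu.
  + exact: reach_perm (perm_refl N) (eds_perm pp2) hRE.
  + by rewrite -hQ !vs_cons catA.
  + by apply: leq_trans hs.
move=> hn hk hu hR hP hs hl use.
case: (join_step hR hk hu) => [[TT [k r s e p]]|[E [tE hRE]]].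
  by apply: use k r _ e p; rewrite s -hl.
apply: (IH ((E, t1.2 ++ t2.2) :: P') QQ) => //.
- by apply/ok_cons; split=> // t ht; apply: hk; rewrite !inE ht !orbT.
- by move: hu; rewrite !cat_cons !vs_cons -catA.
- by rewrite -hP !vs_cons catA.
by apply: leq_trans hs.
Qed.

End Parts.

(** * Absorbing 2-cycles *)

Section Absorption.
Variables v u lam : nat.
Hypothesis hvu : v <= u.
Notation vtx := (vtx v u).
Notation edge := (edge v u lam).
Notation wins N := (reach N (@nil edge)).
Implicit Types (e : edge) (x y z w a b : vtx) (A B E F G X Y Z : seq edge) (I J S Vs IA IB : seq
  vtx).
Implicit Types (TT PP QQ DD : seq (seq edge * seq vtx)) (N : seq nat).

Lemma two_cycle N F : reach (2 :: N) F -> exists a b D,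
  [/\ walk b b D [:: a], a != b, ~~ side b & reach N (D ++ F)].
Proof.
move=> /absorb_tour[D [Vs [tD uV sV hR]]]; have [b bV sb] := tour_side false tD.
have [E [I [w pE pI]]] := tour_at tD bV.
have := perm_size pI; rewrite sV; case: I w pI => // a [] // w pI _.
exists a, b, E; split=> //.
- by move: uV; rewrite -(perm_uniq pI) /= inE andbT eq_sym.
- by rewrite sb.
by apply: reach_perm hR => //; rewrite perm_cat2r perm_sym.
Qed.

Lemma absorb2 N TT : reach (2 :: N) (eds TT) -> ok TT -> bnd v u (size (vs TT) + 2) ->
  exists TT', [/\ ok TT', reach N (eds TT'), size (vs TT') = size (vs TT) + 2,
    Psi TT' <= Psi TT + 1 & 0 < exc (vs TT') \/ exists2 D, TT' = D :: TT & size D.2 = 2].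
Proof.
move=> hR hk hb; have [a [b [D [wD ab sb hR1]]]] := two_cycle hR.
have tD := tour_walk wD.
have [T1 [k1 d1 e1 v1 s1]] := normalize hk.
have sV1 := perm_size v1; have xV1 := exc_perm v1; have mV1 := perm_mem v1.
have hR2 : reach N (D ++ eds T1) by apply: reach_perm hR1; rewrite // perm_cat2l perm_sym.
have kD : ok ((D, [:: b; a]) :: T1) by apply/ok_cons.
have common y : y \in [:: b; a] -> y \in vs TT ->
    [\/ b \notin vs TT, a \notin vs TT | False] ->
      exists TT', [/\ ok TT', reach N (eds TT'), size (vs TT') = size (vs TT) + 2,
    Psi TT' <= Psi TT + 1 & 0 < exc (vs TT')].
  move=> yb yV hc.
  have [|T2 [k2 e2 v2 s2]] := merge1 (y := y) kD.
    by rewrite /= yb /= add1n ltnS -has_count -mem_vs mV1.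
  have x2 : exc (vs T2) = (exc (vs TT)).+1.
    rewrite (exc_perm v2) vs_cons /=; case: hc => // hc.
      have ya : y = a by move: yb yV; rewrite !inE => /orP[]/eqP-> //; rewrite (negbTE hc).
      rewrite exc_out; last by rewrite inE eq_sym (negbTE ab) mV1.
      by rewrite exc_in ?xV1 // mV1 -ya.
    have ya : y = b by move: yb yV; rewrite !inE => /orP[]/eqP-> //; rewrite (negbTE hc).
    rewrite exc_in; last by rewrite inE mV1 -ya yV orbT.
    by rewrite exc_out ?xV1 // mV1.
  exists T2; split=> //.
  - by apply: reach_perm hR2 => //; rewrite perm_sym.
  - by rewrite (perm_size v2) vs_cons /= sV1 addn2.
  - by rewrite /Psi x2; move: s2 s1 => /=; clear; lia.
  - by rewrite x2.
have main : b \in vs TT -> a \in vs TT ->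
  exists TT', [/\ ok TT', reach N (eds TT'), size (vs TT') = size (vs TT) + 2,
    Psi TT' <= Psi TT + 1 & 0 < exc (vs TT')].
  move=> bV aV.
  have [x [hx xV]] : exists x, side x = side b /\ x \notin b :: a :: vs T1.
    apply: (free_U hvu) => //.
    - by rewrite /= sV1 -addn2.
    - by have := ok_half kD; rewrite vs_cons.
    - have : b \in vs T1 by rewrite mV1.
      by rewrite /= eqxx add1n ltnS addn_gt0 -has_count has_pred1 => ->; rewrite orbT.
  have xa : x \notin [:: a] by apply: contra xV; rewrite !inE => /eqP->; rewrite eqxx orbT.
  have xT : x \notin vs T1 by apply: contra xV => h; rewrite !inE h !orbT.
  have fin (T2 : seq (seq edge * seq vtx)) : ok T2 -> reach N (eds T2) ->
    perm_eq (vs T2) (x :: a :: vs T1) -> size T2 <= size TT ->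
      exists TT', [/\ ok TT', reach N (eds TT'), size (vs TT') = size (vs TT) + 2,
    Psi TT' <= Psi TT + 1 & 0 < exc (vs TT')].
    move=> k2 r2 p2 s2.
    have x2 : exc (vs T2) = (exc (vs TT)).+1.
      rewrite (exc_perm p2) exc_out; first by rewrite exc_in ?xV1 // mV1.
      by apply: contra xV => h; rewrite inE h orbT.
    exists T2; split=> //; rewrite ?x2 //.
    - by rewrite (perm_size p2) /= sV1 addn2.
    - by rewrite /Psi x2; move: s2; clear; lia.
  have : b \in vs T1 by rewrite mV1.
  rewrite mem_vs => /hasP[t tT bt].
  have pT := perm_to_rem tT; set R := rem t T1 in pT.
  have [hkt hkR] := (iffLR (ok_cons _ _) (ok_perm pT k1)).
  have dR := disj_cons (disj_perm pT d1) bt.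
  have hR3 : reach N (D ++ t.1 ++ eds R).
    apply: reach_perm hR2 => //; rewrite perm_cat2l.
    by apply: (perm_trans (eds_perm pT)); rewrite eds_cons.
  have pV : perm_eq (vs T1) (t.2 ++ vs R) by apply: (perm_trans (vs_perm pT)).
  have bI : b \notin [:: a] by rewrite inE eq_sym.
  have xt : x \notin t.2 by apply: contra xT => h; rewrite (perm_mem pV) mem_cat h.
  have hF : {in eds R, forall e, ~~ inc e x && ~~ inc e b}.
    move=> e he; apply/andP; split; apply/negP => hi; have hv := eds_inc hkR he hi.
      by move: xT; rewrite (perm_mem pV) mem_cat hv orbT.
    by rewrite hv in dR.
  have sR : size T1 = (size R).+1 by rewrite (perm_size pT).
  case: (detach (@switching_reach _ _ _ _) hR3 wD bI hkt bt hx xa xt hF) =>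
    [[E [tE hRE]]|[D' [wD' sD' hR4]]].
    apply: (fin ((E, x :: [:: a] ++ t.2) :: R)) => //.
    - by apply/ok_cons.
    - by rewrite vs_cons /= !perm_cons perm_sym.
    - by rewrite /= -sR.
  have k2 : ok ((D', [:: x; a]) :: T1) by apply/ok_cons; split=> //; apply: tour_walk wD'.
  have [|T2 [k3 e3 v3 s3]] := merge1 (y := a) k2.
    by rewrite /= !inE eqxx orbT add1n ltnS -has_count -mem_vs mV1.
  apply: (fin T2) => //; last by move: s3 s1 => /= [<-].
  apply: reach_perm hR4 => //; rewrite perm_sym; apply: (perm_trans e3).
  by rewrite eds_cons perm_cat2l; apply: (perm_trans (eds_perm pT)); rewrite eds_cons.
case: (boolP (b \in vs TT)) => bV; case: (boolP (a \in vs TT)) => aV.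
- by have [T2 [*]] := main bV aV; exists T2; split=> //; left.
- have [||T2 [*]] := common b _ bV; rewrite ?inE ?eqxx //; first by constructor 2.
  by exists T2; split=> //; left.
- have [||T2 [*]] := common a _ aV; rewrite ?inE ?eqxx ?orbT //; first by constructor 1.
  by exists T2; split=> //; left.
exists ((D, [:: b; a]) :: TT); split=> //.
- by apply/ok_cons.
- by rewrite vs_cons size_cat addnC.
- rewrite /Psi vs_cons /= !exc_out; first by clear; lia.
    by [].
  by rewrite inE eq_sym (negbTE ab).
by right; exists (D, [:: b; a]).
Qed.

Lemma absorb2s N k TT : reach (nseq k 2 ++ N) (eds TT) -> ok TT -> bnd v u (size (vs TT) + 2 * k) ->
  exists TT', [/\ ok TT', reach N (eds TT'), size (vs TT') = size (vs TT) + 2 * k,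
    Psi TT' <= Psi TT + k & 0 < exc (vs TT') \/ exists DD, [/\ TT' = DD ++ TT, size DD = k &
      {in DD, forall D, size D.2 = 2}]].
Proof.
elim: k TT => [|k IH] TT hR hk hb.
  by exists TT; rewrite ?muln0 ?addn0; split=> //; right; exists [::].
have hb2 j : j <= k.+1 -> bnd v u (size (vs TT) + 2 * j).
  by move=> hj; move: hb; rewrite /bnd; move: (size (vs TT)) hj => p; clear; lia.
have [T1 [k1 r1 s1 p1 h1]] := absorb2 hR hk (hb2 1 isT).
have [|T2 [k2 r2 s2 p2 h2]] := IH T1 r1 k1.
  by rewrite s1 -addnA -mulnS.
exists T2; split=> //.
- by rewrite s2 s1 -addnA mulnS.
- by apply: (leq_trans p2); move: p1; rewrite /Psi; clear; lia.
case: h2 => [|[DD [hD sD aD]]]; first by left.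
case: (posnP (exc (vs T2))) => [/eqP h0|]; last by left.
case: h1 => [h1|[D hT1 sD1]].
  move: h0; rewrite exc_uniq hD vs_cat cat_uniq => /and3P[_ _].
  by rewrite -exc_uniq; case: exc h1.
right; exists (rcons DD D); split.
- by rewrite hD hT1 cat_rcons.
- by rewrite size_rcons sD.
by move=> D'; rewrite mem_rcons inE => /orP[/eqP->|/aD].
Qed.

Lemma size_vs2 DD : {in DD, forall D, size D.2 = 2} -> size (vs DD) = 2 * size DD.
Proof.
elim: DD => // D DD IH h; rewrite vs_cons size_cat IH /=; last by move=> t ht; apply: h;
  rewrite inE ht orbT.
by rewrite (h D (mem_head _ _)) mulnS.
Qed.

(** Absorption gives [Psi <= k + 1 <= y], so [win] applies once there is a repetition. Otherwise all
    cycles are disjoint, and [y / 2] of the 2-cycles form the first part of [two_parts]; [x <= z]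
    ensures that there are enough of them. *)
Lemma open_up N (x k y z : nat) : wins (x :: nseq k 2 ++ N) -> x + 2 * k = y + z -> y <= z ->
  k < y -> x <= z -> ~~ odd y -> 4 <= y -> bnd v u (y + z) -> wins (y :: z :: N).
Proof.
move=> /absorb_tour[E [Vs [tE uV sV hR]]] hs hyz hky hxz oy h4 hb.
rewrite cats0 in hR; have ox := even_tour tE; rewrite sV in ox.
have k0 : ok [:: (E, Vs)] by move=> t; rewrite inE => /eqP->.
have hR0 : reach (nseq k 2 ++ N) (eds [:: (E, Vs)]) by rewrite /eds /= cats0.
have sv0 : size (vs [:: (E, Vs)]) = x by rewrite /vs /= cats0.
have P0 : Psi [:: (E, Vs)] = 1.
  by rewrite /Psi /vs /= cats0; apply/eqP; rewrite eqSS exc_uniq.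
have [|TT [kT rT sT pT hT]] := absorb2s hR0 k0; first by rewrite sv0 hs.
rewrite sv0 hs in sT; rewrite P0 add1n in pT.
have zE : z = y + z - y by rewrite addKn.
rewrite zE; have hyz' : y <= y + z - y by rewrite addKn.
have pTy : Psi TT <= y by apply: leq_trans pT _.
case: (posnP (exc (vs TT))) => [/eqP h0|he]; last exact: (win hvu hb oy h4 hyz' kT rT sT he).
case: hT => [|[DD [hD sD aD]]]; first by case: exc h0.
pose m := (y)./2.
have hm : 2 * m = y by rewrite mul2n -[RHS]odd_double_half (negbTE oy).
have pp : perm_eq TT (take m DD ++ drop m DD ++ [:: (E, Vs)]) by rewrite catA cat_take_drop hD.
have mk : m <= k by move: hm hs hxz; clear; lia.
have a1 : {in take m DD, forall D, size D.2 = 2} by move=> D /mem_take; apply: aD.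
have a2 : {in drop m DD, forall D, size D.2 = 2} by move=> D /mem_drop; apply: aD.
apply: (two_parts hvu hb oy h4 hyz' (PP := take m DD) (QQ := drop m DD ++ [:: (E, Vs)])).
- exact: ok_perm pp kT.
- by rewrite -(perm_uniq (vs_perm pp)) -exc_uniq.
- exact: reach_perm (perm_refl _) (eds_perm pp) rT.
- by rewrite size_vs2 // size_takel ?sD.
- by rewrite vs_cat size_cat sv0 size_vs2 // size_drop sD addKn; move: hm hs mk; clear; lia.
by rewrite -(perm_size pp); apply: leq_trans pTy; rewrite /Psi leq_addr.
Qed.

(** The cycles of lengths [c] and [x] are two disjoint tours, or one tour with at most [x]
    repetitions. Hence [Psi <= x + 1] at the start and [Psi <= x + 1 + k <= x + 2 * k] after
    absorbing the 2-cycles. *)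
Lemma enlarge N (c x k : nat) : wins (c :: x :: nseq k 2 ++ N) -> 0 < k -> 2 <= x ->
  x + 2 * k <= c ->
  ~~ odd x -> 4 <= x + 2 * k -> bnd v u (c + x + 2 * k) -> wins (c :: x + 2 * k :: N).
Proof.
move=> /absorb_tour[C [Vc [tC uC sC hR1]]] hk hx2 hxc ox h4 hb.
rewrite cats0 in hR1; have [E [Vs [tE uV sV hR]]] := absorb_tour hR1.
have k0 : ok [:: (E, Vs); (C, Vc)] by move=> t; rewrite !inE => /orP[]/eqP->.
have hR0 : reach (nseq k 2 ++ N) (eds [:: (E, Vs); (C, Vc)]) by rewrite /eds /= cats0.
have sv0 : size (vs [:: (E, Vs); (C, Vc)]) = c + x by rewrite /vs /= cats0 size_cat sV sC addnC.
have oT : ~~ odd (x + 2 * k) by rewrite oddD (negbTE ox) oddM.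
have cE : c = c + x + 2 * k - (x + 2 * k) by rewrite -addnA addnK.
have hxc' : x + 2 * k <= c + x + 2 * k - (x + 2 * k) by rewrite -cE.
suff : wins (x + 2 * k :: c + x + 2 * k - (x + 2 * k) :: N).
  rewrite -cE; apply: reach_perm => //; perm_lia.
have step (T1 : seq (seq edge * seq vtx)) : ok T1 -> reach (nseq k 2 ++ N) (eds T1) ->
  size (vs T1) = c + x -> Psi T1 <= x.+1 ->
    (T1 = [:: (E, Vs); (C, Vc)]) \/ 0 < exc (vs T1) ->
      wins (x + 2 * k :: c + x + 2 * k - (x + 2 * k) :: N).
  move=> k1 r1 s1 p1 h1; have [|TT [kT rT sT pT hT]] := absorb2s r1 k1; first by rewrite s1.
  rewrite s1 in sT; have pT' : Psi TT <= x + 2 * k.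
    by move: pT p1 hk; clear; lia.
  case: (posnP (exc (vs TT))) => [/eqP h0|he]; last exact: (win hvu hb oT h4 hxc' kT rT sT he).
  case: hT => [|[DD [hD sD aD]]]; first by case: exc h0.
  case: h1 => [h1|h1]; last first.
    move: h0; rewrite exc_uniq hD vs_cat cat_uniq => /and3P[_ _].
    by rewrite -exc_uniq; case: exc h1.
  have pp : perm_eq TT ((DD ++ [:: (E, Vs)]) ++ [:: (C, Vc)]) by rewrite hD h1 -catA.
  apply: (two_parts hvu hb oT h4 hxc' (PP := DD ++ [:: (E, Vs)]) (QQ := [:: (C, Vc)])).
  - exact: ok_perm pp kT.
  - by rewrite -(perm_uniq (vs_perm pp)) -exc_uniq.
  - exact: reach_perm (perm_refl _) (eds_perm pp) rT.
  - by rewrite vs_cat size_cat size_vs2 // sD /vs /= cats0 sV addnC.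
  - by rewrite -cE /vs /= cats0.
  by rewrite -(perm_size pp); apply: leq_trans pT'; rewrite /Psi leq_addr.
case: (posnP (exc (vs [:: (E, Vs); (C, Vc)]))) => h0.
  by apply: (step _ k0 hR0 sv0); [rewrite /Psi h0; apply: leq_trans hx2 (leqnSn x)|left].
have hV : vs [:: (E, Vs); (C, Vc)] = Vs ++ Vc by rewrite /vs /= cats0.
have /hasP[y yc ys] : has [in Vs] Vc.
  by apply/negPn; move: h0; rewrite lt0n exc_uniq hV cat_uniq uV uC andbT.
have ex : exc (Vs ++ Vc) <= x.
  rewrite /exc size_cat sV; have : size Vc <= size (undup (Vs ++ Vc)).
    by apply: uniq_leq_size => // p hp; rewrite mem_undup mem_cat hp orbT.
  by move: (size _) (size (undup _)) => p q; clear; lia.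
apply: (step [:: (E ++ C, Vs ++ Vc)]).
- by move=> t; rewrite inE => /eqP->; apply: tour_cat ys yc.
- by apply: reach_perm hR0 => //; rewrite /eds /= !cats0.
- by rewrite -sv0 hV /vs /= cats0.
- by rewrite /Psi /vs /= cats0.
by right; rewrite -hV /vs /= !cats0 in h0 *.
Qed.

End Absorption.

(** * Bounding the number of beads by labels *)

Section FewLabels.
Variables v u lam : nat.
Notation vtx := (vtx v u).
Notation edge := (edge v u lam).
Notation wins N := (reach N (@nil edge)).
Implicit Types (e : edge) (x y z w a b : vtx) (A B E F G X Y Z : seq edge) (I J S Vs IA IB : seq
  vtx).
Implicit Types (TT PP QQ DD : seq (seq edge * seq vtx)) (N : seq nat).

(* Switching preserves labels, so this number is an invariant of the leave. *)
Definition extra E := count (fun e => 0 < e.2) E.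

(* Two parallel edges have distinct labels, so a closed trail of length 2 has an
   edge with a nonzero label. *)
Lemma closed4 x E I : walk x x E I -> uniq E -> 4 <= size E + 2 * extra E.
Proof.
move=> h uE; have oE := even_closed h.
case/walk_inv: (h) => [[e [_ _ /joins_side]]|[e [y [E' [I' [hE _ j w]]]]]]; first by case: side.
case/walk_inv: w => [[f [hE' _ j2]]|[f [y' [E2 [I2 [hE' _ _ w2]]]]]]; last first.
  by apply: leq_trans (leq_addr _ _); move: oE; rewrite hE hE' /= (size_walk w2); case: (size I2).
suff : 0 < extra E by rewrite hE hE' /=; lia.
rewrite hE hE' /extra /= addn0 lt0n addn_eq0 !eqb0 -!leqNgt !leqn0.
apply/negP => /andP[/eqP e0 /eqP f0].
move: uE; rewrite hE hE' /= inE andbT => /eqP[].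
have : e.2 = f.2 by apply: val_inj; rewrite /= e0 f0.
move: j j2; rewrite /joins; case: e {hE e0} => [[i1 j1] k1]; case: f {hE' f0} => [[i2 j2] k2] /=.
by case/orP => /andP[/eqP-> /eqP->]; case/orP => /andP[/eqP h1 /eqP h2] // ->; case: h1 => ->;
  case: h2 => ->.
Qed.

Lemma size_tours TT : ok TT -> uniq (eds TT) -> 4 * size TT <= size (vs TT) + 2 * extra (eds TT).
Proof.
elim: TT => // t TT IH /ok_cons[ht hk]; rewrite eds_cons cat_uniq => /and3P[u1 _ u2].
have [x [E [I [w p _]]]] := ht; have := closed4 w; rewrite (perm_uniq p) => /(_ u1).
have := IH hk u2; rewrite vs_cons /extra !count_cat size_cat (tour_size ht) (perm_size p) (permP p).
rewrite /=; move: (size _) (size t.1) (size _) (count _ t.1) (count _ _) => a1 a2 a3 a4 a5; clear;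
  lia.
Qed.

Hypothesis hvu : v <= u.

(** After the reduction, [X], [Y] and the other tours are [Psi] closed trails, so [closed4] yields
    [4 * Psi <= l + 2 * extra], which replaces the assumption [Psi <= T] of [win]. The reduction
    runs with [reach_labels], so [extra] has not changed meanwhile. *)
Lemma win_few N T l TT : bnd v u l -> ~~ odd T -> 4 <= T -> T <= l - T ->
  l + 2 * extra (eds TT) < 4 * T.+1 ->
  ok TT -> reach N (eds TT) -> size (vs TT) = l -> 0 < exc (vs TT) -> wins (T :: l - T :: N).
Proof.
move=> hb oT h4 hTl hl4 hk hR hl he.
have hb' : bnd v u (size (vs TT)) by rewrite hl.
have hRL : reach_labels N (map snd (eds TT)) (eds TT) by [].
have [T1 [[k1 d1] [r1 l1] s1 e1 p1]] := reduce1 (@switching_labels _ _ _ _ _) hvu hb' hRL hk he.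
have [w [X [Ix [Y [Iy [Zs [[wX wY] pE pV uV [kZ sT]]]]]]]] := figure_eight k1 d1 e1.
have hx : extra (eds TT) = extra (X ++ Y ++ eds Zs).
  have hm E : extra E = count (fun k : 'I_lam => 0 < k) (map snd E) by rewrite count_map.
  rewrite !hm -(permP l1); apply/permP; exact: perm_map pE.
apply: (win hvu hb oT h4 hTl k1 r1); rewrite ?s1 ?e1 //.
have := reach_uniq r1; rewrite (perm_uniq pE) !cat_uniq => /and3P[u1 _ /and3P[u2 _ u3]].
have := closed4 wX u1; have := closed4 wY u2; have := size_tours kZ u3.
move: hl4; rewrite hx /extra !count_cat.
have := perm_size pV; rewrite s1 hl (size_walk wX) (size_walk wY) /Psi e1 sT.
move: (count _ X) (count _ Y) (count _ (eds Zs)) => c1 c2 c3.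
by size_lia.
Qed.

End FewLabels.

(** * Merging cycles in the simple graph *)

Section Simple.
Variables v u : nat.
Hypothesis hvu : v <= u.
Notation vtx := (vtx v u).
Notation edge := (edge v u 1).
Notation wins N := (reach N (@nil edge)).
Implicit Types (e : edge) (x y z w a b : vtx) (A B E F G X Y Z : seq edge) (I J S Vs IA IB : seq
  vtx).
Implicit Types (TT PP QQ DD : seq (seq edge * seq vtx)) (N : seq nat).

Lemma extra0 E : extra E = 0.
Proof. by apply/eqP; rewrite -leqn0 leqNgt -has_count; apply/hasPn => e _; rewrite (ord1 e.2). Qed.

(** With one label [extra] is 0, and the two ratio bounds say that the total is at most [4 * T] for
    [T] the smaller of [h] and [p + r]; this is the count needed by [win_few]. *)
Lemma merge_simple N h p r : wins (h :: p :: r :: N) -> p + r <= 3 * h -> h <= 3 * (p + r) ->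
  bnd v u (h + (p + r)) -> wins (h :: p + r :: N).
Proof.
move=> /absorb_tour[E1 [V1 [t1 u1 s1 hR1]]] c1 c2 hb.
rewrite cats0 in hR1; have [E2 [V2 [t2 u2 s2 hR2]]] := absorb_tour hR1.
have [E3 [V3 [t3 u3 s3 hR3]]] := absorb_tour hR2.
pose TT := [:: (E1, V1); (E2, V2); (E3, V3)].
have k : ok TT by move=> t; rewrite !inE => /or3P[]/eqP->.
have hR : reach N (eds TT) by apply: reach_perm hR3; rewrite // /eds /= cats0; perm_lia.
have sv : size (vs TT) = h + (p + r) by rewrite /vs /= cats0 !size_cat s1 s2 s3.
have := reach_uniq hR; rewrite /eds /= cats0 !cat_uniq => /and3P[v1 _ /and3P[v2 _ v3]].
have four E V : tour E V -> uniq E -> 4 <= size V.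
  move=> t uE; have := @size_tours _ _ _ [:: (E, V)]; rewrite /vs /eds /= !cats0 extra0 addn0.
  by apply=> // q; rewrite inE => /eqP->.
have hh := four _ _ t1 v1; have hp := four _ _ t2 v2; have hr := four _ _ t3 v3.
rewrite s1 in hh; rewrite s2 in hp; rewrite s3 in hr.
have oh : ~~ odd h by rewrite -s1; apply: even_tour t1.
have op : ~~ odd (p + r) by rewrite -s2 -s3 oddD (negbTE (even_tour t2)) (negbTE (even_tour t3)).
have main T l : T + l = h + (p + r) -> T <= l -> (T == h) || (T == p + r) -> wins (T :: l :: N).
  move=> hTl Tl hT.
  have lE : l = h + (p + r) - T by rewrite -hTl addKn.
  have oT : ~~ odd T by case/orP: hT => /eqP->.
  have T8 : 4 <= T by case/orP: hT => /eqP->; rewrite // (leq_trans hp) // leq_addr.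
  have l4 : h + (p + r) <= 4 * T by case/orP: hT => /eqP->; move: c1 c2; clear; lia.
  rewrite lE in Tl *.
  case: (posnP (exc (vs TT))) => he; last first.
    apply: (win_few hvu hb oT T8 Tl _ k hR sv he).
    by rewrite extra0 addn0; apply: leq_ltn_trans l4 _; rewrite ltn_mul2l /=.
  move/eqP: he; rewrite exc_uniq => uV.
  case/orP: hT => /eqP hT.
    apply: (two_parts hvu hb oT T8 Tl (PP := [:: (E1, V1)]) (QQ := [:: (E2, V2); (E3, V3)])) => //.
    - by rewrite /vs /= cats0 hT s1.
    - by rewrite hT addKn /vs /= cats0 size_cat s2 s3.
    - by apply: leq_trans T8.
  have pp : perm_eq TT ([:: (E2, V2); (E3, V3)] ++ [:: (E1, V1)]) by rewrite /TT; perm_lia.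
  apply: (two_parts hvu hb oT T8 Tl (PP := [:: (E2, V2); (E3, V3)]) (QQ := [:: (E1, V1)])) => //.
  - exact: ok_perm pp k.
  - by rewrite -(perm_uniq (vs_perm pp)).
  - exact: reach_perm (perm_refl _) (eds_perm pp) hR.
  - by rewrite /vs /= cats0 size_cat s2 s3 hT.
  - by rewrite hT addnK /vs /= cats0.
  - by apply: leq_trans T8.
case: (leqP h (p + r)) => hc; first by apply: main => //; rewrite eqxx.
by apply: reach_perm (main _ _ (addnC _ _) (ltnW hc) _); rewrite ?eqxx ?orbT //; perm_lia.
Qed.

End Simple.

(** * Even multiplicity *)

Section Base.
Variables v u lam : nat.
Notation vtx := (vtx v u).
Notation edge := (edge v u lam).
Notation wins N := (reach N (@nil edge)).

(** A list that contains all edges and is no longer than the edge set has no repetition, so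
    exactness of a decomposition follows from covering and a size count. *)
Lemma perm_cover (E : seq edge) : (forall e : edge, e \in E) -> size E <= v * u * lam ->
  perm_eq E (enum {: edge}).
Proof.
move=> h2 h3; have hs : size E <= size (enum {: edge}) by rewrite -cardE !card_prod !card_ord.
have hsub : {subset enum {: edge} <= E} by move=> e _; apply: h2.
have [hsz hmem] := uniq_min_size (enum_uniq _) hsub hs.
rewrite perm_sym; apply: uniq_perm => //; first exact: enum_uniq.
by apply: (leq_size_uniq (enum_uniq _) hsub).
Qed.

Lemma reach_cover (Cs : seq (seq edge)) E : {in Cs, forall C, cyc C} ->
  (forall e : edge, e \in flatten Cs ++ E) -> size (flatten Cs ++ E) <= v * u * lam ->
    reach (map size Cs) E.
Proof. by move=> h1 h2 h3; exists Cs; split=> //; apply: perm_cover. Qed.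

Lemma pair_label_lt (b m : nat) : b < 2 -> m < lam./2 -> odd lam + 2 * m + b < lam.
Proof. by have := odd_double_half lam; case: (odd lam) => /=; lia. Qed.

(** The pairs of labels are (0,1), (2,3), ... for even [lam] and (1,2), (3,4), ... for odd [lam],
    where label 0 is set apart. *)
Definition pair_label (b : bool) (m : 'I_(lam./2)) : 'I_lam :=
  Ordinal (pair_label_lt (leq_b1 b : b < 2) (ltn_ord m)).

(** By covering and size, [Cs] and [E] use exactly the edges of label 0 when [lam] is odd, and none
    when it is even. The 2-cycles on the pairs of labels use the others. *)
Lemma base_cover (Cs : seq (seq edge)) E : {in Cs, forall C, cyc C} ->
  (forall e : edge, e.2 < odd lam -> e \in flatten Cs ++ E) ->
    size (flatten Cs ++ E) = v * u * odd lam ->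
  exists DD : seq (seq edge), [/\ {in Cs ++ DD, forall C, cyc C},
    map size DD = nseq (v * u * lam./2) 2,
    perm_eq (flatten (Cs ++ DD) ++ E) (enum {: edge})
    & forall p m, [:: (p, pair_label false m); (p, pair_label true m)] \in DD].
Proof.
move=> h1 h2 h3.
pose D := [seq [:: (p, pair_label false m);
  (p, pair_label true m)] | p <- enum {: 'I_v * 'I_u}, m <- enum 'I_(lam./2)].
have sD : size D = v * u * lam./2 by rewrite size_allpairs -!cardE card_prod !card_ord.
have D2 : {in D, forall C, cyc C /\ size C = 2}.
  move=> C /allpairsP[[[i j] m] /= [_ _ ->]]; split=> //.
  exists (inl i), [:: inr j]; split=> //.
    by apply: walkS; [rewrite /joins /= !eqxx | apply: walk1; rewrite /joins /= !eqxx].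
  by rewrite /= andbT inE; apply/negP => /eqP[]; lia.
have mD : map size D = nseq (v * u * lam./2) 2.
  rewrite -sD; elim: D D2 {sD} => //= C D IH h.
  by rewrite (h C (mem_head _ _)).2 IH // => C' hC'; apply: h; rewrite inE hC' orbT.
have cD : size (flatten D) = v * u * (lam./2).*2.
  by rewrite size_flatten /shape mD sumn_nseq -muln2 mulnC mulnA.
exists D; split=> //; last by move=> p m; apply: allpairs_f; rewrite mem_enum.
- by move=> C; rewrite mem_cat => /orP[/h1|/D2[]].
apply: perm_cover.
- move=> e; rewrite flatten_cat -catA mem_cat; case: (ltnP e.2 (odd lam)) => he.
    by have := h2 e he; rewrite mem_cat (mem_cat e (flatten D)) => /orP[->|->]; rewrite ?orbT.
  rewrite (mem_cat e (flatten D)); apply/orP; right; apply/orP; left; apply/flattenP.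
  have hm : (e.2 - odd lam)./2 < lam./2.
    by have := ltn_ord e.2; have := odd_double_half lam; move: he; lia.
  pose m := Ordinal hm.
  exists [:: (e.1, pair_label false m); (e.1, pair_label true m)].
    by apply/allpairsP; exists (e.1, m); rewrite !mem_enum.
  rewrite [e]surjective_pairing /= !inE !xpair_eqE eqxx /= -!val_eqE /=.
  by move: he; have := odd_double_half (e.2 - odd lam); case: (odd (_ - _)); lia.
have hE : v * u * lam = v * u * odd lam + v * u * (lam./2).*2 by rewrite -mulnDr odd_double_half.
rewrite flatten_cat -catA !size_cat cD hE -h3 size_cat.
by rewrite addnCA addnC.
Qed.

Lemma base_reach (Cs : seq (seq edge)) E : {in Cs, forall C, cyc C} ->
  (forall e : edge, e.2 < odd lam -> e \in flatten Cs ++ E) ->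
    size (flatten Cs ++ E) = v * u * odd lam ->
  reach (map size Cs ++ nseq (v * u * lam./2) 2) E.
Proof.
move=> h1 h2 h3; have [DD [k1 k2 k3 _]] := base_cover h1 h2 h3.
by exists (Cs ++ DD); split; rewrite ?map_cat ?k2.
Qed.

Lemma base_pick (Cs : seq (seq edge)) E p m : {in Cs, forall C, cyc C} ->
  (forall e : edge, e.2 < odd lam -> e \in flatten Cs ++ E) ->
    size (flatten Cs ++ E) = v * u * odd lam ->
  reach (map size Cs ++ nseq (v * u * lam./2).-1 2) ([:: (p, pair_label false m);
    (p, pair_label true m)] ++ E).
Proof.
move=> h1 h2 h3; have [DD [k1 k2 k3 /(_ p m) kD]] := base_cover h1 h2 h3.
have pD := perm_to_rem kD; set D := [:: _; _] in pD *; set R := rem D DD in pD.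
exists (Cs ++ R); split.
- by move=> C hC; apply: k1; move: hC; rewrite !mem_cat => /orP[->//|/mem_rem->]; rewrite orbT.
- rewrite map_cat perm_cat2l; have := perm_map size pD; rewrite k2.
  case: (v * u * lam./2) => [|k]; first by move/perm_size.
  by rewrite /= perm_cons perm_sym.
apply: perm_trans k3; rewrite !flatten_cat.
have h : perm_eq (flatten DD) (D ++ flatten R) := perm_flatten pD.
rewrite perm_sym; apply: (@perm_trans _ ((flatten Cs ++ D ++ flatten R) ++ E)).
  by rewrite perm_cat2r perm_cat2l.
by rewrite -!catA perm_cat2l perm_catCA.
Qed.

End Base.

(** * Weights of lists of lengths *)

Section Lists.
Implicit Types (M R : seq nat) (m g h : nat).

(** For entries at least 2 this is [sumn M - 2 * size M], so an upper bound on the number of cycles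
    becomes a lower bound on the weight. *)
Definition weight M := sumn [seq m - 2 | m <- M].

Lemma weight_perm M R : perm_eq M R -> weight M = weight R.
Proof. by move=> h; apply: perm_sumn; apply: perm_map. Qed.

Lemma weight_mem M m : m \in M -> m - 2 <= weight M.
Proof. by move=> h; rewrite (weight_perm (perm_to_rem h)) leq_addr. Qed.

Lemma weight_even M : all (fun m => ~~ odd m) M -> ~~ odd (weight M).
Proof.
elim: M => //= m M IH /andP[hm /IH]; rewrite /weight /= oddD => /negbTE->.
by rewrite addbF; move: hm; lia.
Qed.

Lemma weight_pos M : 0 < weight M -> exists2 h, h \in M & 2 < h.
Proof.
elim: M => //= m M IH; case: (ltnP 2 m) => hm; first by exists m; rewrite ?mem_head.
rewrite /weight /= (eqP (hm : m - 2 == 0)) => /IH[h hM h2]; exists h => //.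
by rewrite inE hM orbT.
Qed.

Lemma max_elt M : M != [::] -> exists2 g, g \in M & {in M, forall m, m <= g}.
Proof.
elim: M => // m [|m' M] IH _; first by exists m; rewrite ?mem_head // => x; rewrite inE => /eqP->.
have [g gM hg] := IH isT; case: (leqP m g) => hm.
  by exists g; [rewrite in_cons gM orbT|move=> x; rewrite in_cons => /orP[/eqP->|/hg]].
exists m; first exact: mem_head.
by move=> x; rewrite in_cons => /orP[/eqP->//|/hg hx]; apply: leq_trans hx (ltnW hm).
Qed.

Lemma bndW v u l l' : l <= l' -> bnd v u l' -> bnd v u l.
Proof. by rewrite /bnd; lia. Qed.

End Lists.

Section Even.
Variables v u lam G H : nat.
Hypothesis hvu : v <= u.
Hypothesis hGH : bnd v u (G + H).
Notation wins N := (reach N (@nil (edge v u lam))).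
Implicit Types (M R : seq nat) (m g h : nat).

(** [G] and [H] stay fixed while the list changes. As at most one entry exceeds [H], any two entries
    sum to at most [G + H], which keeps them within [bnd]. *)
Definition good M := [/\ all (fun m => [&& 2 <= m, ~~ odd m & m <= G]) M,
  count (fun m => H < m) M <= 1, {in M, forall m, 2 * (m - 2) <= weight M} & sumn M = v * u * lam].

(** Induction on the weight, undoing one move at a time; weight 0 means that all cycles are
    2-cycles. The delicate condition is the weight bound for the largest entry [g]. *)
Lemma even_lists M : ~~ odd lam -> good M -> wins M.
Proof.
move=> elam; move: {2}(weight M) (leqnn (weight M)) => n; elim: n M => [|n IH] M hn [hM hc hW hs].
  have M2 : all (pred1 2) M.
    apply/allP => m mM /=; have /and3P[h2 _ _] := allP hM _ mM.
    by have := weight_mem mM; move: hn h2; clear; lia.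
  move/all_pred1P: M2 hs => ->; rewrite sumn_nseq => hs.
  have -> : size M = v * u * lam./2.
    have he : lam = (lam./2) * 2 by rewrite muln2 -[LHS]odd_double_half (negbTE elam).
    by move: hs; rewrite {1}he mulnA mulnC => /eqP; rewrite eqn_pmul2r // => /eqP.
  have := @base_reach v u lam [::] [::]; rewrite /=; apply=> //;
    last by rewrite (negbTE elam) muln0.
  by move=> e; rewrite (negbTE elam).
case: (posnP (weight M)) => hw; first by apply: IH; rewrite ?hw.
have [m0 m0M m02] := weight_pos hw.
have [g gM hg] : exists2 g, g \in M & {in M, forall m, m <= g}.
  by apply: max_elt; case: (M) m0M.
have g3 := leq_trans m02 (hg _ m0M).
have pg := perm_to_rem gM; set R := rem g M in pg.
have wg : weight M = g - 2 + weight R := weight_perm pg.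
have hR : 0 < weight R by have := hW g gM; rewrite wg; move: g3; clear; lia.
have [h hR2 h3] := weight_pos hR.
have ph := perm_to_rem hR2; set R2 := rem h R in ph.
have wh : weight R = h - 2 + weight R2 := weight_perm ph.
have pM : perm_eq M [:: g, h & R2] by rewrite (permPl pg) perm_cons.
have hhg : h <= g by apply: hg; rewrite (perm_mem pg) inE hR2 orbT.
have := hM; rewrite (perm_all _ pM) => /= /and3P[/and3P[_ og gG] /and3P[_ oh hG] aR2].
have cM := hc; rewrite (permP pM) /= in cM.
have hH : h <= H by case: (leqP h H) hhg cM => // h1 h2; rewrite (leq_trans h1 h2); clear; lia.
have sM : g + (h + sumn R2) = v * u * lam by rewrite -hs (perm_sumn pM).
have gM2 := hW g gM.
have hb : bnd v u (g + h) by apply: bndW hGH; apply: leq_add.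
have aux m : m \in R2 -> m \in M by move=> hm; rewrite (perm_mem pM) !inE hm !orbT.
apply: reach_perm (_ : wins [:: g, h & R2]) => //; first by rewrite perm_sym.
have evW : ~~ odd (weight M).
  by apply: weight_even; apply: sub_all hM => m /and3P[].
(* With slack, a 2 is split off [h] and put back by [enlarge]. The weight drops by 2, and by parity
   the bound for [g] survives. *)
case: (ltnP (2 * (g - 2)) (weight M)) => hsl.
  have w' : weight [:: g, h - 2, 2 & R2] = weight M - 2.
    by rewrite wg wh /weight /= add0n; move: h3 oh; clear; lia.
  have hr : wins [:: g, h - 2, 2 & R2].
    apply: IH; first by rewrite w'; move: hn hw; clear; lia.
    split.
    - rewrite /= gG og aR2 (leq_trans (leq_subr _ _) hG) andbT /= (leq_trans _ gG) ?andbT //;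
        last exact: ltnW.
      by move: h3 oh g3; clear; lia.
    - move: cM => /=; have -> : H < 2 = false by move: h3 hH; clear; lia.
      case: (ltnP H (h - 2)) => [h1|_]; last by move: (count _ R2) (H < h) => p [] /=; clear; lia.
      by move: hH h1; clear; lia.
    - move=> m; rewrite w' => hm; have : 2 * (m - 2) <= 2 * (g - 2).
        move: hm; rewrite !inE => /or4P[/eqP->|/eqP->|/eqP->|/aux/hg hm]; move: hhg; try (clear;
          lia).
        by move: hm; clear; lia.
      by move: hsl evW og; clear; lia.
    by rewrite -sM /=; move: h3; clear; lia.
  have := enlarge hvu (k := 1) hr isT; rewrite muln1 subnK; last exact: ltnW.
  apply.
  - by move: h3 oh; clear; lia.
  - by [].
  - by move: h3 oh; clear; lia.
  - by move: h3 oh; clear; lia.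
  - by rewrite -addnA subnK // ltnW.
(* Without slack [weight M = 2 * (g - 2)], so [g] and [h] have to change together. Replacing them by
   [g - h + 2] and [h - 1] entries 2 keeps the sum, and the new weight [2 * (g - h)] is just enough
   for the new entry; [open_up] leads back because [h - 1 < h]. *)
have wR2 : weight R2 = g - h by move: gM2 hsl; rewrite wg wh; move: h3 g3 hhg; clear; lia.
have w' : weight ((g - h + 2) :: nseq h.-1 2 ++ R2) = 2 * (g - h).
  by rewrite /weight /= map_cat sumn_cat map_nseq sumn_nseq mul0n add0n -/(weight R2) wR2; clear;
    lia.
have hr : wins ((g - h + 2) :: nseq h.-1 2 ++ R2).
  apply: IH; first by rewrite w'; move: hn gM2 hsl h3 hhg; clear; lia.
  split.
  - rewrite /= all_cat aR2 all_nseq andbT; apply/andP; split; first by move: og oh hhg h3 gG;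
      clear; lia.
    by apply/orP; right; rewrite /=; apply: leq_trans gG; move: g3; clear; lia.
  - rewrite /= count_cat count_nseq.
    have -> : H < 2 = false by move: h3 hH; clear; lia.
    rewrite mul0n add0n; apply: leq_trans cM; move: (count _ R2) => p.
    by move: hH h3 hhg; clear; lia.
  - move=> m; rewrite w' inE mem_cat mem_nseq => /or3P[/eqP->|/andP[_ /eqP->]|hm].
    + by clear; lia.
    + by clear; lia.
    + by rewrite leq_mul2l -wR2 weight_mem.
  by rewrite -sM /= sumn_cat sumn_nseq; move: h3 hhg; clear; lia.
apply: reach_perm (open_up hvu hr (y := h) (z := g) _ hhg _ _ oh _ _) => //.
- by rewrite (perm_catCA [:: h] [:: g]).
- by move: h3 hhg; clear; lia.
- by move: h3; clear; lia.
- by move: h3 hhg; clear; lia.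
- by move: h3 oh; clear; lia.
by rewrite addnC.
Qed.

End Even.

(** * Simple graphs: 4-cycles and 6-cycles *)

Section Grid.
Implicit Types (s : seq (nat * nat)) (D : seq (seq (nat * nat))) (v u n m N : nat).

(* s lists the (row, column) pairs (r_i, c_i) of a cycle r_0, c_0, r_1, c_1, ... *)
Definition cedges s := s ++ [seq (q.2.1, q.1.2) | q <- zip s (rot 1 s)].

Definition wf v u s := [&& (size s == 2) || (size s == 3), uniq (map fst s), uniq (map snd s)
  & all (fun p => (p.1 < v) && (p.2 < u)) s].

(** Covering all cells and having the right total length force each cell to be used once, so an
    explicit block is checked by computation. The number of 6-cycles is written [2 * N] because it
    must be even when 4 divides [v * u]. *)
Definition covers v u N D := [&& all (wf v u) D, count (fun s => size s == 3) D == 2 * N,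
  2 * sumn (map size D) == v * u
  & all (fun p => p \in flatten (map cedges D)) [seq (i, j) | i <- iota 0 v, j <- iota 0 u]].

Lemma gridP v u N D : reflect [/\ {in D, forall s, wf v u s},
  count (fun s => size s == 3) D = 2 * N,
  2 * sumn (map size D) = v * u
  & forall i j, i < v -> j < u -> (i, j) \in flatten (map cedges D)] (covers v u N D).
Proof.
apply: (iffP and4P) => [[/allP h1 /eqP h2 /eqP h3 /allP h4]|[h1 h2 h3 h4]].
  by split=> // i j hi hj; apply: h4; apply: allpairs_f; rewrite mem_iota.
split; [exact/allP|exact/eqP|exact/eqP|].
by apply/allP => p /allpairsP[[i j] /= []]; rewrite !mem_iota => hi hj ->; apply: h4.
Qed.

Definition shift a b (p : nat * nat) := (p.1 + a, p.2 + b).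

Lemma cedges_shift a b s : cedges (map (shift a b) s) = map (shift a b) (cedges s).
Proof.
rewrite /cedges map_cat -map_rot; congr (_ ++ _).
by elim: s (rot 1 s) => [|p s IH] [|q t] //=; rewrite IH.
Qed.

Lemma wf_shift v u v' u' a b s : v + a <= v' -> u + b <= u' -> wf v u s ->
  wf v' u' (map (shift a b) s).
Proof.
move=> hv hu /and4P[h1 h2 h3 h4].
have e1 : map fst (map (shift a b) s) = map (addn^~ a) (map fst s) by rewrite -!map_comp.
have e2 : map snd (map (shift a b) s) = map (addn^~ b) (map snd s) by rewrite -!map_comp.
rewrite /wf size_map h1 e1 e2 (map_inj_uniq (@addIn a)) (map_inj_uniq (@addIn b)) h2 h3 /=.
rewrite all_map; apply: sub_all h4 => p /= /andP[p1 p2].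
by rewrite (leq_trans _ hv) ?(leq_trans _ hu) // -addSn leq_add2r.
Qed.

Lemma wf_widen v u v' u' s : v <= v' -> u <= u' -> wf v u s -> wf v' u' s.
Proof.
move=> hv hu /and4P[h1 h2 h3 h4]; rewrite /wf h1 h2 h3 /=; apply: sub_all h4 => p /andP[p1 p2].
by rewrite (leq_trans p1) ?(leq_trans p2).
Qed.

Lemma covers_union v u v1 u1 v2 u2 a b N1 N2 D1 D2 : covers v1 u1 N1 D1 -> covers v2 u2 N2 D2 ->
  v1 <= v -> u1 <= u -> v2 + a <= v -> u2 + b <= u -> v * u = v1 * u1 + v2 * u2 ->
  (forall i j, i < v -> j < u ->
    (i < v1) && (j < u1) || [&& a <= i, i < v2 + a, b <= j & j < u2 + b]) ->
  covers v u (N1 + N2) (D1 ++ map (map (shift a b)) D2).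
Proof.
move=> /gridP[h1 h2 h3 h4] /gridP[k1 k2 k3 k4] hv1 hu1 hv2 hu2 hs hc; apply/gridP; split.
- move=> s; rewrite mem_cat => /orP[/h1|/mapP[s' /k1 hs' ->]]; first exact: wf_widen.
  exact: wf_shift hs'.
- rewrite count_cat h2 mulnDr -k2 count_map; congr (_ + _); apply: eq_count => s /=.
  by rewrite size_map.
- rewrite map_cat sumn_cat mulnDr h3 hs -k3; congr (_ + 2 * sumn _).
  by rewrite -map_comp; apply: eq_map => s /=; rewrite size_map.
move=> i j hi hj; rewrite map_cat flatten_cat mem_cat.
case/orP: (hc _ _ hi hj) => [/andP[*]|/and4P[ai ia bj jb]]; first by rewrite h4.
apply/orP; right; have ->
  : map cedges (map (map (shift a b)) D2) = map (map (shift a b)) (map cedges D2).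
  by rewrite -!map_comp; apply: eq_map => s /=; rewrite cedges_shift.
rewrite -map_flatten; apply/mapP; exists (i - a, j - b).
  by apply: k4; rewrite ltn_subLR // addnC.
by rewrite /shift /= !subnK.
Qed.

(* K_{2n,2m} splits into 2N 6-cycles and 4-cycles for all N <= a. *)
Definition sixes n m a := forall N, N <= a -> exists D, covers (2 * n) (2 * m) N D.

Lemma sixesD1 n1 n2 m a b : sixes n1 m a -> sixes n2 m b -> sixes (n1 + n2) m (a + b).
Proof.
move=> h1 h2 N hN; have [D1 d1] := h1 _ (geq_minr N a).
have [|D2 d2] := h2 (N - minn N a); first by rewrite minnE; lia.
exists (D1 ++ map (map (shift (2 * n1) 0)) D2).
have -> : N = minn N a + (N - minn N a) by rewrite subnKC // geq_minl.
apply: covers_union d1 d2 _ _ _ _ _ _; rewrite ?addn0 //; lia.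
Qed.

Lemma sixesD2 n m1 m2 a b : sixes n m1 a -> sixes n m2 b -> sixes n (m1 + m2) (a + b).
Proof.
move=> h1 h2 N hN; have [D1 d1] := h1 _ (geq_minr N a).
have [|D2 d2] := h2 (N - minn N a); first by rewrite minnE; lia.
exists (D1 ++ map (map (shift 0 (2 * m1))) D2).
have -> : N = minn N a + (N - minn N a) by rewrite subnKC // geq_minl.
apply: covers_union d1 d2 _ _ _ _ _ _; rewrite ?addn0 //; lia.
Qed.

(** Unions of smaller blocks provide the smaller numbers of 6-cycles, so only the largest number
    asks for an explicit block. *)
Lemma sixesS n m a D : sixes n m a -> covers (2 * n) (2 * m) a.+1 D -> sixes n m a.+1.
Proof. by move=> h hD N; rewrite leq_eqVlt => /orP[/eqP->|/h//]; exists D. Qed.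

Lemma sixes11 : sixes 1 1 0.
Proof. by move=> N; rewrite leqn0 => /eqP->; exists [:: [:: (0,0); (1,1)]]. Qed.

Lemma sixes22 : sixes 2 2 1.
Proof.
apply: (sixesS (D := [:: [:: (0,0); (1,1); (2,2)]; [:: (0,1); (3,0); (2,3)]; [:: (1,2);
  (3,3)]])) => //.
by have h := sixesD1 sixes11 sixes11; apply: (sixesD2 h h).
Qed.

Lemma sixes23 : sixes 2 3 2.
Proof.
apply: (sixesS (D := [:: [:: (0,0); (2,3); (1,2)]; [:: (0,1); (2,5); (3,3)];
  [:: (0,4); (3,1); (1,5)]; [:: (1,0); (3,2); (2,4)]])) => //.
by apply: (sixesD2 sixes22 (sixesD1 sixes11 sixes11)).
Qed.

Lemma sixes32 : sixes 3 2 2.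
Proof.
apply: (sixesS (D := [:: [:: (0,0); (3,2); (1,3)]; [:: (0,1); (2,3); (5,2)];
  [:: (1,0); (2,2); (4,1)]; [:: (3,1); (5,0); (4,3)]])) => //.
by apply: (sixesD1 sixes22 (sixesD2 sixes11 sixes11)).
Qed.

Lemma sixes33 : sixes 3 3 3.
Proof.
apply: (sixesS (D := [:: [:: (0,0); (2,5); (3,3)]; [:: (0,1); (4,4); (3,2)];
  [:: (0,4); (2,3); (5,5)]; [:: (1,0); (3,1); (5,2)]; [:: (1,1); (2,2); (4,3)];
  [:: (1,4); (5,0); (4,5)]])) => //.
by apply: (sixesD2 sixes32 (sixesD1 (sixesD1 sixes11 sixes11) sixes11)).
Qed.

(** Four copies of [sixes22] reach only 4, whereas [16 %/ 3] is 5. *)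
Lemma sixes44 : sixes 4 4 5.
Proof.
apply: (sixesS (D := [:: [:: (0,0); (2,4); (5,2)]; [:: (0,1); (6,3); (2,7)];
  [:: (0,3); (3,7); (4,5)]; [:: (0,4); (3,1); (2,6)]; [:: (1,0); (7,4); (4,1)];
  [:: (1,2); (3,0); (6,5)]; [:: (1,3); (5,1); (7,6)]; [:: (1,4); (6,6); (5,7)];
  [:: (2,2); (6,7); (7,5)]; [:: (3,5); (5,0); (4,6)]; [:: (4,2); (7,3)]])) => //.
by have h := sixesD1 sixes22 sixes22; apply: (sixesD2 h h).
Qed.

Lemma nat_ind3 (P : nat -> Prop) : P 2 -> P 3 -> P 4 -> (forall n, P n -> P (3 + n)) ->
  forall n, 2 <= n -> P n.
Proof.
move=> h2 h3 h4 hs n; elim/ltn_ind: n => -[|[|[|[|[|n]]]]] IH // _.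
by apply: (hs n.+2); apply: IH => //; lia.
Qed.

Lemma sixes3 m : 2 <= m -> sixes 3 m m.
Proof.
move: m; apply: nat_ind3; [exact: sixes32|exact: sixes33|exact: (sixesD2 sixes32 sixes32)|].
by move=> m IH; apply: (sixesD2 sixes33 IH).
Qed.

(** A block with [m = 3] splits into 6-cycles alone, so appending it raises the quotient by exactly
    [n]; the values 2, 3, 4 of [m] start the induction. *)
Lemma sixes_lt5 n : 2 <= n <= 4 -> forall m, 2 <= m -> sixes n m ((n * m) %/ 3).
Proof.
move=> hn; have hn3 : sixes n 3 n.
  case: n hn => [|[|[|[|[|n]]]]] // _; [exact: sixes23|exact: sixes33|].
  exact: (sixesD1 sixes23 sixes23).
apply: nat_ind3.
- case: n hn hn3 => [|[|[|[|[|n]]]]] // _ _; [exact: sixes22|exact: sixes32|].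
  exact: (sixesD1 sixes22 sixes22).
- by rewrite mulnK.
- case: n hn hn3 => [|[|[|[|[|n]]]]] // _ _; [exact: (sixesD2 sixes22 sixes22)|exact: sixes3|].
  exact: sixes44.
by move=> m IH; rewrite mulnDr divnMDl //; apply: sixesD2.
Qed.

Lemma sixes_all n m : 2 <= n -> 2 <= m -> sixes n m ((n * m) %/ 3).
Proof.
move=> hn hm; move: n hn; apply: nat_ind3; try exact: sixes_lt5.
move=> n IH; rewrite mulnDl mulnC divnMDl //; apply: sixesD1 IH; exact: sixes3.
Qed.

End Grid.

Lemma perm46 (L : seq nat) : all (fun m => (m == 4) || (m == 6)) L ->
  perm_eq L (nseq (count_mem 6 L) 6 ++ nseq (count_mem 4 L) 4) /\
  sumn L = 6 * count_mem 6 L + 4 * count_mem 4 L.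
Proof.
elim: L => //= m L IH /andP[hm /IH[h1 h2]]; split; last first.
  by rewrite h2; case/orP: hm => /eqP-> /=; clear; lia.
case/orP: hm => /eqP-> /=; rewrite ?add0n ?add1n.
  by rewrite -(perm_cons 4) in h1; perm_from h1.
by rewrite perm_cons.
Qed.

Lemma perm46_eq (L1 L2 : seq nat) : all (fun m => (m == 4) || (m == 6)) L1 ->
  all (fun m => (m == 4) || (m == 6)) L2 -> sumn L1 = sumn L2 ->
  count_mem 6 L1 = count_mem 6 L2 -> perm_eq L1 L2.
Proof.
move=> /perm46[p1 s1] /perm46[p2 s2] hs h6.
have h4 : count_mem 4 L1 = count_mem 4 L2.
  by move: s1 s2; rewrite hs h6 => -> /addnI /eqP; rewrite eqn_mul2l => /eqP.
by rewrite (permPl p1) h4 h6 perm_sym.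
Qed.

(** * From grid blocks to cycles of the simple graph *)

Section Embed.
Variables v u : nat.
Notation edge := (edge v.+1 u.+1 1).
Notation wins N := (reach N (@nil edge)).

Lemma cyc4 (r0 r1 : 'I_v.+1) (c0 c1 : 'I_u.+1) : r0 != r1 -> c0 != c1 ->
  cyc [:: (r0, c0, ord0); (r1, c0, ord0); (r1, c1, ord0); (r0, c1, ord0) : edge].
Proof.
move=> hr hc; exists (inl r0), [:: inr c0; inl r1; inr c1]; split.
- by do 3 (apply: walkS; first by rewrite /joins /= !eqxx ?orbT);
    apply: walk1; rewrite /joins /= !eqxx ?orbT.
- by rewrite /= !inE !eqE /= ?(eq_sym r1) (negbTE hr) (negbTE hc).
by rewrite /= !inE !xpair_eqE !eqxx (eq_sym r1) (negbTE hr) (negbTE hc) ?(andbF, andbT).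
Qed.

Lemma cyc6 (r0 r1 r2 : 'I_v.+1) (c0 c1 c2 : 'I_u.+1) : uniq [:: r0; r1; r2] -> uniq [:: c0; c1;
  c2] ->
  cyc [:: (r0, c0, ord0); (r1, c0, ord0); (r1, c1, ord0); (r2, c1, ord0); (r2, c2, ord0);
    (r0, c2, ord0) : edge].
Proof.
rewrite /= !inE !negb_or !andbT => /andP[/andP[h1 h2] h3] /andP[/andP[k1 k2] k3].
exists (inl r0), [:: inr c0; inl r1; inr c1; inl r2; inr c2]; split.
- by do 5 (apply: walkS; first by rewrite /joins /= !eqxx ?orbT);
    apply: walk1; rewrite /joins /= !eqxx ?orbT.
- rewrite /= !inE !eqE /= -?/(_ == _).
  by rewrite (negbTE h1) (negbTE h2) (negbTE h3) (negbTE k1) (negbTE k2) (negbTE k3).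
rewrite /= !inE !xpair_eqE !eqxx ?(eq_sym r1 r0) ?(eq_sym r2 r0) ?(eq_sym r2 r1).
by rewrite (negbTE h1) (negbTE h2) (negbTE h3) (negbTE k1) (negbTE k2) (negbTE k3) ?(andbF, andbT).
Qed.

Definition grid_edge (p : nat * nat) : edge := (inord p.1, inord p.2, ord0).

Lemma inord_neq n a b : a < n.+1 -> b < n.+1 -> a != b -> inord a != inord b :> 'I_n.+1.
Proof. by move=> ha hb; apply: contraNneq => h; apply/eqP; move: (congr1 val h);
  rewrite /= !inordK. Qed.

Lemma wf_cyc s : wf v.+1 u.+1 s -> exists2 E, perm_eq E (map grid_edge (cedges s)) & cyc E.
Proof.
case/and4P; case: s => [|[a b] [|[c d] [|[e f] [|? ?]]]] // _ /=.
- rewrite !inE !andbT => h1 h2 /andP[/andP[a1 a2] /andP[b1 b2]].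
  have := cyc4 (inord_neq a1 b1 h1) (inord_neq a2 b2 h2) => hC.
  by eexists; last exact: hC; rewrite /grid_edge /=; perm_lia.
rewrite !inE !negb_or !andbT => /andP[/andP[h1 h2] h3] /andP[/andP[k1 k2] k3].
move=> /and3P[/andP[a1 a2] /andP[b1 b2] /andP[c1 c2]].
have hC := @cyc6 (inord a) (inord c) (inord e) (inord b) (inord d) (inord f).
eexists; last first.
  by apply: hC; rewrite /= !inE !negb_or !inord_neq.
by rewrite /grid_edge /=; perm_lia.
Qed.

Lemma covers_reach N D : covers v.+1 u.+1 N D -> wins (map (fun s => 2 * size s) D).
Proof.
case/gridP => h1 _ h3 h4.
have [Cs [c1 c2 c3]] : exists Cs : seq (seq edge), [/\ {in Cs, forall C, cyc C},
    map size Cs = map (fun s =>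
      2 * size s) D & perm_eq (flatten Cs) (map grid_edge (flatten (map cedges D)))].
  elim: D h1 {h3 h4} => [|s D IH] h1; first by exists [::].
  have [|Cs [c1 c2 c3]] := IH; first by move=> t ht; apply: h1; rewrite inE ht orbT.
  have [E pE cE] := wf_cyc (h1 s (mem_head _ _)).
  exists (E :: Cs); split.
  - by move=> C; rewrite inE => /orP[/eqP->|/c1].
  - rewrite /= c2 (perm_size pE) size_map /cedges size_cat size_map size_zip size_rot minnn.
    by rewrite mul2n addnn.
  by rewrite /= map_cat perm_cat.
rewrite -c2; apply: reach_cover => //.
  move=> [[i j] k]; rewrite cats0 (perm_mem c3); apply/mapP; exists (val i, val j);
    first by apply: h4; apply: ltn_ord.
  by rewrite /grid_edge /= !inord_val (ord1 k).
rewrite cats0 size_flatten /shape c2 muln1 -h3.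
by elim: (D) => //= s D' IH; rewrite mulnDr leq_add2l.
Qed.

Lemma base46 n m M : v.+1 = 2 * n -> u.+1 = 2 * m -> 2 <= n -> 2 <= m ->
  all (fun m => (m == 4) || (m == 6)) M -> sumn M = v.+1 * u.+1 -> wins M.
Proof.
move=> hv hu hn hm hM hs; have [pM sM] := perm46 hM.
have hs2 : sumn M = 4 * (n * m) by rewrite hs hv hu; clear; lia.
(* From [6 * a + 4 * b = 4 * (n * m)] the number [a] of 6-cycles is even, and [a = 2 * N] gives
   [3 * N <= n * m], the range of [sixes_all]. *)
have [N hN] : exists N, count_mem 6 M = 2 * N.
  exists (count_mem 6 M)./2; move: sM; rewrite hs2; move: (count_mem 6 M) (count_mem 4 M) (n * m).
  by clear; lia.
have hN3 : N <= (n * m) %/ 3.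
  by rewrite leq_divRL //; move: sM; rewrite hs2 hN; move: (count_mem 4 M) (n * m); clear; lia.
have [D hD] := sixes_all hn hm hN3; rewrite -hv -hu in hD.
apply: reach_perm (covers_reach hD) => //; have [h1 h2 h3 _] := gridP _ _ _ _ hD.
apply: perm46_eq => //.
- by apply/allP => k /mapP[s /h1/and4P[/orP[]/eqP-> _ _ _] ->].
- rewrite hs -h3; elim: (D) => //= s D' IH; by rewrite mulnDr IH.
by rewrite hN -h2 count_map; apply: eq_count => s /=; rewrite -[6]/(2 * 3) eqn_mul2l.
Qed.

End Embed.

Lemma four_six v u n m M : v = 2 * n -> u = 2 * m -> 2 <= n -> 2 <= m ->
  all (fun m => (m == 4) || (m == 6)) M -> sumn M = v * u -> reach M (@nil (edge v u 1)).
Proof.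
case: v u => [|v] [|u] hv hu hn hm; try (by move: hv hu hn hm; clear; lia).
exact: base46 hv hu hn hm.
Qed.

(** * Lists of lengths for the simple graph *)

Section SimpleLists.
Variables v u G H : nat.
Hypothesis hvu : v <= u.
Hypothesis hGH : bnd v u (G + H).
Notation wins N := (reach N (@nil (edge v u 1))).
Implicit Types (M R : seq nat) (m g h : nat).

Definition good1 M := [/\ all (fun m => [&& 4 <= m, ~~ odd m & m <= G]) M,
  count (fun m => H < m) M <= 1,
  forall m R, perm_eq M (m :: R) -> has (fun b => m <= 3 * b) R & sumn M = v * u].

(** A 4 is split off the largest entry until only 4 and 6 remain. It is merged back in the presence
    of the second largest entry [h], for which the third condition of [good1] gives the ratio 3. *)
Lemma simple_lists n m M : v = 2 * n -> u = 2 * m -> 2 <= n -> 2 <= m -> good1 M -> wins M.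
Proof.
move=> hv hu hn hm.
have base R : all (fun m => (m == 4) || (m == 6)) R -> sumn R = v * u -> wins R.
  exact: four_six hv hu hn hm.
move: {2}(sumn [seq k - 4 | k <- M]) (leqnn (sumn [seq k - 4 | k <- M])) => w.
elim: w M => [|w IH] M hw [hM hc hd hs].
  apply: base => //; apply/allP => k kM; have := allP hM _ kM => /and3P[h4 _ _].
  rewrite (perm_sumn (perm_map (fun k => k - 4) (perm_to_rem kM))) /= in hw.
  by move: hw h4; clear; lia.
case: (boolP (all (fun m => (m == 4) || (m == 6)) M)) => h46; first exact: base.
have [g gM hg] : exists2 g, g \in M & {in M, forall m, m <= g}.
  by apply: max_elt; apply: contraNneq h46 => ->.
have g8 : 8 <= g.
  case/allPn: h46 => k kM; have := allP hM _ kM => /and3P[h4 ok _] hk.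
  by apply: leq_trans (hg _ kM); move: h4 ok hk; clear; lia.
have pg := perm_to_rem gM; set R := rem g M in pg.
have /hasP[b bR gb] := hd _ _ pg.
have [h hR hh] : exists2 h, h \in R & {in R, forall m, m <= h}.
  by apply: max_elt; case: (R) bR.
have g3 : g <= 3 * h by apply: leq_trans gb _; rewrite leq_mul2l hh.
have ph := perm_to_rem hR; set R2 := rem h R in ph.
have pM : perm_eq M [:: g, h & R2] by rewrite (permPl pg) perm_cons.
have hhg : h <= g by apply: hg; rewrite (perm_mem pg) in_cons hR orbT.
have := hM; rewrite (perm_all _ pM) => /= /and3P[/and3P[_ og gG] /and3P[h4 oh hG] aR2].
have cM := hc; rewrite (permP pM) /= in cM.
have hH : h <= H by case: (leqP h H) hhg cM => // h1 h2; rewrite (leq_trans h1 h2); clear; lia.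
have hb : bnd v u (h + g) by apply: bndW hGH; rewrite addnC; apply: leq_add.
have hR2 k : k \in R2 -> k <= h.
  by move=> hk; apply: hh; rewrite (perm_mem ph) in_cons hk orbT.
(* The entry [h] dominates all others up to the factor 3, and [h] itself is dominated by [g - 4],
   since [h <= g <= 3 * (g - 4)] for [g >= 8]. *)
pose M' := [:: h, 4, g - 4 & R2].
apply: reach_perm (_ : wins [:: h, g & R2]) => //.
  by rewrite perm_sym (permPl pM) (perm_catCA [:: g] [:: h]).
have gE : 4 + (g - 4) = g by rewrite subnKC // (leq_trans _ g8).
have := @merge_simple v u hvu R2 h 4 (g - 4); rewrite gE; apply=> //; last first.
  by apply: leq_trans hhg _; rewrite leq_pmull.
apply: IH.
  rewrite (perm_sumn (perm_map (fun k => k - 4) pM)) /= in hw.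
  by move: hw g8; rewrite /=; clear; lia.
split.
- rewrite /= h4 oh hG aR2 (leq_trans h4 hG) andbT /=.
  by move: g8 og gG; clear; lia.
- apply: leq_trans cM => /=; move: (count _ _) hH h4 g8 => p; clear; lia.
- move=> k S pk; have kM' : k \in M' by rewrite (perm_mem pk) mem_head.
  case: (eqVneq k h) => kh.
    have pS : perm_eq S [:: 4, g - 4 & R2].
      by rewrite -(perm_cons h) -kh perm_sym {1}kh.
    rewrite (perm_has _ pS) /= kh; apply/orP; right; apply/orP; left.
    by move: hhg g8; clear; lia.
  apply/hasP; exists h.
    have : h \in k :: S by rewrite -(perm_mem pk) mem_head.
    by rewrite in_cons eq_sym (negbTE kh).
  move: kM'; rewrite /M' !in_cons (negbTE kh) /= => /or3P[/eqP->|/eqP->|/hR2 hk].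
  + by move: h4; clear; lia.
  + by apply: leq_trans g3; apply: leq_subr.
  by apply: leq_trans hk _; rewrite leq_pmull.
by rewrite -hs (perm_sumn pM) /=; move: g8; clear; lia.
Qed.

End SimpleLists.

(** * Odd multiplicity *)

Section Odd.
Variables v u lam : nat.
Hypothesis hvu : v <= u.
Hypothesis lam_odd : odd lam.
Notation edge := (edge v u lam).
Notation edge1 := (Defs.edge v u 1).
Notation wins N := (reach N (@nil edge)).
Implicit Types (N A : seq nat).

Definition emb (e : edge1) : edge := (e.1, Ordinal (odd_gt0 lam_odd)).

Lemma walk_emb x y (E : seq edge1) I : walk x y E I -> walk x y (map emb E) I.
Proof. by elim=> [x1 y1 e j|x1 y1 z1 e E1 I1 j _ IH] /=; [apply: walk1|apply: walkS IH]. Qed.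

Lemma emb_inj : injective emb.
Proof. by move=> [p k] [q l] [->]; rewrite (ord1 k) (ord1 l). Qed.

Lemma cyc_emb (E : seq edge1) : cyc E -> cyc (map emb E).
Proof.
move=> [x [I [w uI uE]]]; exists x, I; split=> //; first exact: walk_emb.
by rewrite (map_inj_uniq emb_inj).
Qed.

Lemma lift_cover N (E : seq edge1) : reach N E -> exists Cs : seq (seq edge),
  [/\ {in Cs, forall C, cyc C}, perm_eq (map size Cs) N,
    forall e : edge, e.2 < odd lam -> e \in flatten Cs ++ map emb E
    & size (flatten Cs ++ map emb E) = v * u * odd lam].
Proof.
move=> [Cs [h1 h2 h3]]; exists (map (map emb) Cs).
have fE : flatten (map (map emb) Cs) ++ map emb E = map emb (flatten Cs ++ E).
  by rewrite map_cat map_flatten.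
split.
- by move=> C /mapP[C' /h1 hC ->]; apply: cyc_emb.
- rewrite -map_comp; apply: perm_trans h2.
  by rewrite (eq_map (g := size)) // => C /=; rewrite size_map.
- rewrite fE lam_odd => -[p k] /= hk; apply/mapP; exists (p, ord0).
    by rewrite (perm_mem h3) mem_enum.
  by congr pair; apply: val_inj => /=; move: hk; case: (val k).
by rewrite fE size_map (perm_size h3) -cardE !card_prod !card_ord lam_odd.
Qed.

Lemma lift_simple N : reach N (@nil edge1) -> wins (N ++ nseq (v * u * lam./2) 2).
Proof.
move=> /lift_cover[Cs [h1 h2 h3 h4]]; apply: reach_perm (base_reach h1 h3 h4) => //.
by rewrite perm_cat2r.
Qed.

(* Two label-0 cycles absorb a 2-cycle parallel to one of their edges; at most two beads
   of length 2 can then occur. *)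
Lemma odd_step_two N c h g : 0 < lam./2 -> reach (c :: c :: N) (@nil edge1) -> h + g = c + c + 2 ->
  h <= g -> g < 3 * h -> ~~ odd h -> 4 <= h -> bnd v u (h + g) ->
  wins (h :: g :: N ++ nseq (v * u * lam./2).-1 2).
Proof.
move=> lam2 /absorb_tour[E1 [V1 [t1 u1 s1 hR1]]] hc hhg g3 oh h4 hb.
rewrite cats0 in hR1; have [E2 [V2 [t2 u2 s2 hR2]]] := absorb_tour hR1.
have [Cs [k1 k2 k3 k4]] := lift_cover hR2.
have em E V : tour E V -> tour (map emb E) V.
  move=> [x [F [I [w p q]]]]; exists x, (map emb F), I.
  by split=> //; [exact: walk_emb|exact: perm_map].
have [e eE] : exists e, e \in E1.
  case: E1 t1 {hR1 hR2 k3 k4} => [|e E] t1; last by exists e; rewrite mem_head.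
  by move: (tour_size t1); rewrite s1 /= => c0; move: hc h4 hhg; rewrite c0; clear; lia.
(* Parallel to an edge of the first cycle, so the 2-cycle shares a vertex with it and the state has
   a repetition. *)
pose D : seq edge := [:: (e.1, pair_label false (Ordinal lam2));
  (e.1, pair_label true (Ordinal lam2))].
pose a : vtx v u := inl e.1.1; pose b : vtx v u := inr e.1.2.
have tD : tour D [:: a; b].
  apply: tour_walk; apply: walkS; first by rewrite /joins /= !eqxx.
  by apply: walk1; rewrite /joins /= !eqxx ?orbT.
have hR := @base_pick v u lam Cs (map emb (E2 ++ E1)) e.1 (Ordinal lam2) k1 k3 k4.
rewrite -/D in hR.
pose TT := [:: (D, [:: a; b]); (map emb E2, V2); (map emb E1, V1)].
have kTT : ok TT by move=> t; rewrite !inE => /or3P[]/eqP-> //=; apply: em.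
have hR' : reach (N ++ nseq (v * u * lam./2).-1 2) (eds TT).
  by apply: reach_perm hR; [rewrite perm_cat2r|rewrite /eds /= cats0 map_cat].
have lE : g = h + g - h by rewrite addKn.
rewrite {1}lE; apply: (@win_few v u lam hvu _ h (h + g) TT) => //.
- by rewrite addKn.
(* Only the 2-cycle can carry nonzero labels, so [extra <= 2], and the count of [win_few] becomes
   [h + g + 4 < 4 * (h + 1)], that is [g < 3 * h]. *)
- have x0 (E : seq edge1) : extra (map emb E) = 0 by rewrite /extra count_map; elim: E.
  rewrite /eds /extra /= cats0 count_cat -!/(extra _) !x0.
  rewrite !addn0; move: g3; have : forall b1 b2 : bool, b1 + b2 <= 2 by case=> -[].
  by move/(_ (0 < pair_label false (Ordinal lam2)) (0 < pair_label true (Ordinal lam2)));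
    move: (_ + _) => z; clear; lia.
- by rewrite /vs /= cats0 size_cat s1 s2 hc; clear; lia.
rewrite /vs /= exc_in // !(in_cons, mem_cat).
by rewrite (tour_inc t1 eE) ?orbT // /inc eqxx.
Qed.

(** The entries above 2 cover at least one full label. Entries of [A] are shrunk, with 2-cycles
    split off, until [g], [h] and [A] fill label 0 exactly and [simple_lists] applies; [enlarge]
    with the long cycle [g] undoes each step. *)
Lemma odd_lists n m g h A k : v = 2 * n -> u = 2 * m -> 3 <= n -> 3 <= m ->
  ~~ odd g -> ~~ odd h -> 4 <= h -> h <= g -> g <= 3 * h -> bnd v u (g + h) ->
  all (fun x => [&& 4 <= x, ~~ odd x & x <= h]) A -> v * u <= g + h + sumn A ->
  g + h + sumn A + 2 * k = v * u * lam -> wins (g :: h :: A ++ nseq k 2).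
Proof.
move=> hv hu hn hm og oh h4 hhg g3 hb.
move: {2}(sumn A) (leqnn (sumn A)) => w; elim: w A k => [|w IH] A k hw hA hS hs.
  by exfalso; move: hw hS hb hv hu hn hm; rewrite /bnd => h0; nia.
have hK : v * u * lam = v * u + 2 * (v * u * lam./2).
  by rewrite -{1}[lam]odd_double_half lam_odd mulnDr muln1 -mul2n mulnCA.
have ev : v * u = 4 * (n * m) by rewrite hv hu; clear; lia.
have vu_big : g + h < v * u.
  by move: hb hvu; rewrite /bnd; move: hv hu hn hm; clear; nia.
case: (ltnP (v * u) (g + h + sumn A)) => hS2; last first.
  have eS : g + h + sumn A = v * u by apply/eqP; rewrite eqn_leq hS2 hS.
  have -> : k = v * u * lam./2 by move: hs; rewrite eS hK => /addnI/eqP; rewrite eqn_mul2l => /eqP.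
  rewrite -!cat_cons; apply: lift_simple; apply: (simple_lists hvu hb hv hu (ltnW hn) (ltnW hm));
    split.
  - rewrite /= og oh hhg leqnn (leq_trans h4 hhg) h4 /=.
    by apply: sub_all hA => x /and3P[-> -> hx]; rewrite (leq_trans hx).
  - rewrite /= ltnn; have /eqP-> : count (fun x => h < x) A == 0; last by case: (_ < _).
    by rewrite -leqn0 leqNgt -has_count; apply/hasPn => x /(allP hA)/and3P[_ _]; rewrite -leqNgt.
  - move=> x R pR; have hx : x <= g.
      have : x \in g :: h :: A by rewrite (perm_mem pR) mem_head.
      rewrite !in_cons => /or3P[/eqP->|/eqP->|/(allP hA)/and3P[_ _ hx]] //.
      exact: leq_trans hx hhg.
    case: (eqVneq x h) => xh.
      apply/hasP; exists g; last by rewrite xh (leq_trans hhg) // leq_pmull.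
      have : perm_eq (h :: R) [:: h, g & A] by rewrite xh in pR; rewrite perm_sym;
        apply: perm_trans pR; rewrite (perm_catCA [:: h] [:: g]).
      by rewrite perm_cons => /perm_mem ->; rewrite mem_head.
    apply/hasP; exists h; last exact: leq_trans hx g3.
    have : h \in x :: R by rewrite -(perm_mem pR) !in_cons eqxx orbT.
    by rewrite in_cons eq_sym (negbTE xh).
  by rewrite /= addnA.
case: (boolP (has (fun x => 6 <= x) A)) => [/hasP[a aA a6]|h6].
  have pA := perm_to_rem aA; set A' := rem a A in pA.
  have := hA; rewrite (perm_all _ pA) /= => /andP[/and3P[a4 oa ah] hA'].
  have sA : sumn A = a + sumn A' := perm_sumn pA.
  have hr : wins (g :: h :: (a - 2 :: A') ++ nseq k.+1 2).
    apply: IH => /=.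
    - by move: hw; rewrite sA; move: a6; clear; lia.
    - by rewrite hA' andbT; move: a6 oa ah; clear; lia.
    - by move: hS2 hs og oh oa a6; rewrite sA hK ev; clear; lia.
    - by rewrite -hs sA; move: a6; clear; lia.
  have hr2 : wins (g :: a - 2 :: nseq 1 2 ++ h :: A' ++ nseq k 2).
    by apply: reach_perm hr => //=; perm_lia.
  have := enlarge hvu hr2 isT; rewrite muln1 subnK; last by apply: leq_trans a6.
  move=> he; apply: reach_perm (he _ _ _ _ _) => //.
  - by move/permP: pA => pA; apply/permP => q; move: (pA q); count_lia.
  - by move: a6; clear; lia.
  - exact: leq_trans ah hhg.
  - by move: a6 oa; clear; lia.
  - by apply: bndW hb; rewrite -addnA leq_add2l subnK // (leq_trans _ a6).
have A4 x : x \in A -> x = 4.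
  move=> xA; have /and3P[x4 ox _] := allP hA _ xA; have := hasPn h6 _ xA.
  by move: x4 ox; clear; lia.
case: A hw hA hS hs hS2 h6 A4 => [|a A] hw hA hS hs hS2 h6 A4.
  by move: hS2 vu_big; rewrite addn0; clear; lia.
have a4 : a = 4 by apply: A4; rewrite mem_head.
have /= /andP[_ hA'] := hA.
(* All entries of [A] are now 4. Splitting one into two 2-cycles lowers the total by 4, which an
   excess of only 2 over [v * u] does not allow. *)
case: (leqP (v * u + 4) (g + h + sumn (a :: A))) => hS4.
  have hr : wins (g :: h :: A ++ nseq k.+2 2).
    apply: IH => //.
    - by move: hw; rewrite a4 /=; clear; lia.
    - by move: hS4; rewrite a4 /=; clear; lia.
    - by rewrite -hs a4 /=; clear; lia.
  have hr2 : wins (g :: 2 :: nseq 1 2 ++ h :: A ++ nseq k 2).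
    by apply: reach_perm hr => //=; perm_lia.
  have := enlarge hvu hr2 isT; rewrite muln1 -[2 + 2]/4 => he;
    apply: reach_perm (he _ _ _ _ _) => //.
  - by rewrite a4 /=; perm_lia.
  - exact: leq_trans h4 hhg.
  - by apply: bndW hb; rewrite -addnA leq_add2l.
have eA : sumn (a :: A) = 4 * size (a :: A).
  have /all_pred1P-> : all (pred1 4) (a :: A) by apply/allP => x /A4->.
  by rewrite sumn_nseq size_nseq.
(* The excess is exactly 2 and 4 divides [v * u], so [g + h] is 2 modulo 4. Therefore [c] is even,
   and [g = 3 * h] is impossible for even [h]; label 0 is filled with [c, c] in place of [g, h], and
   a 2-cycle makes up the difference. *)
have gh2 : g + h + 4 * size (a :: A) = 4 * (n * m) + 2.
  move: hS2 hS4; rewrite eA ev; move: og oh ; clear; lia.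
pose c := (g + h - 2)./2.
have hc : g + h = c + c + 2 by rewrite /c; move: gh2 h4; clear; lia.
have oc : ~~ odd c by move: gh2; rewrite hc; clear; lia.
have c4 : 4 <= c by move: hc oc h4 hhg; clear; lia.
have hk : k = (v * u * lam./2).-1.
  by move: hs; rewrite eA gh2 hK ev; clear; lia.
have l2 : 0 < lam./2.
  by rewrite lt0n; apply/negP => /eqP l0; move: hs hS2; rewrite hK l0 muln0; clear; lia.
rewrite hk; apply: reach_perm (_ : wins (h :: g :: (a :: A) ++ nseq (v * u * lam./2).-1 2)) => //.
  by rewrite (perm_catCA [:: h] [:: g]).
apply: (odd_step_two l2 (c := c)) => //.
- have hcc : bnd v u (c + c) by apply: bndW hb; rewrite hc leq_addr.
  apply: (simple_lists hvu hcc hv hu (ltnW hn) (ltnW hm)); split.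
  + rewrite /= oc c4 leqnn /= a4 c4 /=; apply/allP => x xA.
    by rewrite (A4 x) ?c4 // in_cons xA orbT.
  + rewrite /= ltnn; have /eqP-> : count (fun x => c < x) A == 0; last by rewrite a4 ltnNge c4.
    by rewrite -leqn0 leqNgt -has_count; apply/hasPn => x xA;
      rewrite (A4 x) -?leqNgt // in_cons xA orbT.
  + move=> x R pR; have hx : x <= c.
      have : x \in c :: c :: a :: A by rewrite (perm_mem pR) mem_head.
      by rewrite !(in_cons c) => /or3P[/eqP->|/eqP->|/A4->].
    apply/hasP; exists c; last by apply: leq_trans hx _; rewrite leq_pmull.
    have := permP pR (pred1 c); rewrite /= eqxx.
    rewrite -has_pred1 has_count.
    by move: (count _ A) (count _ R) (x == c) (a == c) => p q [] [] /=; clear; lia.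
  have -> : sumn [:: c, c, a & A] = c + c + sumn (a :: A) by rewrite /= addnA.
  rewrite eA ev; move: gh2; rewrite hc; clear; lia.
- by rewrite addnC hc.
- by rewrite ltn_neqAle g3 andbT; apply/negP => /eqP gh; move: gh2 oh; rewrite gh; clear; lia.
by rewrite addnC.
Qed.

End Odd.

(** * Conclusion *)

(** [reach] fixes lengths up to order, while a decomposition indexes its cycles by the positions of
    [M]; this puts the cycles in that order. *)
Lemma perm_map_sort (T : eqType) (f : T -> nat) s t : perm_eq (map f s) t ->
  exists2 s', perm_eq s' s & map f s' = t.
Proof.
elim: t s => [|m t IH] s h; first by exists s => //; case: s h => // a s /perm_size.
have : m \in map f s by rewrite (perm_mem h) mem_head.
case/mapP => a aS hm; have pa := perm_to_rem aS.
have [|s' p' e'] := IH (rem a s).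
  by have := perm_map f pa; rewrite (permPl h) /= -hm perm_cons perm_sym.
by exists (a :: s'); rewrite /= ?hm ?e' // perm_sym (permPl pa) perm_cons perm_sym.
Qed.

Lemma flatten_nth_inj (T : eqType) (ss : seq (seq T)) e i j : uniq (flatten ss) ->
  e \in nth [::] ss i -> e \in nth [::] ss j -> i = j.
Proof.
elim: ss i j => [|s ss IH] [|i] [|j] //=; rewrite ?nth_nil // cat_uniq => /and3P[_ /hasPn h u].
- move=> es ej; have : e \in flatten ss.
    apply/flattenP; exists (nth [::] ss j) => //; apply: mem_nth.
    by case: ltnP ej => // hj; rewrite nth_default.
  by move/h; rewrite /= es.
- move=> ei es; have : e \in flatten ss.
    apply/flattenP; exists (nth [::] ss i) => //; apply: mem_nth.
    by case: ltnP ei => // hi; rewrite nth_default.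
  by move/h; rewrite /= es.
by move=> ei ej; congr _.+1; apply: IH.
Qed.

Section Final.
Variables v u lam : nat.
Notation vtx := (vtx v u).
Notation edge := (edge v u lam).

Lemma walk_nth (x y z : vtx) E I e0 : walk x y E I -> forall j, j < size E ->
  joins (nth e0 E j : edge) (nth z (x :: I) j) (nth z (rcons I y) j).
Proof.
by elim=> [x1 y1 e h [|j]|x1 y1 z1 e E1 I1 h _ IH [|j]] //= hj; apply: IH.
Qed.

Lemma is_cycle_nth E m e0 : cyc E -> size E = m -> is_cycle (fun j : 'I_m => nth e0 E j : edge).
Proof.
move=> [x [I [w uI uE]]] hm; have sE := size_walk w; split.
  have [e [E' [hE nE]]] := walk_size1 w; rewrite -hm hE; by case: E' nE {hE}.
split.
  by move=> i j /eqP; rewrite nth_uniq ?hm ?ltn_ord // => /eqP; apply: val_inj.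
exists (fun j : 'I_m => nth x (x :: I) j); split.
  have hk (k : 'I_m) : k < size (x :: I) by rewrite /= -sE hm.
  by move=> i j /eqP; rewrite nth_uniq ?hk // => /eqP; apply: val_inj.
move=> i; have hi : i < size E by rewrite hm.
have := walk_nth x e0 w hi; rewrite nth_rcons /=.
(* At the last index [ordS] wraps around to 0, which is the base point of the closed walk. *)
have := hi; rewrite sE ltnS leq_eqVlt => /orP[/eqP hiI|hiI].
  have -> : i.+1 %% m = 0 by rewrite hiI -sE hm modnn.
  by rewrite hiI ltnn eqxx.
have hiS : i.+1 < m by move: hiI; rewrite -ltnS -sE hm.
by rewrite hiI modn_small.
Qed.

Lemma decomposition_of_reach M (e0 : edge) : reach M (@nil edge) -> cycle_decomposition v u lam M.
Proof.
move=> [Cs [h1 h2 h3]]; rewrite cats0 in h3.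
have [Ds pD sD] := perm_map_sort h2.
have hs : size M = size Ds by rewrite -sD size_map.
have sz i : i < size M -> size (nth [::] Ds i) = nth 0 M i.
  by move=> hi; rewrite -sD (nth_map [::]) // -hs.
have pf : perm_eq (flatten Ds) (enum {: edge}) := perm_trans (perm_flatten pD) h3.
have uf : uniq (flatten Ds) by rewrite (perm_uniq pf) enum_uniq.
pose C (i : 'I_(size M)) (j : 'I_(nth 0 M i)) : edge := nth e0 (nth [::] Ds i) j.
have inC (i : 'I_(size M)) (j : 'I_(nth 0 M i)) : C i j \in nth [::] Ds i by apply: mem_nth;
  rewrite sz.
exists C; split.
  move=> i; apply: is_cycle_nth; last by rewrite sz.
  by apply: h1; rewrite -(perm_mem pD); apply: mem_nth; rewrite -hs.
move=> e; have /flattenP[D DD eD] : e \in flatten Ds by rewrite (perm_mem pf) mem_enum.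
have uD : uniq D.
  by move: uf; rewrite (perm_uniq (perm_flatten (perm_to_rem DD))) /= cat_uniq => /and3P[].
have hi : index D Ds < size M by rewrite hs index_mem.
pose i := Ordinal hi; have Di : nth [::] Ds i = D by rewrite nth_index.
have hj : index e D < nth 0 M i by rewrite -sz // Di index_mem.
exists (Tagged (fun i : 'I_(size M) => 'I_(nth 0 M i)) (Ordinal hj)); split.
  by rewrite /C /= nth_index // nth_index.
case=> i' j' /= he; have ei : i = i'.
  apply: val_inj; apply: (flatten_nth_inj uf (e := e)); first by rewrite Di.
  by rewrite -he.
case: i' / ei j' he => j' he; congr existT; apply: val_inj => /=.
by rewrite -he /C Di index_uniq // -Di sz.
Qed.

End Final.

Lemma last_two M : sorted leq M -> 1 < size M -> exists g h R,
  [/\ perm_eq M [:: g, h & R], mi M (size M) = g, mi M (size M).-1 = h, h <= g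
    & all (fun m => m <= h) R].
Proof.
case/lastP: M => // M g; case/lastP: M => // M h hs _; exists g, h, M.
have hsr : sorted (fun x y => y <= x) (rev (rcons (rcons M h) g)) by rewrite rev_sorted.
rewrite !rev_rcons /= in hsr; case/andP: hsr => hg hp.
have tr : transitive (fun x y : nat => y <= x) by move=> a b c hab hbc; apply: leq_trans hbc hab.
move: hp; rewrite path_sortedE // all_rev => /andP[hM _].
split=> //.
- by rewrite -!cats1; perm_lia.
- by rewrite size_rcons /= nth_rcons size_rcons ltnn eqxx.
by rewrite !size_rcons /= nth_rcons size_rcons ltnSn nth_rcons ltnn eqxx.
Qed.

Lemma weight_size M : all (leq 2) M -> weight M + 2 * size M = sumn M.
Proof.
elim: M => //= m M IH /andP[hm /IH]; rewrite /weight /=;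
  move: (sumn (map _ _)) (sumn M) (size M) => a b c.
by move: hm; clear; lia.
Qed.

Theorem theorem24 (v u lam : nat) (M : seq nat) :
  5 <= v -> 5 <= u -> v <= u -> 0 < lam ->
  ~~ odd (lam * v) -> ~~ odd (lam * u) ->
  sorted leq M ->
  all (fun m => (0 < m) && ~~ odd m) M ->
  2 <= mi M 1 ->
  (* m_t <= 3 m_{t-1} *)
  mi M (size M) <= 3 * mi M (size M).-1 ->
  (* t <= (lam/2) v u - m_t + 2 if lam even *)
  (~~ odd lam -> size M + mi M (size M) <= (lam * v * u)./2 + 2) ->
  2 * nu2 M <= (lam - 1) * v * u ->
  (v < u -> mi M (size M).-1 + mi M (size M) <= 2 * v + 2) ->
  (v = u -> mi M (size M).-1 + mi M (size M) <= 2 * v) ->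
  sumn M = lam * v * u ->
  cycle_decomposition v u lam M.
Proof.
move=> v5 u5 hvu lam0 ev eu hs hM hm1 hg3 hlam hnu hb1 hb2 hsum.
have v0 : 0 < v by apply: leq_trans v5.
have u0 : 0 < u by apply: leq_trans u5.
apply: (decomposition_of_reach (Ordinal v0, Ordinal u0, Ordinal lam0)).
have M2 : all (leq 2) M by apply: sub_all hM => m /andP[]; clear; lia.
(* The convention [m_0 = 0] in [mi] rules out a single cycle, whose length would be at most
   [3 * 0]. *)
have s1 : 1 < size M.
  by case: M hm1 hg3 M2 {hs hM hlam hnu hb1 hb2 hsum} => [|m [|m' M]] //= _ + /andP[]; clear; lia.
have [g [h [R [pM eg eh hhg hR]]]] := last_two hs s1.
rewrite eg eh in hg3 hlam hb1 hb2.
have hb : bnd v u (g + h).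
  rewrite /bnd addnC; case: (ltngtP v u) hvu => // [/hb1 hx|/hb2 hx] _; last by rewrite hx.
  by rewrite hx orbT.
have := hM; rewrite (perm_all _ pM) => /= /and3P[/andP[g0 og] /andP[h0 oh] eR].
case: (boolP (odd lam)) => [lo|le]; last first.
  apply: (even_lists hvu hb le); split.
  - rewrite (perm_all _ pM) /= og oh hhg leqnn !andbT /=; apply/and3P; split; try by [move: g0 og;
      clear; lia|move: h0 oh; clear; lia].
    apply/allP => m mR; have /andP[m0 om] := allP eR _ mR; have mh := allP hR _ mR.
    by rewrite om (leq_trans mh hhg); move: m0 om; clear; lia.
  - rewrite (permP pM) /= ltnn add0n; have /eqP-> : count (fun m => h < m) R == 0;
      last by case: (_ < _).
    by rewrite -leqn0 leqNgt -has_count; apply/hasPn => m /(allP hR); rewrite -leqNgt.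
  (* By [weight_size], the bound on the number of cycles is the weight bound for [g]; the halving is
     exact because [lam * v * u] is even. *)
  - move=> m mM; have mg : m <= g.
      move: mM; rewrite (perm_mem pM) !in_cons => /or3P[/eqP->|/eqP->|/(allP hR) mh] //.
      exact: leq_trans mh hhg.
    have := weight_size M2; have := hlam le; rewrite hsum.
    have : ~~ odd (lam * v * u) by rewrite !oddM (negbTE le).
    by move: mg; move: (lam * v * u) (weight M) (size M) => a b c; clear; lia.
  by rewrite hsum -mulnA mulnC.
have [n hv] : exists n, v = 2 * n by exists v./2; move: ev; rewrite oddM lo; clear; lia.
have [m hu] : exists m, u = 2 * m by exists u./2; move: eu; rewrite oddM lo; clear; lia.
have n3 : 3 <= n by move: v5; rewrite hv; clear; lia.
have m3 : 3 <= m by move: u5; rewrite hu; clear; lia.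
pose A := [seq x <- R | x != 2]; pose k := count_mem 2 R.
have pR : perm_eq R (A ++ nseq k 2).
  rewrite perm_sym; apply: perm_trans (permEl (perm_filterC (pred1 2) R)); rewrite perm_catC.
  by rewrite perm_cat2r; have /all_pred1P-> := filter_all (pred1 2) R; rewrite size_filter.
have sM : g + h + sumn A + 2 * k = v * u * lam.
  have <- : lam * v * u = v * u * lam by rewrite -mulnA mulnC.
  by rewrite -hsum (perm_sumn pM) /= (perm_sumn pR) sumn_cat sumn_nseq; clear; lia.
have hnuk : 2 * ((g == 2) + (h == 2) + k) <= v * u * lam - v * u.
  have <- : (lam - 1) * v * u = v * u * lam - v * u by rewrite -mulnA mulnBl mul1n (mulnC lam).
  by move: hnu; rewrite /nu2 (permP pM) /= -/k addnA.
have AE x : x \in A -> [/\ x <= h, 4 <= x & ~~ odd x].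
  rewrite mem_filter => /andP[x2 xR]; have /andP[x0 ox] := allP eR _ xR.
  by split=> //; [exact: (allP hR)|move: x0 x2 ox; clear; lia].
have vu25 : 25 <= v * u by rewrite (leq_mul v5 u5).
have lvu : v * u <= v * u * lam by rewrite leq_pmulr.
(* If [h = 2], all entries except possibly [g] are 2 and [g <= 6]; the bound on the number of
   2-cycles would then force [g >= v * u >= 25]. *)
have h4 : 4 <= h.
  rewrite leqNgt; apply/negP => hh; have h2 : h = 2 by move: hh h0 oh; clear; lia.
  have A0 : A = [::].
    case: A AE {pR sM} => // x A0 /(_ x (mem_head _ _))[xh x4 _].
    by move: (leq_trans x4 xh); rewrite h2.
  move: sM hnuk hg3 vu25 lvu; rewrite A0 h2 /=.
  by move: (v * u * lam) (v * u) (nat_of_bool (g == 2)) (k) => a b c k'; clear; lia.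
apply: reach_perm (_ : reach [:: g, h & A ++ nseq k 2] _) => //.
  by rewrite perm_sym (permPl pM) !perm_cons.
apply: (odd_lists hvu lo hv hu n3 m3 og oh h4 hhg hg3 hb) => //.
  by apply/allP => x /AE[-> -> ->].
have /negbTE h2 : h != 2 by move: h4; clear; lia.
have /negbTE g2 : g != 2 by move: h4 hhg; clear; lia.
move: hnuk sM lvu; rewrite h2 g2 /=.
by move: (v * u * lam) (v * u) (sumn A) (k) => a b s' k'; clear; lia.
Qed.
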